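(* Suppose that $F:D(A^\alpha)\to H$ satisfies $F(0)=0$ and $\|F(u_1)-F(u_2)\|\le L\|A^\alpha(u_1-u_2)\|$ for all $u_1,u_2\in D(A^\alpha)$ with a constant $L>0$, and that there are $n\in\mathbb{N}$ and $k\in(0,\tfrac12)$ such that $$\lambda_{n+1}-\lambda_n\ \ge\ \frac{2L}{k}\left(\lambda_{n+1}^\alpha+\lambda_n^\alpha+c_\alpha(\lambda_{n+1}-\lambda_n)^\alpha\right).$$ Put $\mu=\lambda_n+\frac{2L}{k}\lambda_n^\alpha$. If $g:\mathbb{R}\to D(A^\alpha)$ is almost periodic, then the cocycle $\Phi$ generated by $\frac{du}{dt}+Au=F(u)+g(t)+\frac{dW}{dt}$ has a pathwise almost periodic random inertial manifold $\widetilde{\mathcal M}=\{\widetilde{\mathcal M}(\tau,\omega):\tau\in\mathbb{R},\omega\in\Omega\}$, given by $$\widetilde{\mathcal M}(\tau,\omega)=\{x+z(\omega)+m(\tau,\omega)(x):x\in P_nH\}=\mathcal M(\tau,\omega)+z(\omega).$$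
   Context: Setting. $H$ is a separable Hilbert space with norm $\|\cdot\|$, and $A:D(A)\subseteq H\to H$ is a symmetric positive operator with compact inverse; $\{e_j\}_{j\ge1}$ is an orthonormal basis of $H$ with $Ae_j=\lambda_je_j$, $0<\lambda_1\le\lambda_2\le\cdots$, $\lambda_j\to\infty$. Fix $\alpha\in[0,\tfrac12)$; $D(A^\alpha)$ carries the norm $\|u\|_{D(A^\alpha)}=\|A^\alpha u\|$. $P_n$ is the orthogonal projection of $H$ onto $\mathrm{span}\{e_1,\dots,e_n\}$ and $Q_n=I-P_n$; $e^{-At}$ is defined on $P_nH$ for all $t\in\mathbb{R}$. $c_\alpha=\alpha^\alpha\int_0^\infty s^{-\alpha}e^{-s}ds$ if $\alpha>0$ and $c_\alpha=0$ if $\alpha=0$. $g^\tau(s)=g(s+\tau)$. Noise. $\Omega=\{\omega\in C(\mathbb{R},H):\omega(0)=0\}$ with the compact-open topology, $\mathcal F$ its Borel $\sigma$-algebra, $P$ the Wiener measure of a two-sided $H$-valued Wiener process $W$ with trace class covariance $Q$, and $\theta_t\omega(\cdot)=\omega(\cdot+t)-\omega(t)$. $z:\Omega\to D(A^\alpha)$ is the unique stationary solution of $dz(\theta_t\omega)+Az(\theta_t\omega)\,dt=dW$, taken in a version for which, for every $\omega$, $t\mapsto z(\theta_t\omega)$ is continuous from $\mathbb{R}$ to $D(A^\alpha)$ and $\lim_{t\to-\infty}e^{ct}\|A^\alpha z(\theta_t\omega)\|=0$ for every $c>0$. Solutions and cocycles. For a forcing $h\in L^2_{loc}(\mathbb{R},D(A^\alpha))$,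 $r\in\mathbb{R}$, $v_r\in D(A^\alpha)$, let $v(t)=v(t,r,\omega,h,v_r)$, $t\ge r$, be the unique mild solution in $C([r,\infty),D(A^\alpha))$ of $\frac{dv}{dt}+Av=F(v+z(\theta_t\omega))+h(t)$, $v(r)=v_r$, i.e. $v(t)=e^{-A(t-r)}v_r+\int_r^te^{-A(t-s)}(F(v(s)+z(\theta_s\omega))+h(s))\,ds$. Set $\Psi(t,\tau,\omega,v_0)=v(t,0,\omega,g^\tau,v_0)$ for $t\ge0$. With $u(t,\tau,\omega,g,u_\tau)=v(t,\tau,\omega,g,u_\tau-z(\theta_\tau\omega))+z(\theta_t\omega)$ (a mild solution of the stochastic equation), set $\Phi(t,\tau,\omega,u_0)=u(t+\tau,\tau,\theta_{-\tau}\omega,g,u_0)$; equivalently $\Phi(t,\tau,\omega,u_0)=\Psi(t,\tau,\omega,u_0-z(\omega))+z(\theta_t\omega)$. Both are continuous cocycles on $D(A^\alpha)$ over $(\Omega,\mathcal F,P,\{\theta_t\})$. The sets $\mathcal M(\tau,\omega)$ and maps $m(\tau,\omega)$. Let $\mathcal S=\{\xi\in C((-\infty,0],D(A^\alpha)):\|\xi\|_{\mathcal S}=\sup_{t\le0}e^{\mu t}\|A^\alpha\xi(t)\|<\infty\}$ and $\mathcal M(\tau,\omega)=\{\xi(0):\xi\in\mathcal S,\ v(t,r,\omega,g^\tau,\xi(r))=\xi(t)\text{ for all }r\le t\le0\}$. For $x\in P_nH$ let $\xi^*(x,\omega,\tau)$ be the unique $\xi\in\mathcal S$ with $$\xi(t)=e^{-At}x-\int_t^0e^{-A(t-s)}P_n(F(\xi(s)+z(\theta_s\omega))+g(s+\tau))ds+\int_{-\infty}^te^{-A(t-s)}Q_n(F(\xi(s)+z(\theta_s\omega))+g(s+\tau))ds,\quad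 t\le0,$$ and $m(\tau,\omega):P_nH\to Q_nD(A^\alpha)$, $m(\tau,\omega)(x)=Q_n\xi^*(x,\omega,\tau)(0)$. One has $\mathcal M(\tau,\omega)=\{x+m(\tau,\omega)(x):x\in P_nH\}$. Definition (random inertial manifold). Let $\Phi$ be a cocycle on a separable Banach space $X$ (here $X=D(A^\alpha)$). A family $\mathcal N=\{\mathcal N(\tau,\omega)\}$ of subsets of $X$, measurable in $\omega$ for each fixed $\tau$ (in the usual sense of closed random sets), is a random inertial manifold of $\Phi$ if: (i) there is a finite-dimensional subspace $X_1$ with $X=X_1\oplus X_2$ and a mapping $q:\mathbb{R}\times\Omega\times X_1\to X_2$ with $\mathcal N(\tau,\omega)=\{x+q(\tau,\omega)(x):x\in X_1\}$ for all $\tau,\omega$, where $q(\tau,\omega)(x)$ is measurable in $\omega$ and Lipschitz continuous in $x$; (ii) $\Phi(t,\tau,\omega,\mathcal N(\tau,\omega))=\mathcal N(\tau+t,\theta_t\omega)$ for all $t\ge0$, $\tau$, $\omega$; (iii) for all $\tau,\omega$ and $x\in X$ there is $y=y(\tau,\omega,x)\in\mathcal N(\tau,\omega)$ such that $\|\Phi(t,\tau,\omega,x)-\Phi(t,\tau,\omega,y)\|_X\le c_1e^{-c_2t}$ for all $t\ge0$, with positive numbers $c_1,c_2$ depending on $\tau,\omega,x$. Almost periodicity. A continuous function $g:\mathbb{R}\to X$ is almost periodic if for every $\varepsilon>0$ there is $l=l(\varepsilon)>0$ such that every interval of length $l$ contains a number $t_0$ with $\|g(t+t_0)-g(t)\|_X<\varepsilon$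 for all $t\in\mathbb{R}$. A random inertial manifold $\mathcal N$, given as the graph of $q$ as in (i), is pathwise almost periodic if for every $\varepsilon>0$ there is $l=l(\varepsilon)>0$ such that any interval of length $l$ contains a number $\tau_0$ with $\sup_{x\in X_1}\|q(\tau+\tau_0,\omega)(x)-q(\tau,\omega)(x)\|_X\le\varepsilon$ for all $\tau\in\mathbb{R}$ and $\omega\in\Omega$. *)

(* Defs.v *)
From HB Require Import structures.
From mathcomp Require Import all_boot all_order all_algebra.
From mathcomp Require Import all_classical all_reals all_analysis.
From mathcomp Require Import ring.
From mathcomp Require Import sesquilinear.

Set Implicit Arguments.
Unset Strict Implicit.
Unset Printing Implicit Defensive.

Import Order.TTheory GRing.Theory Num.Theory.
Import numFieldNormedType.Exports.

Local Open Scope classical_set_scope.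
Local Open Scope ring_scope.

(* A real Hilbert space H, an operator opA with domain domA, and its spectral
   data.  The index j : nat of [ebase] and [lam] stands for the mathematical
   index j + 1: [lam 0] is lambda_1.  The values of [opA] outside [domA] are
   irrelevant.  [opA] is injective on [domA] by positivity, and
   [A_compact_inverse] is the compactness of its inverse: the set is the image
   of the closed unit ball. *)
Record setting (R : realType) (H : completeNormedModType R) := Setting {
  ip : {dot H for idfun} ;
  ip_norm : forall u, ip u u = `|u| ^+ 2 ;
  domA : set H ;
  opA : H -> H ;
  domA0 : domA 0 ;
  domA_linear : forall (a : R) u v, domA u -> domA v -> domA (a *: u + v) ;
  A_linear : forall (a : R) u v, domA u -> domA v ->
    opA (a *: u + v) = a *: opA u + opA v ;
  A_symmetric : forall u v, domA u -> domA v -> ip (opA u) v = ip u (opA v) ;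
  A_positive : forall u, domA u -> u != 0 -> 0 < ip (opA u) u ;
  A_onto : forall w, exists2 u, domA u & opA u = w ;
  A_compact_inverse :
    compact (closure [set u | domA u /\ `|opA u| <= 1]) ;
  ebase : nat -> H ;
  lam : nat -> R ;
  e_orthonormal : forall i j, ip (ebase i) (ebase j) = (i == j)%:R ;
  e_basis : forall u, series (fun j => ip u (ebase j) *: ebase j) @ \oo --> u ;
  e_dom : forall j, domA (ebase j) ;
  e_eigen : forall j, opA (ebase j) = lam j *: ebase j ;
  lam_gt0 : forall j, 0 < lam j ;
  lam_nondecr : {homo lam : i j / (i <= j)%N >-> i <= j} ;
  lam_unbounded : lam @ \oo --> +oo ;
  alpha : R ;
  alpha_ge0 : 0 <= alpha ;
  alpha_lt : alpha < 2^-1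
}.

Section FractionalPower.
Context (R : realType) (H : completeNormedModType R) (S : setting H).
Implicit Types (f : nat -> R) (u v : H).

Definition spectral_series f u : nat -> H :=
  series (fun j => (f j * ip S u (ebase S j)) *: ebase S j).

Definition spectral f u : H := limn (spectral_series f u).

Definition Apow : H -> H := spectral (fun j => lam S j `^ alpha S).

(* For t < 0 the series still converges (it is a finite sum) on the range of
   [proj n], which is the only place where negative times are used. *)
Definition semigroup (t : R) : H -> H := spectral (fun j => expR (- lam S j * t)).

Definition proj (n : nat) u : H := \sum_(j < n) ip S u (ebase S j) *: ebase S j.

Definition coproj (n : nat) u : H := u - proj n u.

(* D(A^alpha) = { u | sum_j lam_j^alpha <u, e_j> e_j converges in H }. *)
Definition in_Dalpha : {pred H} :=
  fun u => `[< cvgn (spectral_series (fun j => lam S j `^ alpha S) u) >].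

Lemma in_DalphaP u : reflect
  (cvgn (spectral_series (fun j => lam S j `^ alpha S) u)) (u \in in_Dalpha).
Proof. exact: asboolP. Qed.

Lemma spectral_seriesD f (a : R) u v :
  spectral_series f (a *: u + v) =
  a *: spectral_series f u + spectral_series f v.
Proof.
apply/funext => n; rewrite /spectral_series /series /=.
rewrite !fctE /= scaler_sumr -big_split /=; apply: eq_bigr => j _.
by rewrite linearPl /= mulrDr scalerDl scalerA mulrCA.
Qed.

Lemma spectral_series0 f : spectral_series f 0 = 0.
Proof.
apply/funext => n; rewrite /spectral_series /series /= big1 // => j _.
by rewrite linear0l mulr0 scale0r.
Qed.

Lemma in_Dalpha_submod : submod_closed in_Dalpha.
Proof.
split; first by apply/in_DalphaP; rewrite spectral_series0; apply: is_cvg_cst.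
move=> a u v /in_DalphaP cu /in_DalphaP cv; apply/in_DalphaP.
by rewrite spectral_seriesD; apply: is_cvgD => //; apply: is_cvgZl_tmp.
Qed.

HB.instance Definition _ :=
  GRing.isSubmodClosed.Build R H in_Dalpha in_Dalpha_submod.

End FractionalPower.

Section InnerProductFacts.
Context (R : realType) (H : completeNormedModType R) (S : setting H).

Lemma ip_sym (u v : H) : ip S u v = ip S v u.
Proof. by rewrite hermC /= expr0 mul1r. Qed.

Lemma ipDl (u v w : H) : ip S (u + v) w = ip S u w + ip S v w.
Proof. exact: linearDl. Qed.

Lemma ipNl (u w : H) : ip S (- u) w = - ip S u w.
Proof. exact: linearNl. Qed.

Lemma ip0l (w : H) : ip S 0 w = 0.
Proof. exact: linear0l. Qed.

Lemma ipZl (a : R) (u w : H) : ip S (a *: u) w = a * ip S u w.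
Proof. exact: linearZl_LR. Qed.

Lemma ip_suml (I : Type) (r : seq I) (P : pred I) (f : I -> H) (w : H) :
  ip S (\sum_(i <- r | P i) f i) w = \sum_(i <- r | P i) ip S (f i) w.
Proof. exact: linear_sumlz. Qed.

Lemma ip_polar (u v : H) :
  ip S u v = (`|u + v| ^+ 2 - `|u - v| ^+ 2) / 4.
Proof.
rewrite -!(ip_norm S) !ipDl !(ip_sym _ (_ + _)) !ipDl.
by rewrite !(ip_sym _ (- v)) !ipNl !(ip_sym _ (- v)) !ipNl (ip_sym v u); field.
Qed.

Lemma ip_cvg (T : Type) (F : set_system T) {FF : Filter F}
    (f : T -> H) (w v : H) :
  f x @[x --> F] --> w -> ip S (f x) v @[x --> F] --> ip S w v.
Proof.
move=> fw; under eq_fun do rewrite ip_polar.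
rewrite ip_polar; apply: cvgMl; apply: cvgB; rewrite expr2; under eq_fun do rewrite expr2.
  by apply: cvgM; apply: cvg_norm; apply: cvgD => //; exact: cvg_cst.
by apply: cvgM; apply: cvg_norm; apply: cvgB => //; exact: cvg_cst.
Qed.

Lemma ip_partial_sum (c : nat -> R) n i : (i < n)%N ->
  ip S (series (fun j => c j *: ebase S j) n) (ebase S i) = c i.
Proof.
move=> ltin; rewrite /series /= ip_suml big_mkord (bigD1 (Ordinal ltin)) //=.
rewrite ipZl e_orthonormal eqxx mulr1 big1 ?addr0 // => j ji.
rewrite ipZl e_orthonormal.
by have /negbTE -> : (j : nat) != i by []; rewrite mulr0.
Qed.

Lemma norm_partial_sum (c : nat -> R) n :
  `|series (fun j => c j *: ebase S j) n| ^+ 2 = \sum_(0 <= j < n) c j ^+ 2.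
Proof.
rewrite -(ip_norm S) {1}/series /= ip_suml !big_mkord.
apply: eq_bigr => i _; by rewrite ipZl ip_sym ip_partial_sum // expr2.
Qed.

End InnerProductFacts.

Record Dalpha (R : realType) (H : completeNormedModType R) (S : setting H) :=
  MkDalpha { Dval : H ; Dval_in : Dval \in in_Dalpha S }.

Section DalphaSpace.
Context (R : realType) (H : completeNormedModType R) (S : setting H).

HB.instance Definition _ := [isSub for @Dval R H S].
HB.instance Definition _ := [Choice of Dalpha S by <:].
HB.instance Definition _ := [SubChoice_isSubLmodule of Dalpha S by <:].

Implicit Types (u v : Dalpha S).

Let cvA u : cvgn (spectral_series S (fun j => lam S j `^ alpha S) (Dval u)).
Proof. by apply/in_DalphaP; exact: Dval_in. Qed.

Lemma Apow_linear (a : R) u v :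
  Apow S (Dval (a *: u + v)) = a *: Apow S (Dval u) + Apow S (Dval v).
Proof.
rewrite /Apow /spectral.
have -> : Dval (a *: u + v) = a *: Dval u + Dval v by [].
rewrite spectral_seriesD; apply/cvg_lim => //.
by apply: cvgD; [apply: cvgZl_tmp|]; exact: cvA.
Qed.

Lemma Apow_coef u j :
  ip S (Apow S (Dval u)) (ebase S j) = lam S j `^ alpha S * ip S (Dval u) (ebase S j).
Proof.
have h1 : ip S (spectral_series S (fun j => lam S j `^ alpha S) (Dval u) n)
    (ebase S j) @[n --> \oo] --> ip S (Apow S (Dval u)) (ebase S j).
  by apply: ip_cvg; exact: cvA.
have h2 : ip S (spectral_series S (fun j => lam S j `^ alpha S) (Dval u) n)
    (ebase S j) @[n --> \oo] --> lam S j `^ alpha S * ip S (Dval u) (ebase S j).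
  apply: cvg_near_cst; near=> n; rewrite /spectral_series ip_partial_sum //.
  by near: n; exists j.+1.
by rewrite -[RHS](cvg_lim _ h2) // -[LHS](cvg_lim _ h1).
Unshelve. all: by end_near. Qed.

Lemma ip_ebase_inj (x y : H) :
  (forall j, ip S x (ebase S j) = ip S y (ebase S j)) -> x = y.
Proof.
move=> xy; rewrite -(cvg_lim _ (@e_basis R H S x)) // -(cvg_lim _ (@e_basis R H S y)) //.
by congr (limn _); apply/funext => n; apply: eq_bigr => j _; rewrite xy.
Qed.

Lemma lam_powR_gt0 j : 0 < lam S j `^ alpha S.
Proof. by rewrite powR_gt0 // lam_gt0. Qed.

Lemma Dval_inj : injective (@Dval R H S).
Proof. exact: val_inj. Qed.

Definition Dnorm u : R := `|Apow S (Dval u)|.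

Lemma DnormD u v : Dnorm (u + v) <= Dnorm u + Dnorm v.
Proof.
by rewrite /Dnorm -[u in Dval (u + v)]scale1r Apow_linear scale1r ler_normD.
Qed.

Lemma Apow_linear0 : Apow S (Dval (0 : Dalpha S)) = 0.
Proof.
have := Apow_linear 1 0 0; rewrite !scale1r addr0 => /eqP.
by rewrite -subr_eq subrr eq_sym => /eqP.
Qed.

Lemma DnormZ (a : R) u : Dnorm (a *: u) = `|a| * Dnorm u.
Proof.
by rewrite /Dnorm -[a *: u]addr0 Apow_linear Apow_linear0 addr0 normrZ.
Qed.

Lemma Dnorm0_eq0 u : Dnorm u = 0 -> u = 0.
Proof.
move=> /normr0_eq0 u0; apply: Dval_inj; apply: ip_ebase_inj => j.
have := Apow_coef u j; rewrite u0 ip0l => /esym/eqP.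
by rewrite mulf_eq0 gt_eqF ?lam_powR_gt0 //= => /eqP ->.
Qed.

HB.instance Definition _ :=
  Lmodule_isNormed.Build R (Dalpha S) DnormD DnormZ Dnorm0_eq0.

Lemma DnormE u : `|u| = `|Apow S (Dval u)|.
Proof. by []. Qed.

Lemma DnormB u v : `|u - v| = `|Apow S (Dval u) - Apow S (Dval v)|.
Proof.
by rewrite DnormE addrC -scaleN1r Apow_linear scaleN1r addrC.
Qed.

Lemma norm_le_Dnorm u : `|Dval u| <= (lam S 0 `^ alpha S)^-1 * `|u|.
Proof.
pose c := (lam S 0 `^ alpha S)^-1.
pose f := fun j => lam S j `^ alpha S.
have cu : `|series (fun j => ip S (Dval u) (ebase S j) *: ebase S j) n|
    @[n --> \oo] --> `|Dval u| by apply: cvg_norm; exact: e_basis.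
have cAu : c * `|spectral_series S f (Dval u) n| @[n --> \oo] --> c * `|u|.
  by apply: cvgM; [exact: cvg_cst|apply: cvg_norm; exact: cvA].
rewrite -(cvg_lim _ cu) // -(cvg_lim _ cAu) //.
apply: ler_lim; [by apply/cvg_ex; eexists; exact: cu|by apply/cvg_ex; eexists; exact: cAu|].
near=> n; rewrite -[leLHS]ger0_norm // -[leRHS]ger0_norm; last first.
  by rewrite mulr_ge0 // invr_ge0 ltW // lam_powR_gt0.
rewrite -ler_sqr ?qualifE //= !ger0_norm //; last first.
  by rewrite mulr_ge0 // invr_ge0 ltW // lam_powR_gt0.
rewrite exprMn !norm_partial_sum mulr_sumr; apply: ler_sum => j _.
rewrite -exprMn mulrA [leRHS]exprMn ler_peMl ?sqr_ge0 // -[leLHS](expr1n _ 2).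
rewrite ler_sqr ?qualifE //= ?mulr_ge0 ?invr_ge0 ?(ltW (lam_powR_gt0 _)) //.
rewrite mulrC ler_pdivlMr ?lam_powR_gt0 // mul1r.
by apply: ge0_ler_powR; rewrite ?qualifE /= ?alpha_ge0 ?(ltW (lam_gt0 _ _)) ?lam_nondecr.
Unshelve. all: by end_near. Qed.

Lemma Apow_eq (u w : H) :
  (forall j, lam S j `^ alpha S * ip S u (ebase S j) = ip S w (ebase S j)) ->
  spectral_series S (fun j => lam S j `^ alpha S) u @ \oo --> w.
Proof.
move=> uw; rewrite /spectral_series.
under [X in series X]eq_fun do rewrite uw.
exact: e_basis.
Qed.

Lemma Dalpha_complete (F : set_system (Dalpha S)) :
  ProperFilter F -> cauchy F -> cvg F.
Proof.
move=> FF /cauchy_ballP Fc.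
have cauchy_image (h : Dalpha S -> H) (c : R) : 0 < c ->
    (forall x y, `|h x - h y| <= c * `|x - y|) -> cvg (h @ F).
  move=> c0 hc; apply: cauchy_cvg; apply/cauchy_ballP => eps eps0.
  have [//|[B1 B2] /= [FB1 FB2] B12] := Fc (eps / c) _; first by rewrite divr_gt0.
  exists (h @` B1, h @` B2) => /=.
    by split; [apply: filterS FB1|apply: filterS FB2] => x Bx /=; exists x.
  move=> [_ _] /= [[x Bx <-] [y By <-]].
  have := B12 (x, y) (conj Bx By); rewrite -!ball_normE /ball_ /= => xy.
  by rewrite (le_lt_trans (hc x y)) // mulrC -ltr_pdivlMr.
have /cvg_ex[w Aw] : cvg ((Apow S \o Dval (S := S)) @ F).
  by apply: (cauchy_image _ 1) => // x y; rewrite mul1r -DnormB.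
have /cvg_ex[u Du] : cvg (Dval (S := S) @ F).
  apply: (cauchy_image _ (lam S 0 `^ alpha S)^-1) => [|x y].
    by rewrite invr_gt0 lam_powR_gt0.
  exact: norm_le_Dnorm (x - y).
have uw j : lam S j `^ alpha S * ip S u (ebase S j) = ip S w (ebase S j).
  have h1 : ip S (Apow S (Dval x)) (ebase S j) @[x --> F] --> ip S w (ebase S j).
    exact: ip_cvg.
  have h2 : ip S (Apow S (Dval x)) (ebase S j) @[x --> F] -->
      lam S j `^ alpha S * ip S u (ebase S j).
    under eq_fun do rewrite Apow_coef.
    by apply: cvgM; [exact: cvg_cst|exact: ip_cvg].
  by rewrite -(cvg_lim _ h1) // -(cvg_lim _ h2).
have cuw := Apow_eq uw.
have uD : u \in in_Dalpha S by apply/in_DalphaP/cvg_ex; exists w; exact: cuw.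
apply/cvg_ex; exists (MkDalpha uD); apply/cvgrPdist_lt => eps eps0.
have Auw : Apow S u = w by apply: cvg_lim cuw.
near=> x; rewrite DnormB /= Auw; near: x.
by move/cvgrPdist_lt : Aw => /(_ _ eps0).
Unshelve. all: by end_near. Qed.

HB.instance Definition _ := Uniform_isComplete.Build (Dalpha S) Dalpha_complete.

Lemma ebase_in_Dalpha j : ebase S j \in in_Dalpha S.
Proof.
apply/in_DalphaP/cvg_ex; exists (lam S j `^ alpha S *: ebase S j).
apply: Apow_eq => i; rewrite ipZl !e_orthonormal.
by have [->|_] := eqVneq j i; rewrite ?mulr0.
Qed.

Definition Dbase j : Dalpha S := MkDalpha (ebase_in_Dalpha j).

Definition Dproj (n : nat) u : Dalpha S :=
  \sum_(j < n) ip S (Dval u) (ebase S j) *: Dbase j.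

Definition Dcoproj (n : nat) u : Dalpha S := u - Dproj n u.

Definition PnH (n : nat) : set (Dalpha S) := range (Dproj n).

End DalphaSpace.

Arguments PnH {R H} S n.

Definition borel (T : ptopologicalType) : measurableType _ :=
  g_sigma_algebraType (@open T).

(* H is separable, so Borel measurability together with integrability of the
   norm is Bochner integrability, and the Bochner integral is the vector whose
   inner products are the scalar integrals. *)
Definition is_integral (R : realType) (H : completeNormedModType R)
    (S : setting H) (D : set R) (f : R -> H) (I : H) : Prop :=
  [/\ measurable_fun D (f : R -> borel H),
      (\int[lebesgue_measure]_(s in D) (`|f s|)%:E < +oo)%E
    & forall y, ip S I y = \int[lebesgue_measure]_(s in D) ip S (f s) y].

Section Noise.
Context (R : realType) (H : completeNormedModType R).

Record wpath := Wpath {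
  wpath_fun :> R -> H ;
  wpath_continuous : continuous wpath_fun ;
  wpath_at0 : wpath_fun 0 = 0
}.

HB.instance Definition _ := gen_eqMixin wpath.
HB.instance Definition _ := gen_choiceMixin wpath.

Lemma path0_continuous : continuous (fun _ : R => 0 : H).
Proof. by move=> x; exact: cvg_cst. Qed.

HB.instance Definition _ := isPointed.Build wpath (Wpath path0_continuous erefl).

(* The subspace topology induced by the compact-open topology of R -> H. *)
Definition wpath_open : set (set wpath) :=
  [set U | exists2 O : set {compact-open, R -> H},
     open O & U = [set w : wpath | O (w : R -> H)]].

Definition Omega : measurableType _ := g_sigma_algebraType wpath_open.

Lemma shift_continuous (w : wpath) (t : R) :
  continuous (fun s => w (s + t) - w t).
Proof.
move=> s; apply: cvgB; last exact: cvg_cst.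
apply: (cvg_comp (fun r => r + t) w); last exact: wpath_continuous.
by apply: cvgD; [exact: cvg_id|exact: cvg_cst].
Qed.

Lemma shift_at0 (w : wpath) (t : R) : w (0 + t) - w t = 0.
Proof. by rewrite add0r subrr. Qed.

Definition theta (t : R) (w : Omega) : Omega :=
  Wpath (@shift_continuous w t) (shift_at0 w t).

End Noise.

Section Wiener.
Context (R : realType) (H : completeNormedModType R) (S : setting H).

(* Borel law N(0, v); [normal_prob] is not the point mass when v = 0. *)
Definition gaussian (v : R) (B : set R) : \bar R :=
  if v == 0 then \d_(0 : R) B else normal_prob 0 (Num.sqrt v) B.

Definition trace_class_covariance (Q : {linear H -> H}) : Prop :=
  [/\ continuous Q,
      forall u v, ip S (Q u) v = ip S u (Q v),
      forall u, 0 <= ip S (Q u) u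
    & cvgn (series (fun j => ip S (Q (ebase S j)) (ebase S j)))].

(* The coordinate process W(t, w) = w t, t in R, has independent increments of
   law N(0, (t - s) Q) and W(0) = 0, i.e. is a two-sided Q-Wiener process. *)
Definition wiener_measure (Q : {linear H -> H}) (P : probability (Omega H) R) :
    Prop :=
  (forall (s t : R) (y : H) (B : set R), s < t -> measurable B ->
     P [set w : wpath H | B (ip S (w t - w s) y)] =
     gaussian ((t - s) * ip S (Q y) y) B) /\
  (forall (k : nat) (t : nat -> R) (B : nat -> set (borel H)),
     {homo t : i j / (i < j)%N >-> i < j} -> (forall i, measurable (B i)) ->
     P (\bigcap_(i in `I_k) [set w : wpath H | B i (w (t i.+1) - w (t i))]) =
     (\prod_(i < k) P [set w : wpath H | B i (w (t i.+1) - w (t i))%R])%E).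

(* Stationary solution t |-> z (theta t w) of dz + A z dt = dW: the equation is
   tested against y in D(A) (for additive noise no stochastic integral then
   remains) and holds almost surely, whereas continuity and temperedness hold
   for every w. *)
Definition stationary_OU (P : probability (Omega H) R)
    (z : Omega H -> Dalpha S) : Prop :=
  [/\ measurable_fun setT (z : Omega H -> borel (Dalpha S)),
      {ae P, forall w : Omega H, forall (s t : R) (y : H), s <= t -> domA S y ->
         ip S (Dval (z (theta t w))) y - ip S (Dval (z (theta s w))) y
         + \int[lebesgue_measure]_(r in `[s, t])
             ip S (Dval (z (theta r w))) (opA S y)
         = ip S ((w : wpath H) t - (w : wpath H) s) y},
      forall w, continuous (fun t => z (theta t w))
    & forall w (c : R), 0 < c ->
        expR (c * t) * `|z (theta t w)| @[t --> -oo] --> (0 : R)].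

End Wiener.

Section Dynamics.
Context (R : realType) (H : completeNormedModType R) (S : setting H).
Local Notation X := (Dalpha S).
Context (F : X -> H) (z : Omega H -> X).

Definition is_mild (w : Omega H) (h : R -> X) (r : R) (vr : X) (v : R -> X) :
    Prop :=
  {within `[r, +oo[, continuous v} /\
  forall t, r <= t -> exists2 I : H,
    is_integral S `[r, t] (fun s => semigroup S (t - s)
      (F (v s + z (theta s w)) + Dval (h s))) I
    & Dval (v t) = semigroup S (t - r) (Dval vr) + I.

(* v(t, r, w, h, v_r); mild solutions are unique on [r, +oo[. *)
Definition vsol (t r : R) (w : Omega H) (h : R -> X) (vr : X) : X :=
  xget (fun=> 0) [set v | is_mild w h r vr v] t.

Definition usol (t tau : R) (w : Omega H) (g : R -> X) (utau : X) : X :=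
  vsol t tau w g (utau - z (theta tau w)) + z (theta t w).

Definition Phi (g : R -> X) (t tau : R) (w : Omega H) (u0 : X) : X :=
  usol (t + tau) tau (theta (- tau) w) g u0.

(* The space S of weighted continuous functions on ]-oo, 0]; only the values of
   xi on ]-oo, 0] matter. *)
Definition in_S (mu : R) (xi : R -> X) : Prop :=
  {within `]-oo, 0], continuous xi} /\
  exists C : R, forall t, t <= 0 -> expR (mu * t) * `|xi t| <= C.

Definition Mset (mu : R) (g : R -> X) (tau : R) (w : Omega H) : set X :=
  [set y | exists xi : R -> X, [/\ in_S mu xi,
     forall r t, r <= t -> t <= 0 ->
       vsol t r w (fun s => g (s + tau)) (xi r) = xi t
   & xi 0 = y]].

Definition lyapunov_perron (n : nat) (mu : R) (g : R -> X) (x : X)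
    (w : Omega H) (tau : R) (xi : R -> X) : Prop :=
  let f s := F (xi s + z (theta s w)) + Dval (g (s + tau)) in
  in_S mu xi /\
  forall t, t <= 0 -> exists I J : H,
    [/\ is_integral S `[t, 0] (fun s => semigroup S (t - s) (proj S n (f s))) I,
        is_integral S `]-oo, t]
          (fun s => semigroup S (t - s) (coproj S n (f s))) J
      & Dval (xi t) = semigroup S t (Dval x) - I + J].

Definition xi_star n mu g x w tau : R -> X :=
  xget (fun=> 0) [set xi | lyapunov_perron n mu g x w tau xi].

Definition mmap n mu g (tau : R) (w : Omega H) (x : X) : X :=
  Dcoproj n (xi_star n mu g x w tau 0).

End Dynamics.

Definition c_const (R : realType) (a : R) : R :=
  if a == 0 then 0 else
  a `^ a * \int[lebesgue_measure]_(s in `]0, +oo[) (s `^ (- a) * expR (- s)).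

Section InertialManifolds.
Context (R : realType) (X : completeNormedModType R).

Definition almost_periodic (g : R -> X) : Prop :=
  continuous g /\
  forall eps : R, 0 < eps -> exists2 l : R, 0 < l &
    forall a, exists2 t0, t0 \in `[a, a + l] &
      forall t, `|g (t + t0) - g t| < eps.

Definition linear_subspace (V : set X) : Prop :=
  V 0 /\ forall (a : R) x y, V x -> V y -> V (a *: x + y).

Definition finite_dimensional (V : set X) : Prop :=
  exists (d : nat) (b : 'I_d -> X),
    V = [set x | exists c : 'I_d -> R, x = \sum_(i < d) c i *: b i].

Definition direct_sum (X1 X2 : set X) : Prop :=
  (forall x, exists x1 x2, [/\ X1 x1, X2 x2 & x = x1 + x2]) /\
  X1 `&` X2 = [set 0].

Context (d : measure_display) (T : measurableType d) (th : R -> T -> T).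
Context (Psi : R -> R -> T -> X -> X).

(* Measurability of a closed random set: w |-> dist(x, N w) is measurable for
   every x. *)
Definition closed_random_set (N : T -> set X) : Prop :=
  (forall w, closed (N w)) /\
  forall x, measurable_fun setT (fun w => inf [set `|x - y| | y in N w]).

(* [q tau w] is only relevant on X1. *)
Definition inertial_manifold_graph (N : R -> T -> set X) (X1 X2 : set X)
    (q : R -> T -> X -> X) : Prop :=
  [/\ [/\ linear_subspace X1, linear_subspace X2, finite_dimensional X1
         & direct_sum X1 X2],
      [/\ forall tau w x, X1 x -> X2 (q tau w x),
          forall tau w, N tau w = [set x + q tau w x | x in X1],
          forall tau x, X1 x ->
            measurable_fun setT ((fun w => q tau w x) : T -> borel X)
        & forall tau w, exists K : R, K.-lipschitz_X1 (q tau w)],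
      forall tau, closed_random_set (N tau),
      forall t tau w, 0 <= t -> Psi t tau w @` N tau w = N (tau + t) (th t w)
    & forall tau w x, exists2 y, N tau w y &
        exists c1 c2 : R, [/\ 0 < c1, 0 < c2 & forall t, 0 <= t ->
          `|Psi t tau w x - Psi t tau w y| <= c1 * expR (- c2 * t)]].

Definition pathwise_almost_periodic (X1 : set X) (q : R -> T -> X -> X) : Prop :=
  forall eps : R, 0 < eps -> exists2 l : R, 0 < l &
    forall a, exists2 tau0, tau0 \in `[a, a + l] &
      forall tau w x, X1 x -> `|q (tau + tau0) w x - q tau w x| <= eps.

Definition pap_random_inertial_manifold (N : R -> T -> set X) : Prop :=
  exists X1 X2 q,
    inertial_manifold_graph N X1 X2 q /\ pathwise_almost_periodic X1 q.

End InertialManifolds.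

(* Main.v *)
(* Lyapunov-Perron method.  In spectral coordinates the equation on the half
   line t <= 0 with e^(mu t) u bounded, mu in the spectral gap, is a fixed point
   equation u = J + G N(u), where the j-th coordinate of the Green operator G is
   convolution with a one-sided exponential (forward for j >= n, backward for
   j < n).  Every coordinate of the kernel, multiplied by lam_j^alpha, is bounded
   by one scalar kernel kappa, and the gap condition yields
   L * int kappa(s) e^(-mu s) ds <= k < 1/2, so that G N contracts the space of
   functions with weight e^(mu t).  Working with coordinates, the Bochner
   integrals of the statement reduce to scalar ones by Riesz-Fischer.
   The graph property, the Lipschitz bound and the almost periodicity in tau are
   the stability of this fixed point in its data; the last one is uniform in
   omega because the noise cancels in the difference of two equations.  Tracking
   orbits come from a similar fixed point problem on the whole line.
   Measurability in omega holds since the fixed point is a pointwise limit of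
   Picard iterates, whose coordinates are integrals of Caratheodory functions,
   and since theta_t is continuous for the compact-open topology.  With
   splitting index 0 the same contraction solves the initial value problem. *)
Require Import Defs.
From mathcomp Require Import all_boot all_order all_algebra.
From mathcomp Require Import all_classical all_reals all_analysis.
From mathcomp Require Import measurable_realfun.
From mathcomp Require Import ring lra.

Set Implicit Arguments.
Unset Strict Implicit.
Unset Printing Implicit Defensive.

Import Order.TTheory GRing.Theory Num.Theory.
Import numFieldNormedType.Exports.

Local Open Scope classical_set_scope.
Local Open Scope ring_scope.

(** F takes values in H only, so the Green operator has to gain the power alpha. With y = lambda_j -
    lambda_(n+1), lambda_j^alpha is at most lambda_(n+1)^alpha + y^alpha, and y^alpha e^(-y s) <=
    alpha^alpha s^(-alpha); integrating this singularity produces c_alpha. The exponent mu is placed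
    so that each half of the kernel has weighted integral at most k/(2L). [vsol] and [xi_star] are
    picked by a choice operator, and only their values on a half-line matter. They are therefore
    compared with continuous functions on the whole line, for which being a solution is a
    coordinatewise variation-of-constants relation between any two times ([evol]); membership in M
    and the Lyapunov-Perron equation are related through it. Sources are switched off outside the
    relevant times, which is why they are only asked to be continuous off a finite set. Translation
    by z(omega) moves base points by P_n z(omega), so m must be measurable along random base points,
    not only at fixed x. *)

Lemma le_of_eq d (T : porderType d) (x y : T) : x = y -> (x <= y)%O.
Proof. by move->. Qed.

(** * The scalar Green kernel *)

Section LebesgueAffine.
Context {R : realType}.
Local Notation mu := (@lebesgue_measure R).
Local Open Scope ereal_scope.

Lemma measurable_affine (a b : R) :
  measurable_fun setT ((fun s => a * s + b)%R : measurableTypeR R -> measurableTypeR R).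
Proof.
apply: continuous_measurable_fun => x.
apply: cvgD; last exact: cvg_cst.
by apply: cvgM; [exact: cvg_cst|exact: cvg_id].
Qed.

(** Scaled by a, the image of Lebesgue measure under s -> a s + b gives each half-open interval its
    length, hence is Lebesgue measure by uniqueness. *)
Lemma ge0_integral_affine (a b : R) (f : R -> \bar R) : (0 < a)%R ->
  measurable_fun setT f -> (forall s, 0 <= f s) ->
  \int[mu]_s f s = a%:E * \int[mu]_s f (a * s + b)%R.
Proof.
move=> a0 mf f0; have mphi := measurable_affine a b.
have := ge0_integral_pushforward mphi mu measurableT mf (fun y _ => f0 y).
rewrite preimage_setT /comp => <-.
rewrite -[RHS](@ge0_integral_mscale _ _ _ _ setT measurableT (NngNum (ltW a0)))//.
apply: eq_measure_integral => A mA _.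
apply: lebesgue_measure_unique mA => // _ [[c d]] _ <-.
rewrite /= /mscale /= /pushforward.
have -> : (fun s => a * s + b)%R @^-1` `]c, d] = [set` Interval (BRight ((c - b) / a)%R) (BRight ((d - b) / a)%R)].
  apply/seteqP; split => s /=; rewrite !in_itv /= ltr_pdivrMr// ler_pdivlMr//;
  by rewrite ltrBlDr lerBrDr [(a * s)%R]mulrC.
rewrite !lebesgue_measure_itv /= !lte_fin ltr_pM2r ?invr_gt0// ltrBlDr subrK.
case: ifP => _; last by rewrite mule0.
by rewrite -!EFinD -EFinM; congr EFin; field; rewrite gt_eqF.
Qed.

Lemma integral_shift (b : R) (f : R -> \bar R) :
  measurable_fun setT f ->
  \int[mu]_s f (s + b)%R = \int[mu]_s f s.
Proof.
move=> mf; rewrite [LHS]integralE [RHS]integralE.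
have h g : measurable_fun setT g -> (forall s, 0 <= g s) ->
    \int[mu]_s g s = \int[mu]_s g (s + b)%R.
  move=> mg g0; rewrite (@ge0_integral_affine 1 b) // mul1e.
  by apply: eq_integral => s _; rewrite mul1r.
congr (_ - _).
- have E := h (funepos f) (measurable_funepos mf) (fun s => funepos_ge0 f s).
  by apply: etrans (esym E); apply: eq_integral => s _; rewrite !funeposE.
- have E := h (funeneg f) (measurable_funeneg mf) (fun s => funeneg_ge0 f s).
  by apply: etrans (esym E); apply: eq_integral => s _; rewrite !funenegE.
Qed.

Lemma measurable_shift (b : R) :
  measurable_fun setT ((fun s => s + b)%R : measurableTypeR R -> measurableTypeR R).
Proof.
rewrite (_ : (fun s => _) = (fun s => 1 * s + b)%R); first exact: measurable_affine.
by apply/funext => s; rewrite mul1r.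
Qed.

Lemma integrable_shift (b : R) (f : R -> R) :
  mu.-integrable setT (EFin \o f) ->
  mu.-integrable setT (EFin \o (fun s => f (s + b)%R)).
Proof.
move=> /integrableP [mf fi]; apply/integrableP; split.
  exact: (measurableT_comp mf (measurable_shift b)).
by rewrite (@integral_shift b (fun x => `|(EFin \o f) x|)) //; exact: measurableT_comp.
Qed.

Lemma Rintegral_shift (b : R) (f : R -> R) :
  measurable_fun setT f ->
  (\int[mu]_s f (s + b) = \int[mu]_s f s)%R.
Proof.
move=> mf; congr fine.
by rewrite (integral_shift b (f := EFin \o f))//; exact/measurable_EFinP.
Qed.

Lemma ge0_integral_opp (f : R -> \bar R) :
  measurable_fun setT f -> (forall s, 0 <= f s) ->
  \int[mu]_s f (- s)%R = \int[mu]_s f s.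
Proof.
move=> mf f0; have mN : measurable_fun setT (-%R : measurableTypeR R -> measurableTypeR R).
  exact: oppr_measurable.
have := ge0_integral_pushforward mN mu measurableT mf (fun y _ => f0 y).
rewrite preimage_setT /comp => <-.
by apply: eq_measure_integral => A mA _; exact: lebesgue_measureN.
Qed.

End LebesgueAffine.

(** * Singular exponential integrals and the constant c_alpha *)

Section GammaConstant.
Context {R : realType}.
Local Notation mu := (@lebesgue_measure R).
Implicit Types (a x y s d : R).

(** After division by x + y: a number w in [0, 1] satisfies w <= w^a, and the two fractions add up
    to 1. *)
Lemma powR_subadditive a x y : 0 <= a -> a <= 1 -> 0 <= x -> 0 <= y ->
  (x + y) `^ a <= x `^ a + y `^ a.
Proof.
move=> a0 a1 x0 y0; have [s0|s0] := eqVneq (x + y) 0.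
  have : (x == 0) && (y == 0) by rewrite -paddr_eq0// s0.
  by move=> /andP[/eqP-> /eqP->]; rewrite addr0 lerDl powR_ge0.
have sp : 0 < x + y by rewrite lt_neqAle eq_sym s0 addr_ge0.
have key w : 0 <= w -> w <= x + y -> w / (x + y) <= (w / (x + y)) `^ a.
  move=> w0 ws; have [->|wn0] := eqVneq w 0; first by rewrite mul0r powR_ge0.
  apply: ger1_powR => //; rewrite divr_gt0//=; last by rewrite lt_neqAle eq_sym wn0.
  by rewrite ler_pdivrMr// mul1r.
have := lerD (key x x0 ltac:(by rewrite lerDl)) (key y y0 ltac:(by rewrite lerDr)).
rewrite -mulrDl divff// !powRM ?invr_ge0 ?addr_ge0// -mulrDl => h.
rewrite -[leLHS]mul1r -ler_pdivlMr ?powR_gt0//; apply: (le_trans h).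
by rewrite -powRN -powR_inv1 ?addr_ge0// -powRrM mulN1r.
Qed.

(* a^a e^(-a) is the maximum of y^a e^(-y); the value 0 at a = 0, where no
   singular term is needed, agrees with [c_const]. *)
Definition singular_coef a : R := if a == 0 then 0 else a `^ a.

Lemma singular_coef_ge0 a : 0 <= singular_coef a.
Proof. by rewrite /singular_coef; case: ifP => // _; rewrite powR_ge0. Qed.

(** Raise (y s / a) e^(-y s / a) <= 1, a consequence of 1 + x <= e^x, to the power a. Giving up the
    factor e^(-a) of the sharp bound leaves the a^a of c_alpha. *)
Lemma powR_exp_le a y s : 0 < a -> 0 <= y -> 0 < s ->
  y `^ a * expR (- (y * s)) <= singular_coef a * s `^ (- a).
Proof.
move=> ap y0 s0; have a0 := ltW ap; have an0 := lt0r_neq0 ap.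
rewrite /singular_coef (gt_eqF ap) powRN.
have ys0 : 0 <= y * s / a by rewrite !mulr_ge0// ?invr_ge0 ltW.
have /eqP yE : y `^ a == a `^ a * (s `^ a)^-1 * (y * s / a) `^ a.
  rewrite !powRM ?mulr_ge0 ?invr_ge0 ?(ltW ap) ?(ltW s0)//.
  have -> : (a^-1) `^ a = (a `^ a)^-1.
    by rewrite -powR_inv1 ?(ltW ap)// -powRrM mulN1r powRN.
  by apply/eqP; field; rewrite !gt_eqF ?powR_gt0.
rewrite yE -mulrA ler_piMr ?mulr_ge0 ?invr_ge0 ?powR_ge0//.
have -> : expR (- (y * s)) = expR (- (y * s / a)) `^ a.
  by rewrite /powR gt_eqF ?expR_gt0// expRK; congr expR; field.
rewrite -powRM ?expR_ge0// (_ : 1 = 1 `^ a); last by rewrite powR1.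
apply: ge0_ler_powR => //; [by rewrite nnegrE mulr_ge0// expR_ge0|by rewrite nnegrE|].
rewrite expRN ler_pdivrMr ?expR_gt0// mul1r.
by apply: le_trans (expR_ge1Dx _); rewrite lerDr.
Qed.

(** Monotone convergence along the segments [1/(i+1), 1], on which the primitive s^(1-a)/(1-a)
    bounds every integral by 1/(1-a). *)
Lemma powR_singular_int a : 0 <= a -> a < 1 ->
  (\int[mu]_(s in `]0%R, 1%R]) (s `^ (- a))%:E < +oo)%E.
Proof.
move=> a0 a1.
have cpow t c : 0 < t -> {for t, continuous (fun s : R => s `^ c)}.
  move=> t0; apply: differentiable_continuous; apply/derivable1_diffP.
  by apply: derivable_powR; rewrite in_itv /= andbT.
pose E i := `[(i.+1%:R^-1 : R), 1%R]%classic.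
have -> : `]0%R, 1%R]%classic = \bigcup_i E i.
  apply/seteqP; split => [s /= | s [i _]] /=; rewrite !in_itv /=.
    move=> /andP[s0 s1]; have [i _ /= Hi] := @near_infty_natSinv_lt R (PosNum s0).
    exists i => //=; rewrite /E /= in_itv /= s1 andbT ltW//; exact: Hi (leqnn i).
  by rewrite /E /= in_itv /= => /andP[si s1]; rewrite s1 andbT (lt_le_trans _ si).
have nd : nondecreasing_seq E.
  move=> i j ij; rewrite subsetEset => s; rewrite /E /= !in_itv /= => /andP[si ->].
  by rewrite andbT (le_trans _ si)// lef_pV2 ?posrE// ler_nat.
have mE i : measurable (E i) by exact: measurable_itv.
have mf i : measurable_fun (E i) (fun s : R => (s `^ (- a))%:E).
  by apply/measurable_EFinP/measurable_funTS; exact: measurable_powR.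
have f0 i s : E i s -> (0 <= (s `^ (- a))%:E)%E by rewrite lee_fin powR_ge0.
have /cvg_lim <- // := ge0_nondecreasing_set_cvg_integral nd mE mf f0 (mu := mu).
have bnd i : (\int[mu]_(s in E i) (s `^ (- a))%:E <= ((1 - a)^-1)%:E)%E.
  pose G (s : R) := (1 - a)^-1 * s `^ (1 - a).
  (* For [i = 0] the segment is the single point 1, where the fundamental theorem for proper
     segments does not apply. *)
  case: i => [|i].
    rewrite /E invr1 set_itv1 integral_set1 lee_fin invr_ge0 subr_ge0; exact: ltW.
  have i1 : (i.+2%:R^-1 : R) < 1 by rewrite invf_lt1// ltr1n.
  rewrite /E (@continuous_FTC2 _ _ G) //.
  - rewrite /G powR1 mulr1 -EFinB lee_fin lerBlDr lerDl mulr_ge0 ?powR_ge0//.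
    by rewrite invr_ge0 subr_ge0 ltW.
  - apply: continuous_in_subspaceT => s; rewrite inE /= in_itv /= => /andP[si _].
    by apply: cpow; rewrite (lt_le_trans _ si).
  - split.
    + move=> s; rewrite in_itv /= => /andP[si _].
      apply: derivableM => //; apply: derivable_powR.
      by rewrite in_itv /= andbT (lt_trans _ si).
    + apply: cvgM; first exact: cvg_cst.
      apply: cvg_at_right_filter; exact: cpow.
    + apply: cvgM; first exact: cvg_cst.
      apply: cvg_at_left_filter; exact: cpow.
  - move=> s; rewrite in_itv /= => /andP[si _].
    have s0 : 0 < s by rewrite (lt_trans _ si).
    rewrite derive1Ml; last by apply: derivable_powR; rewrite in_itv /= andbT.
    rewrite powR_derive1 ?in_itv/= ?andbT//.
    rewrite mulrA mulVf ?mul1r ?subr_eq0 ?gt_eqF//.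
    by congr (_ `^ _); ring.
apply: (@le_lt_trans _ _ ((1 - a)^-1)%:E); last exact: ltry.
apply: lime_le; last exact: nearW.
apply: ereal_nondecreasing_is_cvgn.
exact: ge0_nondecreasing_set_nondecreasing_integral.
Qed.

Lemma integral_expR_decay d : 0 < d ->
  (\int[mu]_(s in `[0%R, +oo[) (expR (- (d * s)))%:E = (d^-1)%:E)%E.
Proof.
move=> d0.
rewrite (@ge0_continuous_FTC2y _ _ (fun s => - (d^-1 * expR (- (d * s)))) 0 0).
- by rewrite mulr0 oppr0 expR0 mulr1 -EFinB sub0r opprK.
- by move=> s _; exact: expR_ge0.
- apply: continuous_subspaceT => s; apply: continuous_comp; last exact: continuous_expR.
  by apply: cvgN; apply: cvgM; [exact: cvg_cst|exact: cvg_id].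
- rewrite -oppr0 -(mulr0 d^-1); apply: cvgN; apply: cvgM; first exact: cvg_cst.
  apply: (cvg_comp (fun s => d * s) (fun s => expR (- s))); last exact: cvgr_expR.
  exact: gt0_cvgMry.
- by move=> s _; exact: ex_derive.
- apply: cvg_at_right_filter; apply: cvgN; apply: cvgM; first exact: cvg_cst.
  apply: continuous_comp; last exact: continuous_expR.
  by apply: cvgN; apply: cvgM; [exact: cvg_cst|exact: cvg_id].
- move=> s _; rewrite derive1E derive_val.
  rewrite /GRing.scale /=; field.
  by rewrite gt_eqF.
Qed.

(** Split at 1: below it the exponential is at most 1 and the power is integrable, above it the
    power is at most 1. *)
Lemma gamma_integral_finite a : 0 <= a -> a < 1 ->
  (\int[mu]_(s in `]0%R, +oo[) (s `^ (- a) * expR (- s))%:E < +oo)%E.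
Proof.
move=> a0 a1.
have mp : measurable_fun setT (fun s : R => s `^ (- a)) by exact: measurable_powR.
have me : measurable_fun setT (fun s : R => expR (- s)).
  by apply: measurableT_comp => //; exact: oppr_measurable.
rewrite (@itv_bndbnd_setU _ _ _ (BRight 1)) ?bnd_simp//.
rewrite ge0_integral_setU //=; last first.
- apply/disj_setPS => y [/=]; rewrite 2!in_itv/= => /andP[_ y1] /andP[].
  by rewrite ltNge y1.
- by move=> s _; rewrite lee_fin mulr_ge0// ?powR_ge0 ?expR_ge0.
- apply/measurable_EFinP/measurable_funTS; exact: measurable_funM.
rewrite lte_add_pinfty//.
  apply: le_lt_trans (powR_singular_int a0 a1).
  apply: ge0_le_integral => //=.
  - by move=> s _; rewrite lee_fin mulr_ge0// ?powR_ge0 ?expR_ge0.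
  - apply/measurable_EFinP/measurable_funTS; exact: measurable_funM.
  - exact/measurable_EFinP/measurable_funTS.
  - move=> s; rewrite in_itv /= => /andP[s0 _]; rewrite lee_fin ler_piMr ?powR_ge0//.
    by rewrite -expR0 ler_expR oppr_le0 ltW.
apply: (@le_lt_trans _ _ (1^-1)%:E); last exact: ltry.
rewrite -integral_expR_decay//.
apply: (@le_trans _ _ (\int[mu]_(s in `]1%R, +oo[) (expR (- (1 * s)))%:E)%E).
  apply: ge0_le_integral => //=.
  - by move=> s _; rewrite lee_fin mulr_ge0// ?powR_ge0 ?expR_ge0.
  - apply/measurable_EFinP/measurable_funTS; exact: measurable_funM.
  - by apply/measurable_EFinP/measurable_funTS; under eq_fun do rewrite mul1r.
  - move=> s; rewrite in_itv /= andbT => s1; rewrite lee_fin mul1r ler_piMl ?expR_ge0//.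
    by rewrite -[leRHS](powRr0 s); apply: ler_powR; rewrite ?oppr_le0// ltW.
apply: ge0_subset_integral => //=.
- by apply/measurable_EFinP/measurable_funTS; under eq_fun do rewrite mul1r.
by apply: subset_itvr; rewrite bnd_simp.
Qed.

(** Majorant of all coordinates of the Green function, multiplied by lambda_j^alpha. The variable is
    source time minus evaluation time: s < 0 is the past, felt by the modes above the gap and
    singular at 0, and s >= 0 is the future, felt by the modes below it. Here l0 is lambda_(n+1),
    and l1 and A bound the lower eigenvalues and their powers. *)
Definition green_kernel a l0 A l1 s : R :=
  if s < 0 then (l0 `^ a + singular_coef a * (- s) `^ (- a)) * expR (l0 * s)
  else A * expR (l1 * s).

Lemma measurable_expRZ c : measurable_fun setT (fun s : R => expR (c * s)).
Proof.
apply: continuous_measurable_fun => s; apply: continuous_comp; last exact: continuous_expR.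
by apply: cvgM; [exact: cvg_cst|exact: cvg_id].
Qed.

Lemma measurable_lt0 : measurable_fun setT (fun s : R => s < 0).
Proof. by apply: measurable_fun_ltr. Qed.

Lemma measurable_green_kernel a l0 A l1 :
  measurable_fun setT (green_kernel a l0 A l1).
Proof.
apply: measurable_fun_if => //; first exact: measurable_lt0.
- apply: measurable_funTS; apply: measurable_funM; last exact: measurable_expRZ.
  apply: measurable_funD; first exact: measurable_cst.
  apply: measurable_funM; first exact: measurable_cst.
  have mp : measurable_fun setT (fun s : R => s `^ (- a)) by exact: measurable_powR.
  have mN : measurable_fun setT (-%R : R -> R) by exact: oppr_measurable.
  exact: (measurableT_comp mp mN).
- apply: measurable_funTS; apply: measurable_funM; first exact: measurable_cst.
  exact: measurable_expRZ.
Qed.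

Lemma integral_expR_decay_ge0 d : 0 < d ->
  (\int[mu]_s (if (0 <= s)%R then expR (- (d * s)) else 0%R)%:E = (d^-1)%:E)%E.
Proof.
move=> d0; rewrite -integral_expR_decay// [RHS]integral_mkcond.
apply: eq_integral => s _; rewrite patchE; case: ifPn => [s0|s0].
  by rewrite mem_set//= in_itv /= s0.
by rewrite memNset//= in_itv /= andbT; apply/negP.
Qed.

Let gam a := \int[mu]_(s in `]0, +oo[) (s `^ (- a) * expR (- s)).

(** The substitution s -> d s leads to the Gamma integral; d^a comes from the power and 1/d from the
    measure. *)
Lemma integral_powR_expR a d : 0 <= a -> a < 1 -> 0 < d ->
  (\int[mu]_s (if (0 < s)%R then s `^ (- a) * expR (- (d * s)) else 0%R)%:E
   = (d `^ a / d * gam a)%:E)%E.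
Proof.
move=> a0 a1 d0.
pose g (s : R) : \bar R := (if (0 < s)%R then s `^ (- a) * expR (- s) else 0%R)%:E.
have g0 s : (0 <= g s)%E.
  by rewrite lee_fin; case: ifP => // _; rewrite mulr_ge0 ?powR_ge0 ?expR_ge0.
have mg : measurable_fun setT g.
  apply/measurable_EFinP; apply: measurable_fun_if => //.
    exact: measurable_fun_ltr.
  apply: measurable_funTS; apply: measurable_funM; first exact: measurable_powR.
  by apply: measurableT_comp => //; exact: oppr_measurable.
have gE : (\int[mu]_s g s = (gam a)%:E)%E.
  rewrite /gam /Rintegral fineK; last first.
    rewrite ge0_fin_numE ?gamma_integral_finite//.
    by apply: integral_ge0 => s _; rewrite lee_fin mulr_ge0 ?powR_ge0 ?expR_ge0.
  rewrite [RHS]integral_mkcond; apply: eq_integral => s _.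
  rewrite /g patchE; case: ifPn => [s0|s0].
    by rewrite mem_set//= in_itv /= s0.
  by rewrite memNset//= in_itv /= andbT; apply/negP.
have := ge0_integral_affine 0 d0 mg g0; rewrite gE => gE2.
transitivity (\int[mu]_s ((d `^ a)%:E * g (d * s + 0)%R))%E.
  apply: eq_integral => s _; rewrite /g addr0 pmulr_rgt0// -EFinM; congr EFin.
  case: ifPn => [s0|]; last by rewrite mulr0.
  rewrite powRM ?(ltW d0) ?(ltW s0)// mulrA mulrA -powRD ?subrr ?powRr0 ?mul1r//.
  by rewrite (gt_eqF d0) implybT.
rewrite ge0_integralZl_EFin ?powR_ge0//; last first.
  exact: (measurableT_comp mg (measurable_affine d 0)).
have -> : (\int[mu]_s g (d * s + 0)%R = (d^-1 * gam a)%:E)%E.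
  by rewrite [in RHS]EFinM gE2 muleA -EFinM mulVf ?mul1e// gt_eqF.
by rewrite -EFinM mulrA.
Qed.

(** Under the weight the past half decays at rate l0 - m and the future half at rate m - l1. The
    singular part gives c_alpha (l0 - m)^(a-1), the source of the c_alpha term in the gap
    condition. *)
Lemma integral_green_kernel a l0 A l1 m :
  0 <= a -> a < 1 -> 0 <= l0 -> 0 <= A -> m < l0 -> l1 < m ->
  (\int[mu]_s (green_kernel a l0 A l1 s * expR (- (m * s)))%:E =
   (A / (m - l1) + (l0 `^ a + c_const a * (l0 - m) `^ a) / (l0 - m))%:E)%E.
Proof.
move=> a0 a1 l00 A0 ml0 l1m; pose d := l0 - m; pose e := m - l1.
have d0 : 0 < d by rewrite subr_gt0.
have e0 : 0 < e by rewrite subr_gt0.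
pose h1 (s : R) : \bar R := (if (0 < s)%R then expR (- (d * s)) else 0%R)%:E.
pose h2 (s : R) : \bar R := (if (0 < s)%R then s `^ (- a) * expR (- (d * s)) else 0%R)%:E.
pose h3 (s : R) : \bar R := (if (0 <= s)%R then expR (- (e * s)) else 0%R)%:E.
have mexp c : measurable_fun setT (fun s : R => expR (- (c * s))).
  by under eq_fun do rewrite -mulNr; exact: measurable_expRZ.
have mh1 : measurable_fun setT h1.
  apply/measurable_EFinP; apply: measurable_fun_if => //.
    exact: measurable_fun_ltr.
  exact: measurable_funTS.
have mh2 : measurable_fun setT h2.
  apply/measurable_EFinP; apply: measurable_fun_if => //.
    exact: measurable_fun_ltr.
  by apply: measurable_funTS; apply: measurable_funM; first exact: measurable_powR.
have mh3 : measurable_fun setT h3.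
  apply/measurable_EFinP; apply: measurable_fun_if => //.
    exact: measurable_fun_ler.
  exact: measurable_funTS.
have h10 s : (0 <= h1 s)%E by rewrite lee_fin; case: ifP => // _; rewrite expR_ge0.
have h20 s : (0 <= h2 s)%E.
  by rewrite lee_fin; case: ifP => // _; rewrite mulr_ge0 ?expR_ge0 ?powR_ge0.
have h30 s : (0 <= h3 s)%E by rewrite lee_fin; case: ifP => // _; rewrite expR_ge0.
have mN : measurable_fun setT (-%R : measurableTypeR R -> measurableTypeR R).
  exact: oppr_measurable.
have mh1N : measurable_fun setT (fun s : R => h1 (- s)) by exact: (measurableT_comp mh1 mN).
have mh2N : measurable_fun setT (fun s : R => h2 (- s)) by exact: (measurableT_comp mh2 mN).
have I1 : (\int[mu]_s h1 (- s)%R = (d^-1)%:E)%E.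
  rewrite ge0_integral_opp// -integral_expR_decay// -integral_itv_obnd_cbnd; last first.
    exact/measurable_EFinP/measurable_funTS.
  rewrite [RHS]integral_mkcond; apply: eq_integral => s _; rewrite /h1 patchE.
  case: ifPn => [s0|s0]; first by rewrite mem_set//= in_itv /= s0.
  by rewrite memNset//= in_itv /= andbT; apply/negP.
have I2 : (\int[mu]_s h2 (- s)%R = (d `^ a / d * gam a)%:E)%E.
  by rewrite ge0_integral_opp// integral_powR_expR.
have I3 : (\int[mu]_s h3 s = (e^-1)%:E)%E by rewrite integral_expR_decay_ge0.
transitivity (\int[mu]_s ((l0 `^ a)%:E * h1 (- s)%R +
  ((singular_coef a)%:E * h2 (- s)%R + A%:E * h3 s)))%E.
  apply: eq_integral => s _; rewrite /h1 /h2 /h3 /green_kernel oppr_gt0.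
  case: ltP => s0.
    rewrite -!EFinM mulr0 adde0 -EFinD; congr EFin.
    rewrite mulrN opprK /d mulrBl expRD expRN; field.
    by rewrite gt_eqF ?expR_gt0.
  rewrite !mule0 !add0e -EFinM -mulrA -expRD; congr (A * expR _)%:E.
  by rewrite /e; ring.
rewrite ge0_integralD //; last 4 first.
- by move=> s _; rewrite mule_ge0// lee_fin powR_ge0.
- by apply: measurable_funeM.
- by move=> s _; rewrite adde_ge0// mule_ge0// lee_fin singular_coef_ge0.
- by apply: emeasurable_funD; apply: measurable_funeM.
rewrite ge0_integralD //; last 4 first.
- by move=> s _; rewrite mule_ge0// lee_fin singular_coef_ge0.
- by apply: measurable_funeM.
- by move=> s _; rewrite mule_ge0.
- by apply: measurable_funeM.
rewrite !ge0_integralZl_EFin ?powR_ge0 ?singular_coef_ge0//.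
rewrite I1 I2 I3 -!EFinM -!EFinD; congr EFin.
have -> : c_const a = singular_coef a * gam a.
  by rewrite /c_const /singular_coef; case: ifP => // _; rewrite mul0r.
by rewrite -/d -/e; field; rewrite !gt_eqF.
Qed.

End GammaConstant.

(** * Coordinates in H and in D(A^alpha) *)

Section Hilbert.
Context (R : realType) (H : completeNormedModType R) (S : setting H).
Implicit Types (u v w : H) (c : nat -> R).
Local Notation e := (ebase S).

Lemma ip_suml_nat c n i : (i < n)%N ->
  ip S (\sum_(0 <= j < n) c j *: e j) (e i) = c i.
Proof. exact: (ip_partial_sum S c). Qed.

Lemma ipNr u w : ip S u (- w) = - ip S u w.
Proof. by rewrite ip_sym ipNl ip_sym. Qed.

Lemma ipDr u v w : ip S u (v + w) = ip S u v + ip S u w.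
Proof. by rewrite ip_sym ipDl !(ip_sym S _ u). Qed.

Lemma ipZr (a : R) u w : ip S u (a *: w) = a * ip S u w.
Proof. by rewrite ip_sym ipZl ip_sym. Qed.

Lemma ip_sumr (I : Type) (r : seq I) (P : pred I) (f : I -> H) w :
  ip S w (\sum_(i <- r | P i) f i) = \sum_(i <- r | P i) ip S w (f i).
Proof. by rewrite ip_sym ip_suml; apply: eq_bigr => i _; rewrite ip_sym. Qed.

Lemma norm_sum_sq c (s : seq nat) : uniq s ->
  `|\sum_(j <- s) c j *: e j| ^+ 2 = \sum_(j <- s) c j ^+ 2.
Proof.
move=> us; rewrite -(ip_norm S) ip_suml.
apply: eq_big_seq => i si; rewrite ipZl ip_sumr (bigD1_seq i)//= ipZr e_orthonormal eqxx.
rewrite mulr1 big1 ?addr0 ?expr2// => j ji.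
by rewrite ipZr e_orthonormal eq_sym (negbTE ji) mulr0.
Qed.

Lemma ip_CS u v : `|ip S u v| <= `|u| * `|v|.
Proof.
have [->|v0] := eqVneq v 0; first by rewrite ip_sym ip0l normr0 mulr_ge0.
have nv : 0 < `|v| ^+ 2 by rewrite exprn_gt0// normr_gt0.
pose t := ip S u v / `|v| ^+ 2.
have : 0 <= `|u - t *: v| ^+ 2 by rewrite sqr_ge0.
rewrite -(ip_norm S) ipDl !ipDr !ipNl !ipNr !ipZl !ipZr !(ip_norm S) (ip_sym S v u).
move=> h.
rewrite -ler_sqr ?nnegrE ?mulr_ge0// exprMn real_normK ?num_real//.
rewrite -subr_ge0; move: h.
have -> : `|u| ^+ 2 - t * ip S u v + (- (t * ip S u v) - - (t * (t * `|v| ^+ 2)))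
   = (`|u| ^+ 2 * `|v| ^+ 2 - ip S u v ^+ 2) / `|v| ^+ 2.
  by rewrite /t; field; rewrite gt_eqF// normr_gt0.
by rewrite pmulr_lge0 ?invr_gt0.
Qed.

Lemma norm_sq_lim u :
  \sum_(0 <= j < N) (ip S u (e j)) ^+ 2 @[N --> \oo] --> `|u| ^+ 2.
Proof.
under eq_fun do rewrite -(norm_partial_sum S).
have h : `|series (fun j => ip S u (e j) *: e j) N| @[N --> \oo] --> `|u|.
  by apply: cvg_norm; exact: e_basis.
rewrite expr2 (_ : (fun N => _) = (fun N => `|series (fun j => ip S u (e j) *: e j) N|
  * `|series (fun j => ip S u (e j) *: e j) N|)); first exact: cvgM.
by apply/funext => N; rewrite expr2.
Qed.

Lemma bessel u N : \sum_(0 <= j < N) (ip S u (e j)) ^+ 2 <= `|u| ^+ 2.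
Proof.
have h := @norm_sq_lim u.
rewrite -(cvg_lim _ h)//; apply: nondecreasing_cvgn_le; last by apply/cvg_ex; eexists; exact: h.
by apply/nondecreasing_seqP => n; rewrite big_nat_recr//= lerDl sqr_ge0.
Qed.

Lemma coef_norm_le u B : 0 <= B ->
  (forall N, \sum_(0 <= j < N) (ip S u (e j)) ^+ 2 <= B ^+ 2) -> `|u| <= B.
Proof.
move=> B0 h; rewrite -ler_sqr ?nnegrE//.
have hl := @norm_sq_lim u.
rewrite -(cvg_lim _ hl)//; apply: limr_le; first by apply/cvg_ex; eexists; exact: hl.
exact: nearW.
Qed.

(** A block of the vector series has squared norm equal to the same block of the scalar series, so
    both are Cauchy together. *)
Lemma riesz_fischer c B : 0 <= B ->
  (forall N, \sum_(0 <= j < N) c j ^+ 2 <= B ^+ 2) ->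
  exists2 w, (forall j, ip S w (e j) = c j) & `|w| <= B.
Proof.
move=> B0 h.
have cc : cvgn (series (fun j => c j ^+ 2)).
  apply: nondecreasing_is_cvgn.
    by apply/nondecreasing_seqP => n; rewrite !seriesEnat /= big_nat_recr//= lerDl sqr_ge0.
  by exists (B ^+ 2) => _ [N _ <-]; rewrite seriesEnat; exact: h.
have : cvgn (series (fun j => c j *: e j)).
  apply: cauchy_cvg; apply/cauchy_seriesP => eps eps0.
  have /cauchy_cvgP/cauchy_seriesP/(_ _ (exprn_gt0 2 eps0)) := cc.
  apply: filterS => -[m n] /=.
  rewrite -norm_sum_sq ?iota_uniq//.
  rewrite ger0_norm ?sqr_ge0// ltr_sqr ?nnegrE//.
  exact: ltW.
move=> /cvg_ex [w cw]; exists w.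
  move=> j.
  have h1 : ip S (series (fun j => c j *: e j) n) (e j) @[n --> \oo] --> ip S w (e j).
    exact: ip_cvg.
  have h2 : ip S (series (fun j => c j *: e j) n) (e j) @[n --> \oo] --> c j.
    apply: cvg_near_cst; near=> n; apply: ip_partial_sum.
    by near: n; exists j.+1.
  by rewrite -[LHS](cvg_lim _ h1)// -[RHS](cvg_lim _ h2).
have hn : `|series (fun j => c j *: e j) n| @[n --> \oo] --> `|w| by exact: cvg_norm.
rewrite -(cvg_lim _ hn)//.
apply: limr_le; first by apply/cvg_ex; eexists; exact: hn.
apply: nearW => N; rewrite -ler_sqr ?nnegrE// (norm_partial_sum S); exact: h.
Unshelve. all: by end_near. Qed.

End Hilbert.

Section Coordinates.
Context (R : realType) (H : completeNormedModType R) (S : setting H).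
Implicit Types (u v w : Dalpha S) (c : nat -> R).
Local Notation e := (ebase S).
Local Notation la j := (lam S j `^ alpha S).

Definition Dcoef u j : R := ip S (Dval u) (e j).

Lemma DcoefD u v j : Dcoef (u + v) j = Dcoef u j + Dcoef v j.
Proof. by rewrite /Dcoef -ipDl. Qed.

Lemma DcoefZ a u j : Dcoef (a *: u) j = a * Dcoef u j.
Proof. by rewrite /Dcoef -ipZl. Qed.

Lemma Dcoef0 j : Dcoef 0 j = 0.
Proof. by rewrite -(scale0r (0 : Dalpha S)) DcoefZ mul0r. Qed.

Lemma DcoefN u j : Dcoef (- u) j = - Dcoef u j.
Proof. by rewrite -scaleN1r DcoefZ mulN1r. Qed.

Lemma DcoefB u v j : Dcoef (u - v) j = Dcoef u j - Dcoef v j.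
Proof. by rewrite DcoefD DcoefN. Qed.

Lemma Dcoef_sum (I : Type) (r : seq I) (P : pred I) (f : I -> Dalpha S) j :
  Dcoef (\sum_(i <- r | P i) f i) j = \sum_(i <- r | P i) Dcoef (f i) j.
Proof.
apply: (big_morph (fun u => Dcoef u j)) => [u v|]; [exact: DcoefD|exact: Dcoef0].
Qed.

Lemma Dcoef_inj u v : (forall j, Dcoef u j = Dcoef v j) -> u = v.
Proof. by move=> h; apply: Dval_inj; apply: (ip_ebase_inj (S := S)). Qed.

Lemma Dcoef_base i j : Dcoef (Dbase S i) j = (i == j)%:R.
Proof. exact: e_orthonormal. Qed.

Definition Dfin (n : nat) (c : nat -> R) : Dalpha S := \sum_(j < n) c j *: Dbase S j.

Lemma Dcoef_fin n c j : Dcoef (Dfin n c) j = if (j < n)%N then c j else 0.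
Proof.
rewrite /Dfin Dcoef_sum; case: ltnP => jn.
  rewrite (bigD1 (Ordinal jn))//= DcoefZ Dcoef_base eqxx mulr1 big1 ?addr0// => i ij.
  rewrite DcoefZ Dcoef_base; have /negbTE -> : (i : nat) != j by [].
  by rewrite mulr0.
rewrite big1// => i _; rewrite DcoefZ Dcoef_base.
have /negbTE -> : (i : nat) != j by rewrite neq_ltn (leq_trans _ jn).
by rewrite mulr0.
Qed.

Lemma Dcoef_proj n u j : Dcoef (Dproj n u) j = if (j < n)%N then Dcoef u j else 0.
Proof. exact: (Dcoef_fin n (Dcoef u)). Qed.

Lemma Dcoef_coproj n u j : Dcoef (Dcoproj n u) j = if (j < n)%N then 0 else Dcoef u j.
Proof. by rewrite /Dcoproj DcoefB Dcoef_proj; case: ifP => _; rewrite ?subrr ?subr0. Qed.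

Lemma ip_proj n (u : H) j :
  ip S (Defs.proj S n u) (e j) = if (j < n)%N then ip S u (e j) else 0.
Proof.
rewrite /Defs.proj ip_suml; case: ltnP => jn.
  rewrite (bigD1 (Ordinal jn))//= ipZl e_orthonormal eqxx mulr1 big1 ?addr0// => i ij.
  rewrite ipZl e_orthonormal; have /negbTE -> : (i : nat) != j by [].
  by rewrite mulr0.
rewrite big1// => i _; rewrite ipZl e_orthonormal.
have /negbTE -> : (i : nat) != j by rewrite neq_ltn (leq_trans _ jn).
by rewrite mulr0.
Qed.

Lemma ip_coproj n (u : H) j :
  ip S (Defs.coproj S n u) (e j) = if (j < n)%N then 0 else ip S u (e j).
Proof. by rewrite /Defs.coproj ipDl ipNl ip_proj; case: ifP => _; rewrite ?subrr ?subr0. Qed.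

Lemma PnHP n u : PnH S n u <-> forall j, (n <= j)%N -> Dcoef u j = 0.
Proof.
split=> [[v _ <-] j nj|h]; first by rewrite Dcoef_proj ltnNge nj.
exists u => //; apply: Dcoef_inj => j; rewrite Dcoef_proj.
by case: ltnP => // nj; rewrite h.
Qed.

Lemma Dbessel u N : \sum_(0 <= j < N) (la j * Dcoef u j) ^+ 2 <= `|u| ^+ 2.
Proof.
by under eq_bigr do rewrite -(Apow_coef u); rewrite DnormE; exact: bessel.
Qed.

Lemma Dnorm_coef_le u B : 0 <= B ->
  (forall N, \sum_(0 <= j < N) (la j * Dcoef u j) ^+ 2 <= B ^+ 2) -> `|u| <= B.
Proof.
move=> B0 h; rewrite DnormE; apply: (coef_norm_le (S := S)) => // N.
by under eq_bigr do rewrite (Apow_coef u).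
Qed.

(** The linear operators involved are diagonal in the basis, so this comparison yields their norm
    estimates. *)
Lemma Dcoef_le_norm u v :
  (forall j, `|Dcoef u j| <= `|Dcoef v j|) -> `|u| <= `|v|.
Proof.
move=> h; apply: Dnorm_coef_le => // N; apply: le_trans (Dbessel v N).
apply: ler_sum => j _; rewrite -[leLHS]real_normK ?num_real// -[leRHS]real_normK ?num_real//.
rewrite ler_sqr ?nnegrE// !normrM; apply: ler_wpM2l => //.
Qed.

Lemma Dcoef_bound u j : `|Dcoef u j| <= (la j)^-1 * `|u|.
Proof.
rewrite mulrC ler_pdivlMr ?lam_powR_gt0// mulrC.
rewrite -[la j]gtr0_norm ?lam_powR_gt0// -normrM.
rewrite -ler_sqr ?nnegrE// real_normK ?num_real//; apply: le_trans (Dbessel u j.+1).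
by rewrite big_nat_recr//= lerDr sumr_ge0// => i _; rewrite sqr_ge0.
Qed.

Lemma Dnorm_proj n u : `|Dproj n u| <= `|u|.
Proof. by apply: Dcoef_le_norm => j; rewrite Dcoef_proj; case: ifP => // _; rewrite normr0. Qed.

Lemma Dnorm_coproj n u : `|Dcoproj n u| <= `|u|.
Proof. by apply: Dcoef_le_norm => j; rewrite Dcoef_coproj; case: ifP => // _; rewrite normr0. Qed.

(** Riesz-Fischer is applied twice: to lambda_j^alpha c_j, giving w, and to c_j, which is square
    summable because lambda_j^(-alpha) <= lambda_1^(-alpha), giving x. The spectral series of x then
    converges to w, so x lies in D(A^alpha). *)
Lemma Dalpha_build c B : 0 <= B ->
  (forall N, \sum_(0 <= j < N) (la j * c j) ^+ 2 <= B ^+ 2) ->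
  exists2 u : Dalpha S, (forall j, Dcoef u j = c j) & `|u| <= B.
Proof.
move=> B0 h; have [w wE wB] := @riesz_fischer R H S _ B B0 h.
have la0 j : (la j)^-1 <= (la 0%N)^-1.
  rewrite lef_pV2 ?posrE ?lam_powR_gt0//; apply: ge0_ler_powR; rewrite ?nnegrE ?alpha_ge0//;
  by rewrite ?(ltW (lam_gt0 _ _))// lam_nondecr.
have [||x xE _] := @riesz_fischer R H S c ((la 0%N)^-1 * B).
- by rewrite mulr_ge0// invr_ge0 ltW// lam_powR_gt0.
- move=> N; rewrite exprMn; apply: (@le_trans _ _ ((la 0)^-1 ^+ 2 * \sum_(0 <= j < N) (la j * c j) ^+ 2)).
    rewrite mulr_sumr; apply: ler_sum => j _; rewrite -exprMn mulrA.
    rewrite -[leLHS]real_normK ?num_real// -[leRHS]real_normK ?num_real//.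
    rewrite ler_sqr ?nnegrE// normrM ler_peMl// ger0_norm; last first.
      by rewrite mulr_ge0 ?invr_ge0 ?ltW// lam_powR_gt0.
    by rewrite -(mulVf (lt0r_neq0 (lam_powR_gt0 S j))) ler_wpM2r// ltW// lam_powR_gt0.
  by rewrite ler_wpM2l// sqr_ge0.
have cx : spectral_series S (fun j => la j) x @ \oo --> w.
  by apply: Apow_eq => j; rewrite xE wE.
have xD : x \in in_Dalpha S by apply/in_DalphaP/cvg_ex; exists w.
exists (MkDalpha xD) => //.
apply: Dnorm_coef_le => // N; rewrite /Dcoef /=.
by under eq_bigr do rewrite xE.
Qed.

End Coordinates.

(** * Borel measurability of vector-valued maps *)

Section BorelMeasurability.
Context (R : realType).

Lemma lipschitz_continuous (V W : normedModType R) (g : V -> W) (C : R) :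
  (forall u v, `|g u - g v| <= C * `|u - v|) -> continuous g.
Proof.
move=> gC u; have C0 : 0 < `|C| + 1 by rewrite ltr_wpDl.
apply/cvgrPdist_lt => eps eps0; have c0 : 0 < eps / (`|C| + 1) by rewrite divr_gt0.
have /cvgrPdist_lt /(_ _ c0) : v @[v --> u] --> u by exact: cvg_id.
apply: filterS => v uv; rewrite (le_lt_trans (gC _ _))//.
apply: (@le_lt_trans _ _ ((`|C| + 1) * `|u - v|)).
  by rewrite ler_wpM2r// (le_trans (ler_norm C))// lerDl.
by rewrite mulrC -ltr_pdivlMr.
Qed.

Lemma measurable_borel_open (V : normedModType R) (U : set V) :
  open U -> measurable (U : set (borel V)).
Proof. by move=> oU; apply: sub_sigma_algebra. Qed.

Lemma measurable_borel_comp d (T : measurableType d) (V W : normedModType R)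
    (D : set T) (f : T -> V) (g : V -> W) :
  continuous g -> measurable D -> measurable_fun D (f : T -> borel V) ->
  measurable_fun D (g \o f : T -> borel W).
Proof.
move=> cg mD mf; apply: (@measurability _ _ T (borel W) D (g \o f : T -> borel W) (@open W) erefl).
move=> _ [U oU <-]; rewrite comp_preimage.
apply: mf => //; apply: measurable_borel_open.
by move/continuousP : cg; exact.
Qed.

Lemma measurable_borel_real d (T : measurableType d) (V : normedModType R)
    (D : set T) (f : T -> V) (g : V -> R) :
  continuous g -> measurable D -> measurable_fun D (f : T -> borel V) ->
  measurable_fun D (g \o f).
Proof.
move=> cg mD mf; apply: (measurability _ (RGenOpens.measurableE R)).
move=> _ [_ [a [b ->] <-]]; rewrite comp_preimage.
apply: mf => //; apply: measurable_borel_open.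
by move/continuousP : cg; apply; exact: interval_open.
Qed.

(** An open set is the union of those balls around the points q_i, of radius 1/(m+1), that it
    contains. Distances to a dense sequence therefore decide measurability. *)
Lemma measurable_borel_dense d (T : measurableType d) (V : normedModType R)
    (D : set T) (f : T -> V) (q : nat -> V) : measurable D ->
  (forall v (e : R), 0 < e -> exists i, `|v - q i| < e) ->
  (forall i, measurable_fun D (fun t => `|f t - q i|)) ->
  measurable_fun D (f : T -> borel V).
Proof.
move=> mD qd mf; apply: (@measurability _ _ T (borel V) D (f : T -> borel V) (@open V) erefl).
move=> _ [U oU <-].
pose r m : R := m.+1%:R^-1.
pose B i m : set T := if `[< ball (q i) (r m) `<=` U >]
  then D `&` [set t | `|f t - q i| < r m] else set0.
have -> : D `&` f @^-1` U = \bigcup_i \bigcup_m B i m.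
  apply/seteqP; split => [t [Dt Uft]|t [i _ [m _]]]; last first.
    rewrite /B; case: asboolP => // sub [Dt ft]; split => //; apply: sub.
    by rewrite -ball_normE /= distrC.
  have : nbhs (f t) U by exact: open_nbhs_nbhs.
  rewrite -nbhs_ballE => -[eps /= eps0 sub].
  have e2 : 0 < eps / 2 by rewrite divr_gt0.
  have [m _ Hm] := @near_infty_natSinv_lt R (PosNum e2).
  have rm : r m < eps / 2 := Hm m (leqnn m).
  have rm0 : 0 < r m by rewrite invr_gt0.
  have [i fi] := qd (f t) (r m) rm0.
  exists i => //; exists m => //; rewrite /B; case: asboolP => [//|nsub].
  exfalso; apply: nsub => y; rewrite -ball_normE /= => qy.
  apply: sub; rewrite -ball_normE /=.
  rewrite (_ : f t - y = (f t - q i) + (q i - y)); last by rewrite addrA subrK.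
  rewrite (le_lt_trans (ler_normD _ _))//.
  by rewrite [eps]splitr ltrD// (lt_trans _ rm).
apply: bigcup_measurable => i _; apply: bigcup_measurable => m _.
rewrite /B; case: ifP => // _.
have := mf i mD _ (measurable_itv `]-oo, r m[).
by rewrite preimage_itvNyo.
Qed.

End BorelMeasurability.

Section CoordinateMeasurability.
Context (R : realType) (H : completeNormedModType R) (S : setting H).
Local Notation e := (ebase S).
Local Notation la j := (lam S j `^ alpha S).

(** Finite rational combinations of basis vectors, enumerated through the codes of [seq rat]; an
    index that codes no sequence gives 0. Their density is the separability of H. *)
Definition rat_vec (i : nat) : H :=
  let s := odflt [::] (unpickle i : option (seq rat)) in
  \sum_(0 <= j < size s) ratr (nth 0 s j) *: e j.

Lemma ip_rat_vec i j :
  ip S (rat_vec i) (e j) = ratr (nth 0 (odflt [::] (unpickle i : option (seq rat))) j).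
Proof.
rewrite /rat_vec; set s := odflt _ _; case: (ltnP j (size s)) => js.
  by rewrite ip_suml_nat.
rewrite nth_default// raddf0 ip_suml big_nat big1// => l /andP[_ ls].
rewrite ipZl e_orthonormal; have /negbTE -> : l != j by rewrite neq_ltn (leq_trans ls js).
by rewrite mulr0.
Qed.

Lemma rat_vec_dense (v : H) (eps : R) : 0 < eps -> exists i, `|v - rat_vec i| < eps.
Proof.
move=> eps0; have e2 : 0 < eps / 2 by rewrite divr_gt0.
have /cvgrPdist_lt /(_ _ e2) [N _ /(_ N (leqnn N)) vN] := @e_basis R H S v.
pose c j := ip S v (e j).
have N0 : (0 : R) < N.+1%:R by [].
(* Dividing by N + 1 rather than N keeps the tolerance meaningful when N = 0. *)
have d0 : 0 < eps / 2 / N.+1%:R by rewrite divr_gt0.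
have ex j : exists q : rat, `|c j - ratr q| < eps / 2 / N.+1%:R.
  have [q] := @rat_in_itvoo R (c j - eps / 2 / N.+1%:R) (c j) ltac:(by rewrite ltrBlDr ltrDl).
  rewrite in_itv /= => /andP[q1 q2]; exists q; rewrite ger0_norm ?subr_ge0 ?ltW//.
  by rewrite ltrBlDr -ltrBlDl.
pose q j := projT1 (cid (ex j)).
exists (pickle [seq q j | j <- iota 0 N]).
rewrite /rat_vec pickleK /= size_map size_iota.
rewrite (_ : v - _ = (v - series (fun j => c j *: e j) N) +
  (series (fun j => c j *: e j) N - \sum_(0 <= j < N) ratr (nth 0 [seq q j | j <- iota 0 N] j) *: e j)); last first.
  by rewrite addrA subrK.
rewrite (le_lt_trans (ler_normD _ _))// [eps]splitr ltrD//.
rewrite seriesEnat /= -sumrB (le_lt_trans (ler_norm_sum _ _ _))//.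
apply: (@le_lt_trans _ _ (\sum_(0 <= j < N) (eps / 2 / N.+1%:R))).
  rewrite !big_nat; apply: ler_sum => j /andP[_ jN].
  rewrite (nth_map 0%N) ?size_iota// nth_iota// add0n -scalerBl normrZ.
  have -> : `|e j| = 1.
    apply/eqP; rewrite -(@pexpr_eq1 _ _ 2)// -(ip_norm S) e_orthonormal eqxx//.
  by rewrite mulr1 ltW//; exact: (projT2 (cid (ex j))).
rewrite sumr_const_nat subn0 -[ltLHS]mulr_natr -mulrA gtr_pMr// mulrC ltr_pdivrMr//.
by rewrite mul1r ltr_nat.
Qed.

(** The squared distance to a dense vector is the limit of the partial sums of squared coordinate
    differences. *)
Lemma measurable_coef d (T : measurableType d) (D : set T) (f : T -> H) : measurable D ->
  (forall j, measurable_fun D (fun t => ip S (f t) (e j))) ->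
  measurable_fun D (f : T -> borel H).
Proof.
move=> mD mf; apply: (measurable_borel_dense mD rat_vec_dense) => i.
pose c j := ratr (nth 0 (odflt [::] (unpickle i : option (seq rat))) j) : R.
have mN N : measurable_fun D (fun t => \sum_(0 <= j < N) (ip S (f t) (e j) - c j) ^+ 2).
  by apply: measurable_sum => j; apply: measurable_funX; apply: measurable_funB.
have : measurable_fun D (fun t => `|f t - rat_vec i| ^+ 2).
  apply: (measurable_fun_cvg mN) => t Dt.
  have h := @norm_sq_lim R H S (f t - rat_vec i).
  rewrite (_ : (fun N => _) = (fun N => \sum_(0 <= j < N) ip S (f t - rat_vec i) (e j) ^+ 2)) //.
  by apply/funext => N; apply: eq_bigr => j _; rewrite ipDl ipNl ip_rat_vec.
move=> m2.
rewrite (_ : (fun t => _) = (fun t => Num.sqrt (`|f t - rat_vec i| ^+ 2))); last first.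
  by apply/funext => t; rewrite sqrtr_sqr ger0_norm.
apply: (@measurableT_comp _ _ _ _ _ _ (fun x : R => Num.sqrt x)) => //.
by apply: continuous_measurable_fun; exact: sqrt_continuous.
Qed.

(** A^alpha is an isometry onto H, so the preimages of the rational vectors are dense in D(A^alpha)
    and the distances can be computed in H. *)
Lemma measurable_Dcoef d (T : measurableType d) (D : set T) (f : T -> Dalpha S) :
  measurable D -> (forall j, measurable_fun D (fun t => Dcoef (f t) j)) ->
  measurable_fun D (f : T -> borel (Dalpha S)).
Proof.
move=> mD mf.
have ex i : exists u : Dalpha S, Apow S (Dval u) = rat_vec i.
  have [|N|u uE _] := @Dalpha_build R H S (fun j => (la j)^-1 * ip S (rat_vec i) (e j)) `|rat_vec i|.
  - by [].
  - apply: le_trans (bessel S (rat_vec i) N); apply: ler_sum => j _.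
    by rewrite mulrA divff ?mul1r// lt0r_neq0// lam_powR_gt0.
  - exists u; apply: (ip_ebase_inj (S := S)) => j; rewrite Apow_coef.
    have := uE j; rewrite /Dcoef => ->.
    by rewrite mulrA divff ?mul1r// lt0r_neq0// lam_powR_gt0.
pose q i := projT1 (cid (ex i)).
have qE i : Apow S (Dval (q i)) = rat_vec i := projT2 (cid (ex i)).
have mA : measurable_fun D ((fun t => Apow S (Dval (f t))) : T -> borel H).
  apply: measurable_coef => // j; under eq_fun do rewrite Apow_coef.
  by apply: measurable_funM => //; exact: mf.
apply: (@measurable_borel_dense R _ _ _ _ _ q) => //.
  move=> v eps eps0; have [i iP] := rat_vec_dense (Apow S (Dval v)) eps0.
  by exists i; rewrite DnormB qE.
move=> i; under eq_fun do rewrite DnormB qE.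
apply: (@measurable_borel_real R _ _ H D (fun t => Apow S (Dval (f t))) (fun v => `|v - rat_vec i|)) => //.
move=> v; apply: cvg_norm; apply: cvgB; [exact: cvg_id|exact: cvg_cst].
Qed.

Lemma ip_continuous (y : H) : continuous (fun u : H => ip S u y).
Proof. by move=> u; apply: ip_cvg; exact: cvg_id. Qed.

Lemma Dcoef_continuous j : continuous (fun u : Dalpha S => Dcoef u j).
Proof.
apply: (@lipschitz_continuous R _ _ _ (la j)^-1) => u v.
by rewrite -DcoefB; exact: Dcoef_bound.
Qed.

Lemma measurable_borel_Dcoef d (T : measurableType d) (D : set T) (f : T -> Dalpha S) j :
  measurable D -> measurable_fun D (f : T -> borel (Dalpha S)) ->
  measurable_fun D (fun t => Dcoef (f t) j).
Proof. by move=> mD; exact: measurable_borel_real (@Dcoef_continuous j) mD. Qed.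

End CoordinateMeasurability.

(** * The Green operator and its fixed points *)

Section PiecewiseContinuity.
Context (R : realType).
Local Notation mu := (@lebesgue_measure R).

Lemma integrable_dominated (D : set R) (f g : R -> R) : measurable D ->
  measurable_fun D f -> (forall s, D s -> `|f s| <= g s) ->
  mu.-integrable D (EFin \o g) -> mu.-integrable D (EFin \o f).
Proof.
move=> mD mf fg; apply: le_integrable => //; first exact/measurable_EFinP.
move=> s Ds; rewrite /= lee_fin; apply: le_trans (fg s Ds) _; exact: ler_norm.
Qed.

Lemma integrable_scale d (T : measurableType d) (mu : {measure set T -> \bar R})
    (D : set T) (c : R) (f : T -> R) : measurable D ->
  mu.-integrable D (EFin \o f) -> mu.-integrable D (EFin \o (fun s => c * f s)).
Proof.
by move=> mD fi; have := integrableZl mD c fi; apply: eq_integrable.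
Qed.

Lemma integrable_fin_sum d (T : measurableType d) (mu : {measure set T -> \bar R})
    (D : set T) (f : nat -> T -> R) N : measurable D ->
  (forall j, mu.-integrable D (EFin \o f j)) ->
  mu.-integrable D (EFin \o (fun s => \sum_(0 <= j < N) f j s)).
Proof.
move=> mD fi; elim: N => [|N ih].
  have : mu.-integrable D (cst 0%E) by exact: integrable0.
  apply: eq_integrable => // s _ /=.
  by rewrite big_nil.
have := integrableD mD ih (fi N); apply: eq_integrable => // s _ /=.
by rewrite big_nat_recr//= EFinD.
Qed.

(** Sources cut off at finitely many times are of this kind. The property is stable under shifts and
    differences, gives Borel measurability, and lets dominated convergence apply off a null set. *)
Definition pcont (V : normedModType R) (f : R -> V) : Prop :=
  exists B : seq R, forall t, t \notin B -> {for t, continuous f}.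

Lemma near_notin (B : seq R) (t : R) : t \notin B -> \forall s \near t, s \notin B.
Proof.
elim: B => [|b B ih]; first by move=> _; near=> s; rewrite in_nil.
rewrite inE negb_or => /andP[tb /ih tB].
have d0 : 0 < `|t - b| by rewrite normr_gt0 subr_eq0.
near=> s; rewrite inE negb_or; apply/andP; split; last by near: s.
apply/eqP => sb; have : `|t - s| < `|t - b| by near: s; exact: cvgr_dist_lt.
by rewrite sb ltxx.
Unshelve. all: by end_near. Qed.

(** Off the exceptional set the preimage of an open set is open; the rest of it is finite. *)
Lemma pcont_measurable (V : normedModType R) (f : R -> V) : pcont f ->
  measurable_fun setT (f : R -> borel V).
Proof.
move=> [B cB].
apply: (@measurability _ _ _ (borel V) setT (f : R -> borel V) (@open V) erefl).
move=> _ [U oU <-]; rewrite setTI.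
pose O := [set t | t \notin B /\ U (f t)].
have -> : f @^-1` U = O `|` ([set` B] `&` f @^-1` U).
  apply/seteqP; split => [t Ut|t [[_ //]|[_ //]]].
  by case: (boolP (t \in B)) => tB; [right|left].
apply: measurableU.
  apply: open_measurable; rewrite openE => t [tB Ut]; rewrite /interior /=.
  have : \forall s \near t, U (f s) by apply: (cB t tB); exact: open_nbhs_nbhs.
  by apply: filterS2 (near_notin tB) => s.
apply: countable_measurable => [s|]; first exact: measurable_set1.
by apply: finite_set_countable; apply: finite_setIl; exact: finite_seq.
Qed.

Lemma pcont_norm_measurable (V : normedModType R) (f : R -> V) : pcont f ->
  measurable_fun setT (fun t => `|f t|).
Proof.
move=> /pcont_measurable mf.
by apply: (@measurable_borel_real R _ _ V setT f (fun v => `|v|)) => //; exact: norm_continuous.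
Qed.

Lemma pcont_shift (V : normedModType R) (f : R -> V) (a : R) : pcont f ->
  pcont (fun t => f (t + a)).
Proof.
move=> [B cB]; exists [seq b - a | b <- B] => t tB.
apply: (continuous_comp (f := fun t => t + a) (g := f)).
  by apply: cvgD; [exact: cvg_id|exact: cvg_cst].
apply: cB; apply: contra tB => taB.
by apply/mapP; exists (t + a) => //; rewrite addrK.
Qed.

Lemma pcontB (V : normedModType R) (f g : R -> V) : pcont f -> pcont g ->
  pcont (fun t => f t - g t).
Proof.
move=> [B cB] [B' cB']; exists (B ++ B') => t.
rewrite mem_cat negb_or => /andP[tB tB'].
by apply: cvgB; [exact: cB|exact: cB'].
Qed.

Lemma pcont_cts (V : normedModType R) (f : R -> V) : continuous f -> pcont f.
Proof. by move=> cf; exists [::] => t _; exact: cf. Qed.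

Lemma ae_notin (B : seq R) : {ae mu, forall t, t \notin B}.
Proof.
exists [set` B]; split; last by move=> t /= /negP; rewrite negbK.
  apply: countable_measurable => [s|]; first exact: measurable_set1.
  by apply: finite_set_countable; exact: finite_seq.
by apply: countable_lebesgue_measure0; apply: finite_set_countable; exact: finite_seq.
Qed.

End PiecewiseContinuity.

(* The j-th coordinate of e^(-At) y. *)
Local Notation decay S j t y := (expR (- (lam S j * t)) * ip S y (ebase S j)).

Section GreenOperator.
Context (R : realType) (H : completeNormedModType R) (S : setting H).
Local Notation mu := (@lebesgue_measure R).
Local Notation e := (ebase S).
Local Notation X := (Dalpha S).
Local Notation la j := (lam S j `^ alpha S).

(** With s = r - t, the kernel of the weighted-bounded solution of u' + lambda_j u = f: past sources
    act on the modes j >= n, future ones on j < n, with the minus sign of backward integration. *)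
Definition green (n j : nat) (s : R) : R :=
  if s < 0 then (if (j < n)%N then 0 else expR (lam S j * s))
  else (if (j < n)%N then - expR (lam S j * s) else 0).

Lemma measurable_green n j : measurable_fun setT (green n j).
Proof.
apply: measurable_fun_if => //; first exact: measurable_lt0.
- apply: measurable_funTS; case: (j < n)%N; last exact: measurable_expRZ.
  exact: measurable_cst.
- apply: measurable_funTS; case: (j < n)%N; last exact: measurable_cst.
  by apply: measurable_funN; exact: measurable_expRZ.
Qed.

(** The spectral input of the fixed point argument: one scalar kernel dominates every coordinate,
    and its weighted mass is at most q. It is instantiated at the gap and, for the initial value
    problem, at n = 0. *)
Record dichotomy (n : nat) (m : R) (kap : R -> R) (q : R) : Prop := Dichotomy {
  dich_meas : measurable_fun setT kap ;
  dich_bound : forall j s, la j * `|green n j s| <= kap s ;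
  dich_int : (\int[mu]_s (kap s * expR (- (m * s)))%:E <= q%:E)%E
}.

Record admissible (m C : R) (f : R -> H) : Prop := Admissible {
  adm_pcont : pcont f ;
  adm_bound : forall t, expR (m * t) * `|f t| <= C
}.

Section Fixed.
Variables (n : nat) (m : R) (kap : R -> R) (q : R).
Hypothesis dich : dichotomy n m kap q.

Let mkap := dich_meas dich.

Lemma kap_ge0 s : 0 <= kap s.
Proof.
by apply: le_trans (dich_bound dich 0%N s); rewrite mulr_ge0// ltW// lam_powR_gt0.
Qed.

Lemma dich_q_ge0 : 0 <= q.
Proof.
rewrite -lee_fin; apply: le_trans (dich_int dich); apply: integral_ge0 => s _.
by rewrite lee_fin mulr_ge0 ?kap_ge0 ?expR_ge0.
Qed.

Lemma measurable_kap_exp : measurable_fun setT (fun s => kap s * expR (- (m * s))).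
Proof.
apply: measurable_funM => //; under eq_fun do rewrite -mulNr; exact: measurable_expRZ.
Qed.

Lemma integrable_kap_exp : mu.-integrable setT (EFin \o (fun s => kap s * expR (- (m * s)))).
Proof.
apply/integrableP; split; first by apply/measurable_EFinP; exact: measurable_kap_exp.
apply: le_lt_trans (ltry q); apply: le_trans (dich_int dich).
apply: le_of_eq; apply: eq_integral => s _.
by rewrite /= ger0_norm// mulr_ge0 ?kap_ge0 ?expR_ge0.
Qed.

Lemma adm_shift_bound C f t s : admissible m C f ->
  `|f (s + t)| <= C * expR (- (m * t)) * expR (- (m * s)).
Proof.
move=> af; have := adm_bound af (s + t).
rewrite mulrC -ler_pdivlMr ?expR_gt0// -expRN => h.
by rewrite (le_trans h)// -mulrA -expRD -opprD -mulrDr addrC [t + s]addrC.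
Qed.

Lemma adm_C_ge0 C f : admissible m C f -> 0 <= C.
Proof. by move=> af; apply: le_trans (adm_bound af 0); rewrite mulr_ge0 ?expR_ge0. Qed.

Lemma adm_dominated C f t s : admissible m C f ->
  kap s * `|f (s + t)| <= C * expR (- (m * t)) * (kap s * expR (- (m * s))).
Proof.
move=> af; rewrite mulrCA ler_wpM2l ?kap_ge0//; exact: adm_shift_bound.
Qed.

Lemma integrable_kap_adm C f t : admissible m C f ->
  mu.-integrable setT (EFin \o (fun s => kap s * `|f (s + t)|)).
Proof.
move=> af; have mf := pcont_norm_measurable (pcont_shift t (adm_pcont af)).
apply: (@integrable_dominated R _ _ (fun s => C * expR (- (m * t)) * (kap s * expR (- (m * s))))) => //.
- exact: measurable_funM.
- move=> s _; rewrite ger0_norm ?mulr_ge0 ?kap_ge0//; exact: adm_dominated.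
- have := integrableZl measurableT (C * expR (- (m * t))) integrable_kap_exp.
  by apply: eq_integrable => // s _ /=; rewrite EFinM.
Qed.

Lemma measurable_adm_ip C f t y : admissible m C f ->
  measurable_fun setT (fun s : R => ip S (f (s + t)) y).
Proof.
move=> af; have mf := pcont_measurable (pcont_shift t (adm_pcont af)).
exact: (measurable_borel_real (@ip_continuous R H S y) measurableT mf).
Qed.

Definition green_coef f t j : R :=
  \int[mu]_s (green n j s * ip S (f (s + t)) (e j)).

Lemma norm_e j : `|e j| = 1.
Proof. by apply/eqP; rewrite -(@pexpr_eq1 _ _ 2)// -(ip_norm S) e_orthonormal eqxx. Qed.

Lemma green_term_bound f t j s :
  `|la j * (green n j s * ip S (f (s + t)) (e j))| <= kap s * `|f (s + t)|.
Proof.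
rewrite normrM (ger0_norm (ltW (lam_powR_gt0 S j))) normrM mulrA.
apply: ler_pM => //; first by rewrite mulr_ge0// ltW// lam_powR_gt0.
  exact: (dich_bound dich).
by rewrite (le_trans (ip_CS S _ _))// norm_e mulr1.
Qed.

Lemma integrable_green_term C f t j : admissible m C f ->
  mu.-integrable setT (EFin \o (fun s => green n j s * ip S (f (s + t)) (e j))).
Proof.
move=> af; have mf := measurable_adm_ip t (e j) af.
have mg := measurable_green n j.
have := integrableZl measurableT (la j)^-1 (integrable_kap_adm t af).
apply: le_integrable => //; first exact/measurable_EFinP/measurable_funM.
move=> s _ /=; rewrite lee_fin (le_trans _ (ler_norm _))//.
rewrite [leRHS]mulrC ler_pdivlMr ?lam_powR_gt0// mulrC.
by rewrite -[la j]gtr0_norm ?lam_powR_gt0// -normrM; exact: green_term_bound.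
Qed.

(** Minkowski's inequality for integrals, by duality. With b_j the terms of the sum, s2 = sum b_j^2
    is the integral of the pairing of f with sum_j b_j lambda_j^alpha green_j e_j, a vector of norm
    at most sqrt(s2) kappa. Hence s2 <= sqrt(s2) M. *)
Lemma green_coef_sum_le C f t N : admissible m C f ->
  \sum_(0 <= j < N) (la j * green_coef f t j) ^+ 2 <=
  (\int[mu]_s (kap s * `|f (s + t)|)) ^+ 2.
Proof.
move=> af; set M := \int[mu]_s _.
have M0 : 0 <= M by apply: Rintegral_ge0 => s _; rewrite mulr_ge0 ?kap_ge0.
pose b j := la j * green_coef f t j; pose s2 := \sum_(0 <= j < N) b j ^+ 2.
have s20 : 0 <= s2 by apply: sumr_ge0 => j _; rewrite sqr_ge0.
have int_term j : mu.-integrable setT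
    (EFin \o (fun s => b j * la j * (green n j s * ip S (f (s + t)) (e j)))).
  have := integrableZl measurableT (b j * la j) (integrable_green_term t j af).
  by apply: eq_integrable.
have sumE : s2 = \int[mu]_s (\sum_(0 <= j < N)
    (b j * la j * (green n j s * ip S (f (s + t)) (e j)))).
  rewrite /s2; elim: N => [|N ih] in s2 s20 *.
    by rewrite big_nil; under eq_Rintegral do rewrite big_nil; rewrite Rintegral_cst// mul0r.
  under eq_Rintegral do rewrite big_nat_recr//=.
  rewrite big_nat_recr//= RintegralD//; last first.
    exact: integrable_fin_sum.
  rewrite -ih//; last by apply: sumr_ge0 => j _; rewrite sqr_ge0.
  congr (_ + _); rewrite RintegralZl//; last exact: integrable_green_term t N af.
  by rewrite expr2 /b mulrA.
have le1 : s2 <= Num.sqrt s2 * M.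
  rewrite {1}sumE /M -RintegralZl//; last exact: integrable_kap_adm af.
  apply: le_Rintegral => //.
  - exact: integrable_fin_sum.
  - have := integrableZl measurableT (Num.sqrt s2) (integrable_kap_adm t af).
    by apply: eq_integrable.
  - move=> s _.
    pose u := \sum_(0 <= j < N) (b j * la j * green n j s) *: e j.
    have -> : \sum_(0 <= j < N) b j * la j * (green n j s * ip S (f (s + t)) (e j))
        = ip S u (f (s + t)).
      by rewrite /u ip_suml; apply: eq_bigr => j _; rewrite ipZl mulrA ip_sym.
    rewrite (le_trans (ler_norm _))// (le_trans (ip_CS S _ _))// mulrA ler_wpM2r//.
    rewrite -ler_sqr ?nnegrE ?mulr_ge0 ?kap_ge0 ?sqrtr_ge0// exprMn sqr_sqrtr//.
    rewrite /u (norm_sum_sq S) ?iota_uniq// /s2 mulr_suml; apply: ler_sum => j _.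
    rewrite -mulrA exprMn ler_wpM2l ?sqr_ge0//.
    rewrite -[leLHS]real_normK ?num_real// ler_sqr ?nnegrE ?kap_ge0//.
    by rewrite normrM (ger0_norm (ltW (lam_powR_gt0 S j))); exact: (dich_bound dich).
have [s0|s0] := eqVneq s2 0; first by rewrite -/s2 s0 sqr_ge0.
have sq0 : 0 < Num.sqrt s2 by rewrite sqrtr_gt0 lt_neqAle eq_sym s0.
rewrite -/s2 -[leLHS](sqr_sqrtr s20) ler_sqr ?nnegrE ?sqrtr_ge0//.
by rewrite -(ler_pM2l sq0) -expr2 sqr_sqrtr.
Qed.

(** Selected by its coordinates. For admissible f such a vector exists, so the default 0 does not
    intervene. *)
Definition Lop f t : X := xget 0 [set u | forall j, Dcoef u j = green_coef f t j].

Lemma Lop_spec C f t : admissible m C f ->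
  (forall j, Dcoef (Lop f t) j = green_coef f t j) /\
  `|Lop f t| <= \int[mu]_s (kap s * `|f (s + t)|).
Proof.
move=> af.
have M0 : 0 <= \int[mu]_s (kap s * `|f (s + t)|).
  by apply: Rintegral_ge0 => s _; rewrite mulr_ge0 ?kap_ge0.
have [u uE uM] := Dalpha_build M0 (fun N => green_coef_sum_le t N af).
have LE : forall j, Dcoef (Lop f t) j = green_coef f t j.
  by rewrite /Lop; case: xgetP => [v _ //|/(_ u)].
split => //; suff -> : Lop f t = u by [].
by apply: Dcoef_inj => j; rewrite uE LE.
Qed.

Lemma Lop_coef C f t j : admissible m C f -> Dcoef (Lop f t) j = green_coef f t j.
Proof. by move=> af; have [] := Lop_spec t af. Qed.

Lemma Lop_bound C f t : admissible m C f -> expR (m * t) * `|Lop f t| <= q * C.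
Proof.
move=> af; have [_ h] := Lop_spec t af.
rewrite mulrC -ler_pdivlMr ?expR_gt0// -expRN (le_trans h)//.
have C0 := adm_C_ge0 af.
apply: (@le_trans _ _ (\int[mu]_s (C * expR (- (m * t)) * (kap s * expR (- (m * s)))))).
  apply: le_Rintegral => //; first exact: integrable_kap_adm af.
    have := integrableZl measurableT (C * expR (- (m * t))) integrable_kap_exp.
    by apply: eq_integrable.
  by move=> s _; exact: adm_dominated.
rewrite RintegralZl//; last exact: integrable_kap_exp.
rewrite [leLHS]mulrC -mulrA ler_wpM2r ?mulr_ge0 ?expR_ge0//.
rewrite /Rintegral -lee_fin fineK ?(dich_int dich)//.
by apply: integrable_fin_num => //; exact: integrable_kap_exp.
Qed.

Lemma green_coefB C C' f g t j : admissible m C f -> admissible m C' g ->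
  green_coef f t j - green_coef g t j = green_coef (fun s => f s - g s) t j.
Proof.
move=> af ag; rewrite /green_coef -RintegralB//.
- by apply: eq_Rintegral => s _; rewrite -mulrBr ipDl ipNl.
- exact: integrable_green_term af.
- exact: integrable_green_term ag.
Qed.

Lemma admB C C' f g : admissible m C f -> admissible m C' g ->
  admissible m (C + C') (fun s => f s - g s).
Proof.
move=> af ag; split; first by apply: pcontB; [exact: adm_pcont af|exact: adm_pcont ag].
move=> t; apply: le_trans (lerD (adm_bound af t) (adm_bound ag t)).
by rewrite -mulrDr ler_wpM2l ?expR_ge0// ler_normB.
Qed.

Lemma LopB C C' f g t : admissible m C f -> admissible m C' g ->
  Lop f t - Lop g t = Lop (fun s => f s - g s) t.
Proof.
move=> af ag; apply: Dcoef_inj => j.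
rewrite DcoefB (Lop_coef t j af) (Lop_coef t j ag) (Lop_coef t j (admB af ag)).
exact: green_coefB af ag.
Qed.

Lemma adm_shift C f a : admissible m C f ->
  admissible m (C * expR (- (m * a))) (fun s => f (s + a)).
Proof.
move=> af; split; first exact: pcont_shift (adm_pcont af).
move=> t; rewrite mulrC -ler_pdivlMr ?expR_gt0// -expRN.
exact: adm_shift_bound.
Qed.

Lemma Lop_shift f a t : Lop (fun s => f (s + a)) t = Lop f (t + a).
Proof.
rewrite /Lop; congr xget; apply/funext => u; apply/propext.
by split => h j; rewrite h; apply: eq_Rintegral => s _; rewrite ?addrA// addrA.
Qed.

(** Translating f changes the value by at most phi, the integral of kappa against the translation
    difference of f. Dominated convergence sends phi to 0, the integrand converging off the finitely
    many exceptional points of f. *)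
Lemma Lop_continuous C f : admissible m C f -> continuous (Lop f).
Proof.
move=> af t.
pose phi h := \int[mu]_s (kap s * `|f (s + h) - f (s + t)|).
have phi0 : phi h @[h --> t] --> (0 : R).
  apply/(@cvg_nbhsP _ R^o) => w wt.
  have : expR (- (m * w i)) @[i --> \oo] --> expR (- (m * t)).
    apply: (cvg_comp _ expR); last exact: continuous_expR.
    by apply: cvgN; apply: cvgM => //; exact: cvg_cst.
  (* The convergent sequence e^(-m w_i) is bounded by D + 1, which makes the majorant G independent
     of i. *)
  move=> /cvgP/cvg_seq_bounded [D [Dr DP]].
  have D1 i : expR (- (m * w i)) <= D + 1.
    have := DP (D + 1) ltac:(by rewrite ltrDl) i I.
    by rewrite /= ger0_norm// expR_ge0.
  pose G s := (C * (D + 1) + C * expR (- (m * t))) * (kap s * expR (- (m * s))).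
  pose fn i s : \bar R := (kap s * `|f (s + w i) - f (s + t)|)%:E.
  have mfn i : measurable_fun setT (fn i).
    apply/measurable_EFinP; apply: measurable_funM => //.
    apply: pcont_norm_measurable; apply: pcontB; exact: pcont_shift (adm_pcont af).
  have fn0 : {ae mu, forall s, setT s -> fn i s @[i --> \oo] --> (0 : R)%:E}.
    have [B cB] := pcont_shift t (adm_pcont af).
    have [A [mA A0 AB]] := @ae_notin R B; exists A; split => // s /= h.
    apply: AB => sB; apply: h => _; apply: cvg_EFin; first exact: nearW.
    rewrite /fn /comp /= -(mulr0 (kap s)); apply: cvgM; first exact: cvg_cst.
    rewrite -(@normr0 _ H) -(subrr (f (s + t))); apply: cvg_norm.
    apply: cvgB; last exact: cvg_cst.
    have hs : (s + w i - t) @[i --> \oo] --> s.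
      rewrite -[X in _ --> X](addrK t); apply: cvgB; last exact: cvg_cst.
      by apply: cvgD => //; exact: cvg_cst.
    have hc : (fun s => f (s + t)) (s + w i - t) @[i --> \oo] --> f (s + t).
      exact: (cvg_comp _ _ hs (cB s sB)).
    rewrite (_ : (fun i => f (s + w i)) = (fun i => f (s + w i - t + t)))//.
    by apply/funext => i; rewrite subrK.
  have iG : mu.-integrable setT (EFin \o G).
    have := integrableZl measurableT (C * (D + 1) + C * expR (- (m * t))) integrable_kap_exp.
    by apply: eq_integrable.
  have fG : {ae mu, forall s i, setT s -> (`|fn i s| <= (EFin \o G) s)%E}.
    apply: aeW => s i _; rewrite /fn /G /= lee_fin ger0_norm ?mulr_ge0 ?kap_ge0//.
    rewrite [leRHS]mulrCA ler_wpM2l ?kap_ge0// (le_trans (ler_normB _ _))//.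
    rewrite mulrDl lerD//; last exact: adm_shift_bound.
    rewrite (le_trans (adm_shift_bound _ _ af))// ler_wpM2r ?expR_ge0//.
    by rewrite ler_wpM2l// (adm_C_ge0 af).
  have [_ _] := @dominated_convergence _ _ _ mu setT measurableT fn (cst 0%:E) _ mfn
    (measurable_cst _) fn0 iG fG.
  rewrite integral0 => h; apply: fine_cvg; exact: h.
apply/cvgrPdist_le => eps eps0.
have /cvgrPdist_le /(_ _ eps0) := phi0; apply: filterS => h.
rewrite sub0r normrN ger0_norm; last by apply: Rintegral_ge0 => s _; rewrite mulr_ge0 ?kap_ge0.
have LE x : Lop f x = Lop (fun s => f (s + x)) 0 by rewrite Lop_shift add0r.
apply: le_trans; rewrite distrC (LE h) (LE t) (LopB 0 (adm_shift h af) (adm_shift t af)) /phi.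
have [_ h2] := Lop_spec 0 (admB (adm_shift h af) (adm_shift t af)).
by apply: le_trans h2 _; under eq_Rintegral do rewrite addr0.
Qed.

End Fixed.
End GreenOperator.

(** * Contraction in the weighted space *)

Section FixedPoint.
Context (R : realType) (H : completeNormedModType R) (S : setting H).
Local Notation X := (Dalpha S).
Variables (n : nat) (m : R) (kap : R -> R) (q L : R).
Hypothesis dich : dichotomy S n m kap q.
Hypothesis L0 : 0 <= L.
Hypothesis Lq1 : L * q < 1.

Let q0 : 0 <= q := dich_q_ge0 dich.
(** Contraction factor of the Picard map, to be distinguished from the k of the gap condition. *)
Let k := L * q.
Let k0 : 0 <= k. Proof. exact: mulr_ge0. Qed.

Definition weighted_bounded (B : R) (p : R -> X) : Prop :=
  forall t, expR (m * t) * `|p t| <= B.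

(** The weight bound concerns N(t, 0) only; with the Lipschitz bound it makes N(t, p(t)) admissible
    for every continuous weighted-bounded p. *)
Record nonlinearity (C : R) (N : R -> X -> H) : Prop := Nonlinearity {
  nl_pcont : forall p : R -> X, continuous p -> pcont (fun t => N t (p t)) ;
  nl_lip : forall t a b, `|N t a - N t b| <= L * `|a - b| ;
  nl_bound : forall t, expR (m * t) * `|N t 0| <= C
}.

Lemma nl_admissible C N p B : nonlinearity C N -> continuous p ->
  weighted_bounded B p -> admissible m (L * B + C) (fun t => N t (p t)).
Proof.
move=> nl cp bp; split; first exact: (nl_pcont nl).
move=> t; rewrite -[N t (p t)](subrK (N t 0)).
apply: (@le_trans _ _ (expR (m * t) * (L * `|p t| + `|N t 0|))).
  rewrite ler_wpM2l ?expR_ge0// (le_trans (ler_normD _ _))// lerD2r.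
  by have := nl_lip nl t (p t) 0; rewrite subr0.
rewrite mulrDr lerD ?(nl_bound nl)// mulrCA ler_wpM2l//; exact: bp.
Qed.

Fixpoint picard (N : R -> X -> H) (i : nat) : R -> X :=
  if i is i'.+1 then Lop S n (fun s => N s (picard N i' s)) else fun=> 0.

Lemma Lop_diff_bound C C' f g D : admissible m C f -> admissible m C' g ->
  (forall t, expR (m * t) * `|f t - g t| <= D) ->
  forall t, expR (m * t) * `|Lop S n f t - Lop S n g t| <= q * D.
Proof.
move=> af ag fg t; rewrite (LopB dich t af ag); apply: (Lop_bound dich).
by split => //; apply: pcontB; [exact: adm_pcont af|exact: adm_pcont ag].
Qed.

Lemma picard_regular C N i : nonlinearity C N -> 0 <= C ->
  continuous (picard N i) /\ exists2 B, 0 <= B & weighted_bounded B (picard N i).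
Proof.
move=> nl C0; elim: i => [|i [ci [B B0 bi]]] /=.
  split; first by move=> t; exact: cvg_cst.
  by exists 0 => // t; rewrite normr0 mulr0.
have ad := nl_admissible nl ci bi; split; first exact: (Lop_continuous dich ad).
exists (q * (L * B + C)); first by rewrite mulr_ge0// addr_ge0// mulr_ge0.
by move=> t; exact: (Lop_bound dich t ad).
Qed.

Lemma picard_diff C N i : nonlinearity C N -> 0 <= C ->
  weighted_bounded (k ^+ i * (q * C)) (fun t => picard N i.+1 t - picard N i t).
Proof.
move=> nl C0; elim: i => [|i ih] t /=.
  rewrite subr0 expr0 mul1r; apply: (Lop_bound dich).
  split; last exact: (nl_bound nl).
  by apply: (nl_pcont nl) => s; exact: cvg_cst.
have [c1 [B1 B10 b1]] := picard_regular i.+1 nl C0.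
have [c2 [B2 B20 b2]] := picard_regular i nl C0.
rewrite exprS -mulrA (_ : k * _ = q * (L * (k ^+ i * (q * C)))); last by rewrite /k; ring.
apply: Lop_diff_bound; [exact: nl_admissible nl c1 b1|exact: nl_admissible nl c2 b2|].
move=> s; apply: (@le_trans _ _ (expR (m * s) * (L * `|picard N i.+1 s - picard N i s|))).
  by rewrite ler_wpM2l ?expR_ge0//; exact: (nl_lip nl).
by rewrite mulrCA ler_wpM2l//; exact: ih.
Qed.

Let K C := q * C / (1 - k).

(** Telescoping of [picard_diff]. Writing the geometric sum as a difference k^i - k^(i+l) is what
    closes the induction on l. *)
Lemma picard_tail C N i l : nonlinearity C N -> 0 <= C ->
  weighted_bounded (K C * (k ^+ i - k ^+ (i + l)))
    (fun t => picard N (i + l) t - picard N i t).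
Proof.
move=> nl C0 t; elim: l => [|l ih]; first by rewrite addn0 !subrr normr0 !mulr0.
rewrite addnS -(subrKA (picard N (i + l) t)).
apply: (@le_trans _ _ (expR (m * t) * `|picard N (i + l).+1 t - picard N (i + l) t|
   + expR (m * t) * `|picard N (i + l) t - picard N i t|)).
  by rewrite -mulrDr ler_wpM2l ?expR_ge0// ler_normD.
apply: le_trans (lerD (picard_diff (i + l) nl C0 t) ih) _.
apply: le_of_eq; rewrite /K exprS; field.
by rewrite gt_eqF// subr_gt0.
Qed.

Lemma expR_weight_le t (x B : R) : (expR (m * t) * x <= B) = (x <= B * expR (- (m * t))).
Proof. by rewrite mulrC -ler_pdivlMr ?expR_gt0// -expRN. Qed.

Lemma geometric_small (c eps : R) : 0 < eps -> exists i : nat, c * k ^+ i < eps.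
Proof.
move=> eps0; have ck : c * k ^+ i @[i --> \oo] --> 0.
  rewrite -(mulr0 c); apply: cvgM; first exact: cvg_cst.
  by apply: cvg_expr; rewrite ger0_norm.
have /cvgrPdist_lt /(_ _ eps0) [i _ /(_ i (leqnn i))] := ck.
by rewrite sub0r normrN => h; exists i; rewrite (le_lt_trans (ler_norm _)).
Qed.

(** At each time the iterates are Cauchy with rate k^i e^(-m t). Their pointwise convergence is part
    of the conclusion because measurability in omega is read off from it. *)
Lemma fixed_point C N : nonlinearity C N -> 0 <= C ->
  exists p : R -> X, [/\ continuous p, exists B, weighted_bounded B p,
    forall t, p t = Lop S n (fun s => N s (p s)) t
    & forall t, picard N i t @[i --> \oo] --> p t].
Proof.
move=> nl C0.
have K0 : 0 <= K C by rewrite /K divr_ge0 ?mulr_ge0// subr_ge0 ltW.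
have KE t : 0 <= K C * expR (- (m * t)) by rewrite mulr_ge0// expR_ge0.
have tail i l t : `|picard N (i + l) t - picard N i t| <= K C * expR (- (m * t)) * k ^+ i.
  have := picard_tail i l nl C0 t; rewrite expR_weight_le => h; apply: le_trans h _.
  rewrite mulrAC ler_wpM2l//.
  by rewrite lerBlDr lerDl exprn_ge0.
have cv t : cvgn (fun i => picard N i t).
  apply: cauchy_cvg; apply/cauchy_ballP => eps eps0.
  have e2 : 0 < eps / 2 by rewrite divr_gt0.
  have [i0 Hi] := geometric_small (K C * expR (- (m * t))) e2.
  pose A := [set picard N i t | i in [set i | (i0 <= i)%N]].
  exists (A, A) => /=; first by split; exists i0 => // i ii; exists i.
  move=> [_ _] /= [[i ii <-] [j jj <-]]; rewrite -ball_normE /=.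
  rewrite -(subnKC ii) -(subnKC jj) -(subrKA (picard N i0 t)) (le_lt_trans (ler_normD _ _))//.
  rewrite [`|picard N i0 t - _|]distrC.
  apply: (le_lt_trans (lerD (tail i0 (i - i0)%N t) (tail i0 (j - i0)%N t))).
  by rewrite [eps]splitr; exact: (ltrD Hi Hi).
pose p t := limn (fun i => picard N i t).
have pl t : picard N i t @[i --> \oo] --> p t by exact: cv.
have ptail i t : `|p t - picard N i t| <= K C * expR (- (m * t)) * k ^+ i.
  have hl : `|picard N (i + l) t - picard N i t| @[l --> \oo] --> `|p t - picard N i t|.
    apply: cvg_norm; apply: cvgB; last exact: cvg_cst.
    by apply: (cvg_comp (fun l => (i + l)%N) (fun l => picard N l t)) (pl t); exact: cvg_addnl.
  rewrite -(cvg_lim _ hl)//; apply: limr_le; first by apply/cvg_ex; eexists; exact: hl.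
  by apply: nearW => l; exact: tail.
(* The convergence is uniform only locally: the rate carries e^(-m s), which is at most M near t. *)
have cp : continuous p.
  move=> t; apply/cvgrPdist_lt => eps eps0.
  have e3 : 0 < eps / 3 by rewrite divr_gt0.
  pose M := expR (- (m * t)) + 1.
  have cE : expR (- (m * s)) @[s --> t] --> expR (- (m * t)).
    apply: (cvg_comp _ expR); last exact: continuous_expR.
    by apply: cvgN; apply: cvgM; [exact: cvg_cst|exact: cvg_id].
  have [i Hi] := geometric_small (K C * M) e3.
  have bd s : expR (- (m * s)) <= M -> `|p s - picard N i s| < eps / 3.
    move=> sM; apply: le_lt_trans (ptail i s) (le_lt_trans _ Hi).
    by rewrite ler_wpM2r ?exprn_ge0// ler_wpM2l.
  have [ci _] := picard_regular i nl C0.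
  near=> s.
  rewrite -(subrKA (picard N i t)) (le_lt_trans (ler_normD _ _))//.
  rewrite -(subrKA (picard N i s) (picard N i t)).
  have -> : eps = eps / 3 + (eps / 3 + eps / 3) by field.
  apply: ltrD; first by apply: bd; rewrite lerDl.
  rewrite (le_lt_trans (ler_normD _ _))// ltrD//.
    by near: s; move/cvgrPdist_lt : (ci t); exact.
  rewrite distrC; apply: bd; near: s.
  move/cvgrPdist_lt : cE => /(_ _ ltr01); apply: filterS => s.
  by rewrite distrC ltr_norml => /andP[_ h]; rewrite ltW// -ltrBlDl.
have bp : exists B, weighted_bounded B p.
  exists (K C) => t; rewrite expR_weight_le.
  by have := ptail 0%N t; rewrite /= subr0 expr0 mulr1.
(* Both p and its image are within a geometric error of the iterate i + 1, so their difference is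
   below every eps. *)
exists p; split => // t; apply/eqP; rewrite -subr_eq0 -normr_eq0; apply/eqP.
apply: le_anti; rewrite normr_ge0 andbT; apply/ler_addgt0Pr => eps eps0; rewrite add0r.
have [B bB] := bp.
have [i Hi] := geometric_small (2 * (K C * expR (- (m * t)))) eps0.
have [ci [Bi _ bi]] := picard_regular i nl C0.
have l2 : `|Lop S n (fun s => N s (picard N i s)) t - Lop S n (fun s => N s (p s)) t|
    <= K C * expR (- (m * t)) * k ^+ i.
  rewrite mulrAC -expR_weight_le.
  apply: (@le_trans _ _ (q * (L * (K C * k ^+ i)))).
    apply: Lop_diff_bound; [exact: nl_admissible nl ci bi|exact: nl_admissible nl cp bB|].
    move=> s; apply: (@le_trans _ _ (expR (m * s) * (L * `|picard N i s - p s|))).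
      by rewrite ler_wpM2l ?expR_ge0//; exact: (nl_lip nl).
    rewrite mulrCA ler_wpM2l// expR_weight_le distrC mulrAC; exact: ptail.
  by rewrite mulrA [q * L]mulrC ler_piMl ?(ltW Lq1)//; apply: mulr_ge0 => //; exact: exprn_ge0.
have l1 : `|p t - picard N i.+1 t| <= K C * expR (- (m * t)) * k ^+ i.
  apply: le_trans (ptail i.+1 t) _; rewrite exprS mulrCA.
  by rewrite ler_piMl ?(ltW Lq1)//; apply: mulr_ge0 => //; exact: exprn_ge0.
rewrite -(subrKA (picard N i.+1 t)) (le_trans (ler_normD _ _))//.
apply: le_trans (lerD l1 l2) _; apply: le_trans _ (ltW Hi).
by apply: le_of_eq; ring.
Unshelve. all: by end_near. Qed.

(** The weighted supremum of |p1 - p2| is finite thanks to B1 and B2, so sup <= q (L sup + D) can be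
    solved for it. D collects the difference of the data. *)
Lemma fixed_point_stability p1 p2 f1 f2 C1 C2 B1 B2 D :
  admissible m C1 f1 -> admissible m C2 f2 ->
  weighted_bounded B1 p1 -> weighted_bounded B2 p2 ->
  (forall t, p1 t = Lop S n f1 t) -> (forall t, p2 t = Lop S n f2 t) ->
  (forall t, expR (m * t) * `|f1 t - f2 t| <= L * (expR (m * t) * `|p1 t - p2 t|) + D) ->
  forall t, expR (m * t) * `|p1 t - p2 t| <= q * D / (1 - L * q).
Proof.
move=> a1 a2 b1 b2 e1 e2 hd t.
pose E := [set expR (m * t) * `|p1 t - p2 t| | t in setT].
have E0 : E !=set0 by exists (expR (m * 0) * `|p1 0 - p2 0|); exists 0.
have Eb : has_ubound E.
  exists (B1 + B2) => _ [s _ <-]; apply: le_trans (lerD (b1 s) (b2 s)).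
  by rewrite -mulrDr ler_wpM2l ?expR_ge0// ler_normB.
have leE s : expR (m * s) * `|p1 s - p2 s| <= sup E by apply: ub_le_sup => //; exists s.
have supE : sup E <= q * (L * sup E + D).
  apply: ge_sup => // _ [s _ <-]; rewrite e1 e2.
  apply: (Lop_diff_bound a1 a2) => r; apply: le_trans (hd r) _.
  by rewrite lerD2r ler_wpM2l.
apply: le_trans (leE t) _; rewrite ler_pdivlMr ?subr_gt0//.
rewrite mulrBr mulr1 lerBlDr; apply: le_trans supE _.
by rewrite mulrDr addrC mulrCA mulrA [_ * sup E]mulrC.
Qed.

End FixedPoint.

(** * The semigroup and Bochner integrals in coordinates *)

Section BochnerCoordinates.
Context (R : realType) (H : completeNormedModType R) (S : setting H).
Local Notation mu := (@lebesgue_measure R).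
Local Notation e := (ebase S).

Lemma spectral_coefE (c : nat -> R) (u : H) (B : R) : 0 <= B ->
  (forall N, \sum_(0 <= j < N) (c j * ip S u (e j)) ^+ 2 <= B ^+ 2) ->
  (forall j, ip S (spectral S c u) (e j) = c j * ip S u (e j)) /\ `|spectral S c u| <= B.
Proof.
move=> B0 h; have [w wE wB] := @riesz_fischer R H S _ B B0 h.
suff -> : spectral S c u = w by [].
rewrite /spectral /spectral_series; under [X in series X]eq_fun do rewrite -wE.
by apply: cvg_lim => //; exact: e_basis.
Qed.

Lemma semigroup_coef_norm t (u : H) : 0 <= t ->
  (forall j, ip S (semigroup S t u) (e j) = expR (- (lam S j * t)) * ip S u (e j)) /\
  `|semigroup S t u| <= `|u|.
Proof.
move=> t0; have [|h1 h2] := @spectral_coefE (fun j => expR (- lam S j * t)) u _ (normr_ge0 u).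
  move=> N; apply: le_trans (bessel S u N); apply: ler_sum => j _.
  rewrite exprMn ler_piMl ?sqr_ge0// expr_le1 ?expR_ge0// -expR0 ler_expR mulNr oppr_le0.
  by rewrite mulr_ge0// ltW// lam_gt0.
by split => // j; rewrite h1 mulNr.
Qed.

Lemma semigroup_coef t (u : H) j : 0 <= t ->
  ip S (semigroup S t u) (e j) = expR (- (lam S j * t)) * ip S u (e j).
Proof. by move=> /(semigroup_coef_norm u)[->]. Qed.

Lemma semigroup_norm t (u : H) : 0 <= t -> `|semigroup S t u| <= `|u|.
Proof. by move=> /(semigroup_coef_norm u)[]. Qed.

(** Serves the negative times: only finitely many modes are present, so one constant B controls the
    growth. *)
Lemma semigroup_coef_fin n t (u : H) (B : R) : 0 <= B ->
  (forall j, (n <= j)%N -> ip S u (e j) = 0) ->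
  (forall j, (j < n)%N -> expR (- (lam S j * t)) <= B) ->
  (forall j, ip S (semigroup S t u) (e j) = expR (- (lam S j * t)) * ip S u (e j)) /\
  `|semigroup S t u| <= B * `|u|.
Proof.
move=> B0 u0 hB.
have [||h1 h2] := @spectral_coefE (fun j => expR (- lam S j * t)) u (B * `|u|).
- exact: mulr_ge0.
- move=> N; rewrite exprMn; apply: (@le_trans _ _ (\sum_(0 <= j < N) (B * ip S u (e j)) ^+ 2)).
    apply: ler_sum => j _; case: (ltnP j n) => jn; last by rewrite u0// !mulr0.
    by rewrite !exprMn ler_wpM2r ?sqr_ge0// ler_sqr ?nnegrE ?expR_ge0// mulNr hB.
  under eq_bigr do rewrite exprMn.
  by rewrite -mulr_sumr ler_wpM2l ?sqr_ge0// bessel.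
by split => // j; rewrite h1 mulNr.
Qed.

(** Both sides are linear in y and bounded by a multiple of |y|, the right one by the integral M of
    the norm. They agree on the finite expansions yN, which converge to y. *)
Lemma is_integral_coord (D : set R) (f : R -> H) (I : H) : measurable D ->
  (forall j, measurable_fun D (fun s => ip S (f s) (e j))) ->
  (\int[mu]_(s in D) (`|f s|)%:E < +oo)%E ->
  (forall j, ip S I (e j) = \int[mu]_(s in D) ip S (f s) (e j)) ->
  is_integral S D f I.
Proof.
move=> mD mf fi IE.
have mfb : measurable_fun D (f : R -> borel H) by exact: measurable_coef.
have mip y : measurable_fun D (fun s => ip S (f s) y).
  exact: (measurable_borel_real (@ip_continuous R H S y) mD mfb).
have mnf : measurable_fun D (fun s => `|f s|).
  exact: (measurable_borel_real (@norm_continuous R H) mD mfb).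
have inf : mu.-integrable D (EFin \o (fun s => `|f s|)).
  apply/integrableP; split; first exact/measurable_EFinP.
  by under eq_integral do rewrite /= normr_id.
have iip y : mu.-integrable D (EFin \o (fun s => ip S (f s) y)).
  apply: (@integrable_dominated R D _ (fun s => `|y| * `|f s|)) => //.
    by move=> s _; rewrite mulrC; exact: ip_CS.
  exact: integrable_scale.
split => // y.
pose yN N := \sum_(0 <= j < N) ip S y (e j) *: e j.
have E N : ip S I (yN N) = \int[mu]_(s in D) ip S (f s) (yN N).
  rewrite /yN; elim: N => [|N ih].
    rewrite big_nil ip_sym ip0l; under eq_Rintegral do rewrite ip_sym ip0l.
    by rewrite Rintegral_cst// mul0r.
  rewrite big_nat_recr//= ipDr ih ipZr IE.
  under [RHS]eq_Rintegral do rewrite ipDr ipZr.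
  rewrite RintegralD//; last first.
    exact: integrable_scale.
  by rewrite RintegralZl.
pose M := \int[mu]_(s in D) `|f s|.
have bound v : `|\int[mu]_(s in D) ip S (f s) v| <= M * `|v|.
  apply: le_trans; first exact: (le_normr_Rintegral _ (iip v)).
  rewrite /M mulrC -RintegralZl//; apply: le_Rintegral => //.
  - exact: integrable_norm.
  - exact: integrable_scale.
  - by move=> s _; rewrite mulrC; exact: ip_CS.
apply/eqP; rewrite -subr_eq0 -normr_eq0; apply/eqP.
apply: le_anti; rewrite normr_ge0 andbT; apply/ler_addgt0Pr => eps eps0; rewrite add0r.
have Mp : 0 < `|I| + M + 1.
  by rewrite ltr_wpDl// addr_ge0//; apply: Rintegral_ge0 => s _.
have c0 : 0 < eps / (`|I| + M + 1) by rewrite divr_gt0.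
have /cvgrPdist_lt /(_ _ c0) [N _ /(_ N (leqnn N))] := @e_basis R H S y.
rewrite seriesEnat -/(yN N) => yN0.
have -> : ip S I y - \int[mu]_(s in D) ip S (f s) y =
    ip S I (y - yN N) - \int[mu]_(s in D) ip S (f s) (y - yN N).
  under [in RHS]eq_Rintegral do rewrite ipDr ipNr.
  by rewrite ipDr ipNr E RintegralB//; ring.
rewrite (le_trans (ler_normB _ _))//.
apply: (@le_trans _ _ ((`|I| + M + 1) * `|y - yN N|)).
  rewrite !mulrDl mul1r ler_wpDr// lerD//; first exact: ip_CS.
by rewrite mulrC -ler_pdivlMr// ltW.
Qed.

End BochnerCoordinates.

(** * Green operator and variation of constants *)

Section Evolution.
Context (R : realType) (H : completeNormedModType R) (S : setting H).
Local Notation mu := (@lebesgue_measure R).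
Local Notation e := (ebase S).
Local Notation X := (Dalpha S).
Local Notation la j := (lam S j `^ alpha S).

(** Below the gap the domination is termwise. Above it write lambda_j = lambda_(n+1) + y:
    subadditivity splits off lambda_(n+1)^alpha, and y^alpha e^(y s) is absorbed by the singular
    term. *)
Lemma dichotomy_green n m l1 A : m < lam S n -> l1 < m -> 0 <= A ->
  (forall j, (j < n)%N -> la j <= A /\ lam S j <= l1) ->
  dichotomy S n m (green_kernel (alpha S) (lam S n) A l1)
    (A / (m - l1) + (lam S n `^ alpha S + c_const (alpha S) * (lam S n - m) `^ alpha S) / (lam S n - m)).
Proof.
move=> ml l1m A0 hA.
have a1 : alpha S < 1 by rewrite (lt_le_trans (alpha_lt S))// invf_le1// ler1n.
split; first exact: measurable_green_kernel; last first.
  by rewrite integral_green_kernel// ?alpha_ge0// ltW// lam_gt0.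
move=> j s; rewrite /green /green_kernel; case: ifP => s0; case: ltnP => jn.
- rewrite normr0 mulr0 mulr_ge0 ?expR_ge0// addr_ge0 ?powR_ge0//.
  by rewrite mulr_ge0 ?powR_ge0// singular_coef_ge0.
- rewrite ger0_norm ?expR_ge0//; pose y := lam S j - lam S n.
  have y0 : 0 <= y by rewrite subr_ge0 lam_nondecr.
  have -> : lam S j = lam S n + y by rewrite /y addrC subrK.
  have ln0 : 0 <= lam S n by rewrite ltW// lam_gt0.
  rewrite [(_ + y) * s]mulrDl [lam S n * s + _]addrC expRD mulrA ler_wpM2r ?expR_ge0//.
  have ey : expR (y * s) <= 1 by rewrite -expR0 ler_expR mulr_ge0_le0// ltW.
  have [az|an0] := eqVneq (alpha S) 0.
    rewrite az !powRr0 mul1r (le_trans ey)// lerDl.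
    by rewrite mulr_ge0 ?powR_ge0// singular_coef_ge0.
  have ap : 0 < alpha S by rewrite lt_neqAle eq_sym an0 alpha_ge0.
  apply: (@le_trans _ _ ((lam S n `^ alpha S + y `^ alpha S) * expR (y * s))).
    by rewrite ler_wpM2r ?expR_ge0// powR_subadditive// ?alpha_ge0// ltW.
  rewrite mulrDl lerD//; first by rewrite ler_piMr ?powR_ge0.
  have := @powR_exp_le R (alpha S) y (- s) ap y0; rewrite mulrN opprK; apply.
  by rewrite oppr_gt0.
- rewrite normrN ger0_norm ?expR_ge0//; have [h1 h2] := hA j jn.
  rewrite ler_pM ?powR_ge0 ?expR_ge0// ler_expR ler_wpM2r//.
  by rewrite leNgt s0.
- by rewrite normr0 mulr0 mulr_ge0 ?expR_ge0.
Qed.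

Section GreenCoef.
Variables (n : nat) (m : R) (kap : R -> R) (q : R).
Hypothesis dich : dichotomy S n m kap q.

Lemma green_coef_shift C f t j : admissible m C f ->
  mu.-integrable setT (EFin \o (fun r => green S n j (r - t) * ip S (f r) (e j))) /\
  green_coef S n f t j = \int[mu]_r (green S n j (r - t) * ip S (f r) (e j)).
Proof.
move=> af.
have := integrable_shift (- t) (integrable_green_term dich t j af).
rewrite (_ : EFin \o _ = EFin \o (fun r => green S n j (r - t) * ip S (f r) (e j))); last first.
  by apply/funext => r /=; rewrite subrK.
move=> iG; split => //.
rewrite -(Rintegral_shift t); last by have /integrableP[/measurable_EFinP] := iG.
by apply: eq_Rintegral => s _; rewrite addrK.
Qed.

Lemma green_coef_high C f t j : admissible m C f -> (n <= j)%N ->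
  green_coef S n f t j = \int[mu]_(r in `]-oo, t[) (decay S j (t - r) (f r)).
Proof.
move=> af nj; have [_ ->] := green_coef_shift t j af.
rewrite [RHS]Rintegral_mkcond; apply: eq_Rintegral => r _; rewrite patchE /green ltnNge nj /=.
rewrite subr_lt0; case: ifPn => rt.
  by rewrite mem_set ?in_itv//= -mulrN opprB.
by rewrite memNset ?mul0r//= in_itv /=; apply/negP.
Qed.

Lemma green_coef_low C f t j : admissible m C f -> (j < n)%N ->
  green_coef S n f t j = - \int[mu]_(r in `[t, +oo[) (decay S j (t - r) (f r)).
Proof.
move=> af nj; have [iG ->] := green_coef_shift t j af.
have E r : green S n j (r - t) * ip S (f r) (e j) =
    - ((fun r => decay S j (t - r) (f r)) \_ `[t, +oo[) r.
  rewrite patchE /green nj subr_lt0 mem_setE in_itv /= andbT; case: ltP => rt.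
    by rewrite mul0r oppr0.
  by rewrite mulNr; congr (- (expR _ * _)); ring.
rewrite [in RHS]Rintegral_mkcond -[RHS]mulN1r -RintegralZl//; last first.
  have := integrableZl measurableT (-1) iG; apply: eq_integrable => // r _ /=.
  by rewrite -EFinM E mulN1r opprK.
by apply: eq_Rintegral => r _; rewrite E mulN1r.
Qed.

(** Variation of constants between any two times of D, with no distinguished initial time, so that
    orbits can be restricted, shifted and glued. *)
Definition evol (D : set R) (f : R -> H) (u : R -> X) : Prop :=
  forall s t, s <= t -> D s -> D t -> forall j,
    Dcoef (u t) j = expR (- (lam S j * (t - s))) * Dcoef (u s) j +
      \int[mu]_(r in `[s, t[) (decay S j (t - r) (f r)).

(** For modes on either side of the gap, the Green function at t minus e^(-lambda_j (t - s)) times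
    the one at s is the plain exponential on [s, t[ and 0 elsewhere. *)
Lemma Lop_evol C f : admissible m C f -> evol setT f (Lop S n f).
Proof.
move=> af s t st _ _ j.
rewrite !(Lop_coef dich _ j af).
have [iGt ->] := green_coef_shift t j af.
have [iGs ->] := green_coef_shift s j af.
have E r : green S n j (r - t) * ip S (f r) (e j) - expR (- (lam S j * (t - s))) *
    (green S n j (r - s) * ip S (f r) (e j)) =
    ((fun r => decay S j (t - r) (f r)) \_ `[s, t[) r.
  rewrite patchE mem_setE in_itv /= mulrA -mulrBl /green !subr_lt0.
  have er : expR (lam S j * (r - t)) = expR (- (lam S j * (t - r))) by rewrite -mulrN opprB.
  have es : expR (- (lam S j * (t - s))) * expR (lam S j * (r - s)) = expR (- (lam S j * (t - r))).
    by rewrite -expRD; congr expR; ring.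
  case: (ltP r s) => rs /=.
    rewrite (lt_le_trans rs st); case: ifP => _; first by rewrite mulr0 subrr mul0r.
    by rewrite es er subrr mul0r.
  case: (ltP r t) => rt /=; case: ifP => _.
  - by rewrite mulrN es opprK add0r.
  - by rewrite mulr0 subr0 er.
  - by rewrite mulrN es er opprK addNr mul0r.
  - by rewrite mulr0 subrr mul0r.
have iZ : mu.-integrable setT (EFin \o (fun r => expR (- (lam S j * (t - s))) *
    (green S n j (r - s) * ip S (f r) (e j)))).
  by have := integrableZl measurableT (expR (- (lam S j * (t - s)))) iGs; apply: eq_integrable.
rewrite [X in _ + X]Rintegral_mkcond.
under [X in _ + X]eq_Rintegral do rewrite -E.
by rewrite RintegralB// RintegralZl// addrC subrK.
Qed.

End GreenCoef.

Lemma evol_ext D f g u v : (forall t, D t -> u t = v t) ->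
  (forall s t r, D s -> D t -> s <= r -> r < t -> f r = g r) -> evol D f u -> evol D g v.
Proof.
move=> uv fg eu s t st Ds Dt j; rewrite -!uv// (eu s t)//; congr (_ + _).
apply: eq_Rintegral => r; rewrite inE /= in_itv /= => /andP[sr rt].
by rewrite (fg s t).
Qed.

Lemma evol_sub D D' f u : D' `<=` D -> evol D f u -> evol D' f u.
Proof. by move=> DD eu s t st /DD Ds /DD Dt; exact: eu. Qed.

Lemma evol_shift (D D' : set R) a f u : measurable D ->
  (forall j, measurable_fun D (fun r => ip S (f r) (e j))) ->
  (forall s t, D s -> D t -> `[s, t[ `<=` D) ->
  (forall t, D' t -> D (t + a)) -> evol D f u ->
  evol D' (fun r => f (r + a)) (fun t => u (t + a)).
Proof.
move=> mD mf cD DD eu s t st D's D't j.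
rewrite (eu (s + a) (t + a)) ?lerD2r//; last 2 first; [exact: DD|exact: DD|].
congr (_ + _); first by congr (expR _ * _); ring.
pose h r := ((fun r => decay S j (t + a - r) (f r)) \_ `[s + a, t + a[) r.
have mh : measurable_fun setT h.
  apply/(measurable_restrictT _ _).1 => //.
  apply: (@measurable_funS _ _ _ _ D) => //; first exact: cD (DD _ D's) (DD _ D't).
  apply: measurable_funM => //; apply: measurable_funTS.
  apply: measurableT_comp => //.
  apply: continuous_measurable_fun => r; apply: cvgN; apply: cvgM; first exact: cvg_cst.
  by apply: cvgB; [exact: cvg_cst|exact: cvg_id].
rewrite Rintegral_mkcond -(Rintegral_shift a mh) [RHS]Rintegral_mkcond.
apply: eq_Rintegral => r _; rewrite /h !patchE !mem_setE !in_itv /= lerD2r ltrD2r.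
by case: ifP => // _; congr (expR _ * _); ring.
Qed.

End Evolution.

(** * Clamping and cutting in time *)

Section Regularity.
Context (R : realType).

Lemma dist_continuous (V : normedModType R) (f : R -> V) :
  (forall t (eps : R), 0 < eps -> \forall s \near t, `|f t - f s| < eps) -> continuous f.
Proof. by move=> h t; apply/cvgrPdist_lt => eps; exact: h. Qed.

Lemma continuous_dist (V : normedModType R) (f : R -> V) t (eps : R) :
  {for t, continuous f} -> 0 < eps -> \forall s \near t, `|f t - f s| < eps.
Proof. by move=> cf eps0; move/cvgrPdist_lt : cf; exact. Qed.

(** Meant for phi a clamp onto a closed half-line: a function continuous there becomes one
    continuous on R. *)
Lemma within_continuous_comp (V : normedModType R) (A : set R) (u : R -> V) (phi : R -> R) :
  {within A, continuous u} -> continuous phi -> (forall t, A (phi t)) ->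
  continuous (u \o phi).
Proof.
move=> cu cphi Aphi; apply: dist_continuous => t eps eps0.
have /subspace_continuousP /(_ _ (Aphi t)) /cvgrPdist_lt /(_ _ eps0) := cu.
rewrite near_withinE => h.
pose P x := A x -> `|u (phi t) - u x| < eps.
have hP : nbhs (phi t) P by exact: h.
have hQ : \forall s \near t, P (phi s) by exact: (cphi t P hP).
near=> s; have : P (phi s) by near: s.
by apply; exact: Aphi.
Unshelve. all: by end_near. Qed.

Lemma continuous_within_eq (V : normedModType R) (A : set R) (u v : R -> V) :
  continuous u -> (forall t, A t -> u t = v t) -> {within A, continuous v}.
Proof.
move=> cu uv; apply: (@subspace_eq_continuous _ _ _ u) => [t /set_mem At|].
  exact: uv.
exact: continuous_subspaceT.
Qed.

Lemma maxc_lipschitz (x y c : R) : `|Num.max x c - Num.max y c| <= `|x - y|.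
Proof.
wlog xy : x y / x <= y => [th|].
  by have [/th//|/ltW/th] := leP x y; rewrite distrC [leRHS]distrC.
rewrite distrC [leRHS]distrC !ger0_norm ?subr_ge0 ?le_max2r//; last first.
  by rewrite ge_max !le_max xy lexx orbT.
by case: (leP x c) => xc; case: (leP y c) => yc; lra.
Qed.

Lemma minc_lipschitz (x y c : R) : `|Num.min x c - Num.min y c| <= `|x - y|.
Proof.
have := maxc_lipschitz (- x) (- y) (- c).
by rewrite -!oppr_min !opprK ![- _ + _]addrC distrC [leRHS]distrC.
Qed.

Lemma continuous_maxc (f : R -> R) (c : R) : continuous f ->
  continuous (fun t => Num.max (f t) c).
Proof.
move=> cf; apply: dist_continuous => t eps eps0.
have := continuous_dist (cf t) eps0; apply: filterS => s.
by apply: le_lt_trans; exact: maxc_lipschitz.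
Qed.

Lemma continuous_minc (f : R -> R) (c : R) : continuous f ->
  continuous (fun t => Num.min (f t) c).
Proof.
move=> cf; apply: dist_continuous => t eps eps0.
have := continuous_dist (cf t) eps0; apply: filterS => s.
by apply: le_lt_trans; exact: minc_lipschitz.
Qed.

Lemma continuous_bounded (f : R -> R) (r T : R) : continuous f ->
  exists2 C, 0 <= C & forall t, r <= t -> t <= T -> f t <= C.
Proof.
move=> cf; have [rT|Tr] := leP r T; last first.
  by exists 0 => // t rt tT; have := lt_le_trans Tr (le_trans rt tT); rewrite ltxx.
have [c _ fc] := EVT_max rT (continuous_subspaceT cf).
exists `|f c| => // t rt tT; rewrite (le_trans _ (ler_norm _))// fc//.
by rewrite in_itv /= rt tT.
Qed.

Lemma near_lt_const (a t : R) : t != a -> \forall s \near t, (s < a) = (t < a).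
Proof.
move=> ta; have d0 : 0 < `|t - a| by rewrite normr_gt0 subr_eq0.
near=> s; have : `|t - s| < `|t - a| by near: s; exact: cvgr_dist_lt.
case: (ltrgtP t a) ta => // [lta|gta] _.
  rewrite ltr_norml => /andP[h _]; have -> // : s < a by move: h; lra.
move=> h; have {}h : t - s < t - a by apply: le_lt_trans h; exact: ler_norm.
by apply/negbTE; rewrite -leNgt; move: h; lra.
Unshelve. all: by end_near. Qed.

Lemma continuous_shift (V : normedModType R) (u : R -> V) (a : R) : continuous u ->
  continuous (fun s => u (s + a)).
Proof.
move=> cu s; apply: (continuous_comp (f := fun s : R => s + a) (g := u)); last exact: cu.
by apply: cvgD; [exact: cvg_id|exact: cvg_cst].
Qed.

Lemma continuous_weighted_norm (V : normedModType R) (u : R -> V) (m : R) : continuous u ->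
  continuous (fun s => expR (m * s) * `|u s|).
Proof.
move=> cu s; apply: cvgM; last by apply: cvg_norm; exact: cu.
apply: (cvg_comp (fun s => m * s) expR); last exact: continuous_expR.
by apply: cvgM; [exact: cvg_cst|exact: cvg_id].
Qed.

Definition piecewise_const (d : R -> bool) : Prop :=
  exists B : seq R, forall t, t \notin B -> \forall s \near t, d s = d t.

Lemma piecewise_const_lt (a : R) : piecewise_const (fun t => t < a).
Proof. by exists [:: a] => t; rewrite inE => ta; exact: near_lt_const. Qed.

Lemma pcont_if (V : normedModType R) (d : R -> bool) (b1 b2 : R -> V) : piecewise_const d ->
  continuous b1 -> continuous b2 -> pcont (fun t => if d t then b1 t else b2 t).
Proof.
move=> [B cd] c1 c2; exists B => t tB; have nc := cd t tB.
rewrite /continuous_at /prop_for /=; case dt : (d t).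
  apply: cvg_trans (c1 t); apply: near_eq_cvg; near=> s.
  suff -> : d s = true by [].
  by rewrite -dt; near: s.
apply: cvg_trans (c2 t); apply: near_eq_cvg; near=> s.
suff -> : d s = false by [].
by rewrite -dt; near: s.
Unshelve. all: by end_near. Qed.

End Regularity.

(** * The semigroup on D(A^alpha) *)

Section DalphaSemigroup.
Context (R : realType) (H : completeNormedModType R) (S : setting H).
Local Notation X := (Dalpha S).
Local Notation la j := (lam S j `^ alpha S).

Lemma continuous_Dfin n (c : nat -> R -> R) : (forall j, continuous (c j)) ->
  continuous (fun t => Dfin S n (fun j => c j t)).
Proof.
move=> cc; elim: n => [|n ih]; last first.
  rewrite (_ : (fun t => _) = (fun t => Dfin S n (c^~ t) + c n t *: Dbase S n)); last first.
    by apply/funext => t; rewrite /Dfin big_ord_recr.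
  move=> t; apply: cvgD; first exact: ih.
  by apply: cvgZr_tmp; exact: cc.
rewrite (_ : (fun t => _) = (fun=> 0)); first by move=> t; exact: cvg_cst.
by apply/funext => t; rewrite /Dfin big_ord0.
Qed.

Lemma Dproj_cvg (u : X) : Dproj N u @[N --> \oo] --> u.
Proof.
apply/cvgrPdist_lt => eps eps0.
have /cvgrPdist_lt /(_ _ eps0) := @e_basis R H S (Apow S (Dval u)).
apply: filterS => N; rewrite DnormB.
suff -> : Apow S (Dval (Dproj N u)) =
  series (fun j => ip S (Apow S (Dval u)) (ebase S j) *: ebase S j) N by [].
apply: (ip_ebase_inj (S := S)) => j; rewrite Apow_coef -/(Dcoef (Dproj N u) j) Dcoef_proj.
case: ltnP => jN; first by rewrite ip_partial_sum// Apow_coef.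
rewrite seriesEnat /= ip_suml big_nat big1 ?mulr0// => i /andP[_ iN].
rewrite ipZl e_orthonormal; have /negbTE -> : i != j by rewrite neq_ltn (leq_trans iN jN).
by rewrite mulr0.
Qed.

(** e^(-At) inside D(A^alpha), selected by its coordinates. Its coordinates are guaranteed for t >=
    0, whence the later clamp [Num.max t 0]. *)
Definition Dsg (t : R) (u : X) : X :=
  xget 0 [set v | forall j, Dcoef v j = expR (- (lam S j * t)) * Dcoef u j].

Lemma Dsg_coef t u j : 0 <= t -> Dcoef (Dsg t u) j = expR (- (lam S j * t)) * Dcoef u j.
Proof.
move=> t0; have e1 i : expR (- (lam S i * t)) <= 1.
  by rewrite -expR0 ler_expR oppr_le0 mulr_ge0// ltW// lam_gt0.
have [|v vE _] := @Dalpha_build R H S (fun j => expR (- (lam S j * t)) * Dcoef u j) _ (normr_ge0 u).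
  move=> N; apply: le_trans (Dbessel u N); apply: ler_sum => i _.
  rewrite mulrCA exprMn ler_piMl ?sqr_ge0// expr_le1 ?expR_ge0//.
by rewrite /Dsg; case: xgetP => [w _ //|/(_ v)].
Qed.

Lemma Dsg0 u : Dsg 0 u = u.
Proof. by apply: Dcoef_inj => j; rewrite Dsg_coef// mulr0 oppr0 expR0 mul1r. Qed.

(** Finitely many modes depend continuously on t, and since e^(-lambda_j t) <= 1 the remainder is at
    most the tail of u, uniformly in t. *)
Lemma Dsg_continuous u : continuous (fun t : R => Dsg (Num.max t 0) u).
Proof.
apply: dist_continuous => t eps eps0.
have e3 : 0 < eps / 3 by rewrite divr_gt0.
have /cvgrPdist_lt /(_ _ e3) [N _ /(_ N (leqnn N)) uN] := @Dproj_cvg u.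
pose psi (s : R) := Dfin S N (fun j => expR (- (lam S j * Num.max s 0)) * Dcoef u j).
have m0 (s : R) : 0 <= Num.max s 0 by rewrite le_max lexx orbT.
have cpsi : continuous psi.
  apply: continuous_Dfin => j s; apply: cvgM; last exact: cvg_cst.
  apply: (cvg_comp (fun s => - (lam S j * Num.max s 0)) expR); last exact: continuous_expR.
  apply: cvgN; apply: cvgM; first exact: cvg_cst.
  by apply: continuous_maxc => x; exact: cvg_id.
have close s : `|Dsg (Num.max s 0) u - psi s| < eps / 3.
  apply: le_lt_trans uN; apply: Dcoef_le_norm => j.
  rewrite !DcoefB Dsg_coef// Dcoef_fin Dcoef_proj; case: ifP => _.
    by rewrite !subrr.
  rewrite !subr0 normrM ler_piMl// ger0_norm ?expR_ge0// -expR0 ler_expR oppr_le0.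
  by rewrite mulr_ge0// ltW// lam_gt0.
have := continuous_dist (cpsi t) e3; apply: filterS => s ts.
rewrite -(subrKA (psi t)) (le_lt_trans (ler_normD _ _))//.
rewrite -(subrKA (psi s) (psi t)).
have -> : eps = eps / 3 + (eps / 3 + eps / 3) by field.
apply: ltrD; first exact: close.
apply: le_lt_trans (ler_normD _ _) _; apply: ltrD => //.
by rewrite distrC; exact: close.
Qed.

Lemma Dval_continuous : continuous (@Dval R H S).
Proof.
apply: (@lipschitz_continuous R _ _ _ (la 0%N)^-1) => u v.
exact: (norm_le_Dnorm (u - v)).
Qed.

End DalphaSemigroup.

(** * Cut-off nonlinearities *)

Section Forcing.
Context (R : realType) (H : completeNormedModType R) (S : setting H).
Local Notation X := (Dalpha S).
Variables (F : X -> H) (L : R).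
Hypothesis L_gt0 : 0 < L.
Hypothesis F_lip : forall a b, `|F a - F b| <= L * `|a - b|.

Lemma F_continuous : continuous F.
Proof. exact: lipschitz_continuous F_lip. Qed.

Definition force (Z : R -> X) (h : R -> H) (u : R -> X) (s : R) : H := F (u s + Z s) + h s.

Lemma force_continuous Z h u t : {for t, continuous Z} -> {for t, continuous h} ->
  {for t, continuous u} -> {for t, continuous (force Z h u)}.
Proof.
move=> cZ ch cu; apply: cvgD => //.
apply: (continuous_comp (f := fun s => u s + Z s) (g := F)); last exact: F_continuous.
exact: cvgD.
Qed.

(** Common form of three fixed point problems: the initial value problem, the half-line equation and
    the tracking problem. [d] is the set of active times, [b] a known background added to the
    unknown, [c] a known source. *)
Definition cutN (d : R -> bool) (b : R -> X) (c : R -> H) (t : R) (a : X) : H :=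
  if d t then F (b t + a) + c t else 0.

Lemma cutN_nonlinearity m C (d : R -> bool) b c : 0 <= C -> pcont b -> pcont c ->
  piecewise_const d ->
  (forall t, d t -> expR (m * t) * `|F (b t) + c t| <= C) ->
  nonlinearity m L C (cutN d b c).
Proof.
move=> C0 [B1 cb] [B2 cc] [B3 cd] bd; split.
- move=> p cp; exists (B1 ++ B2 ++ B3) => t; rewrite !mem_cat !negb_or => /and3P[t1 t2 t3].
  have cont : F (b s + p s) + c s @[s --> t] --> F (b t + p t) + c t.
    apply: cvgD; last exact: cc.
    apply: (continuous_comp (f := fun s => b s + p s) (g := F)); last exact: F_continuous.
    by apply: cvgD; [exact: cb|exact: cp].
  rewrite /continuous_at /prop_for /= /cutN; case dt : (d t); last first.
    apply: cvg_near_cst; near=> s; suff -> : d s = false by [].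
    by rewrite -dt; near: s; exact: cd.
  apply: cvg_trans cont; apply: near_eq_cvg; near=> s.
  suff -> : d s = true by [].
  by rewrite -dt; near: s; exact: cd.
- move=> t a a'; rewrite /cutN; case: ifP => _; last by rewrite subrr normr0 mulr_ge0// ltW.
  rewrite opprD addrACA subrr addr0; apply: le_trans (F_lip _ _) _.
  by rewrite opprD addrACA subrr add0r.
- move=> t; rewrite /cutN; case: ifP => dt; last by rewrite normr0 mulr0.
  by rewrite addr0; exact: bd.
Unshelve. all: by end_near. Qed.

End Forcing.

(** * Mild solutions *)

Section Mild.
Context (R : realType) (H : completeNormedModType R) (S : setting H).
Local Notation mu := (@lebesgue_measure R).
Local Notation e := (ebase S).
Local Notation X := (Dalpha S).
Variables (F : X -> H) (L : R).
Hypothesis L_gt0 : 0 < L.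
Hypothesis F_lip : forall a b, `|F a - F b| <= L * `|a - b|.

Lemma c_const_ge0 (a : R) : 0 <= c_const a.
Proof.
rewrite /c_const; case: ifP => // _; rewrite mulr_ge0 ?powR_ge0//.
by apply: Rintegral_ge0 => s _; rewrite mulr_ge0 ?powR_ge0 ?expR_ge0.
Qed.

(* With the splitting index 0 there is no unstable part, so any sufficiently
   negative weight exponent makes the Green operator contractive. *)
Lemma exists_dichotomy0 : exists m kap q, dichotomy S 0 m kap q /\ L * q < 1.
Proof.
pose a := lam S 0 `^ alpha S; pose c := c_const (alpha S).
have a0 : 0 <= a by exact: powR_ge0.
have c0 : 0 <= c by exact: c_const_ge0.
(* Chosen so that L (a + c) < D. Since alpha < 1/2, (D^2)^alpha <= D, hence L q <= L (a + c) / D <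
   1. *)
pose D := 1 + L * (a + c).
have D1 : 1 <= D by rewrite lerDl mulr_ge0// ?addr_ge0// ltW.
have D0 : 0 < D by rewrite (lt_le_trans ltr01).
pose m := lam S 0 - D ^+ 2.
have ml : m < lam S 0 by rewrite ltrBlDr ltrDl exprn_gt0.
have l1m : m - 1 < m by rewrite ltrBlDr ltrDl.
have := @dichotomy_green R H S 0 m (m - 1) 0 ml l1m (lexx 0) ltac:(by []).
move=> dd; exists m; eexists; eexists; split; first exact: dd.
have -> : lam S 0 - m = D ^+ 2 by rewrite /m opprB addrC subrK.
rewrite mul0r add0r -/a -/c.
have Da : (D ^+ 2) `^ alpha S <= D.
  rewrite -[leRHS](@ger0_norm R) ?(ltW D0)// -sqrtr_sqr -powR12_sqrt ?sqr_ge0//.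
  apply: ler_powR; last by rewrite ltW// alpha_lt.
  by rewrite expr_ge1// (ltW D0).
apply: (@le_lt_trans _ _ (L * ((a + c) / D))).
  rewrite ler_wpM2l ?(ltW L_gt0)// ler_pdivrMr ?exprn_gt0//.
  have -> : (a + c) / D * D ^+ 2 = (a + c) * D by field; rewrite gt_eqF.
  rewrite mulrDl lerD//.
    by rewrite ler_peMr.
  by rewrite ler_wpM2l.
by rewrite mulrA ltr_pdivrMr// mul1r /D ltrDr.
Qed.

(** Restricting the source to a compact time interval makes every continuous f admissible, whatever
    the weight exponent. *)
Definition cutf (r T : R) (f : R -> H) (s : R) : H := if r <= s <= T then f s else 0.

Lemma piecewise_const_segment (r T : R) : piecewise_const (fun s => r <= s <= T).
Proof.
exists [:: r; T] => t; rewrite !inE negb_or => /andP[tr tT].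
have tT' : - t != - T by rewrite eqr_opp.
have hN : - s @[s --> t] --> - t by apply: cvgN; exact: cvg_id.
have h2 := hN _ (near_lt_const tT').
near=> s; rewrite !leNgt; congr (~~ _ && ~~ _).
  by near: s; exact: near_lt_const.
have : (- s < - T) = (- t < - T) by near: s; exact: h2.
by rewrite !ltrN2.
Unshelve. all: by end_near. Qed.

Lemma cutf_admissible m r T f : continuous f -> exists C, admissible m C (cutf r T f).
Proof.
move=> cf.
have [C C0 hC] := continuous_bounded r T (@continuous_weighted_norm R H f m cf).
exists C; split.
  by apply: (pcont_if (piecewise_const_segment r T) cf) => t; exact: cvg_cst.
move=> s; rewrite /cutf; case: ifP => [/andP[rs sT]|_]; first exact: hC.
by rewrite normr0 mulr0.
Qed.

Definition base_eq (Z : R -> X) (h : R -> H) (r T : R) (vr : X) (u : R -> X) : Prop :=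
  forall t, r <= t -> t <= T -> forall j,
    Dcoef (u t) j = expR (- (lam S j * (t - r))) * Dcoef vr j +
      \int[mu]_(s in `[r, t[) (decay S j (t - s) (force F Z h u s)).

Section Local.
Variables (Z : R -> X) (h : R -> H).
Hypotheses (cZ : continuous Z) (ch : continuous h).
Variables (m : R) (kap : R -> R) (q : R).
Hypothesis dich : dichotomy S 0 m kap q.
Hypothesis Lq1 : L * q < 1.

Let cforce u : continuous u -> continuous (force F Z h u).
Proof. by move=> cu t; exact: (force_continuous F_lip (@cZ t) (@ch t) (@cu t)). Qed.

Lemma green0_coef r T f t j : continuous f -> r <= t -> t <= T ->
  green_coef S 0 (cutf r T f) t j =
  \int[mu]_(s in `[r, t[) (decay S j (t - s) (f s)).
Proof.
move=> cf rt tT; have [C af] := cutf_admissible m r T cf.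
rewrite (green_coef_high dich t af)// Rintegral_mkcond [RHS]Rintegral_mkcond.
apply: eq_Rintegral => s _; rewrite !patchE !mem_setE !in_itv /= /cutf.
case: ltP => st /=; last by rewrite andbF.
rewrite andbT (le_trans (ltW st) tT) andbT; case: ifP => // _.
by rewrite ip0l mulr0.
Qed.

Let Jr r vr t : X := Dsg (Num.max (t - r) 0) vr.

(** With splitting index 0 only the past acts, so on [r, T] the Green operator of the cut source is
    the Duhamel integral from r. *)
Lemma base_eqP r T vr u : continuous u -> base_eq Z h r T vr u <->
  (forall t, r <= t -> t <= T -> u t = Jr r vr t + Lop S 0 (cutf r T (force F Z h u)) t).
Proof.
move=> cu; have [C af] := cutf_admissible m r T (cforce cu).
have E t j : r <= t -> t <= T -> Dcoef (Jr r vr t + Lop S 0 (cutf r T (force F Z h u)) t) j =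
    expR (- (lam S j * (t - r))) * Dcoef vr j +
    \int[mu]_(s in `[r, t[) (decay S j (t - s) (force F Z h u s)).
  move=> rt tT; rewrite DcoefD (Lop_coef dich t j af) (green0_coef _ (cforce cu))//.
  by rewrite Dsg_coef ?le_max ?lexx ?orbT// (max_idPl _)// subr_ge0.
split => hu t rt tT; first by apply: Dcoef_inj => j; rewrite E// hu.
by move=> j; rewrite hu// E.
Qed.

Lemma base_eq_evol r T vr u : continuous u -> base_eq Z h r T vr u -> r <= T ->
  u r = vr /\ evol `[r, T] (force F Z h u) u.
Proof.
move=> cu hu rT; split.
  apply: Dcoef_inj => j; rewrite (hu r)// subrr mulr0 oppr0 expR0 mul1r.
  by rewrite set_itvxx/= ?set_itvoo0 Rintegral_set0 addr0.
have [C af] := cutf_admissible m r T (cforce cu).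
have rep := (base_eqP r T vr cu).1 hu.
move=> s t st; rewrite /= !in_itv /= => /andP[rs sT] /andP[rt tT] j.
rewrite !rep// !DcoefD (Lop_evol dich af st I I j).
rewrite !Dsg_coef ?le_max ?lexx ?orbT// !(max_idPl _) ?subr_ge0//.
have -> : \int[mu]_(x in `[s, t[) (decay S j (t - x) (cutf r T (force F Z h u) x)) =
    \int[mu]_(x in `[s, t[) (decay S j (t - x) (force F Z h u x)).
  apply: eq_Rintegral => x; rewrite inE /= in_itv /= => /andP[sx xt].
  by rewrite /cutf (le_trans rs sx) (le_trans (ltW xt) tT).
rewrite addrA; congr (_ + _); rewrite [RHS]mulrDr; congr (_ + _).
by rewrite mulrA -expRD; congr (expR _ * _); ring.
Qed.

(** The unknown of the fixed point problem is u minus the free evolution of vr, which enters as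
    background. *)
Lemma mild_local_exists r T vr : r <= T ->
  exists2 u : R -> X, continuous u & base_eq Z h r T vr u.
Proof.
move=> rT; have cJ : continuous (Jr r vr).
  exact: (@continuous_shift R X (fun s : R => Dsg (Num.max s 0) vr) (- r) (@Dsg_continuous R H S vr)).
have cJZ : continuous (fun s => Jr r vr s + Z s) by move=> t; apply: cvgD; [exact: cJ|exact: cZ].
have cJF : continuous (fun s => F (Jr r vr s + Z s) + h s).
  move=> s; apply: cvgD; last exact: ch.
  by apply: (continuous_comp (f := fun s => Jr r vr s + Z s) (g := F)); [exact: cJZ|exact: (F_continuous F_lip)].
have [C C0 hC] := continuous_bounded r T (@continuous_weighted_norm R H _ m cJF).
have nl : nonlinearity m L C (cutN F (fun s => r <= s <= T) (fun s => Jr r vr s + Z s) h).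
  apply: (cutN_nonlinearity L_gt0 F_lip C0); [exact: pcont_cts|exact: pcont_cts| |].
    exact: piecewise_const_segment.
  by move=> t /andP[rt tT]; exact: hC.
have [p [cp _ pE _]] := fixed_point dich (ltW L_gt0) Lq1 nl C0.
pose u t := Jr r vr t + p t.
have cu : continuous u by move=> t; apply: cvgD; [exact: cJ|exact: cp].
exists u => //; apply/(base_eqP r T vr cu) => t rt tT; rewrite /u; congr (_ + _).
rewrite pE; congr (Lop S 0 _ t); apply/funext => s; rewrite /cutN /cutf /force /u.
by case: ifP => // _; rewrite addrAC.
Qed.

(** Stability with D = 0 for the Green parts; the free evolutions coincide. *)
Lemma mild_local_unique r T vr u1 u2 : continuous u1 -> continuous u2 ->
  base_eq Z h r T vr u1 -> base_eq Z h r T vr u2 ->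
  forall t, r <= t -> t <= T -> u1 t = u2 t.
Proof.
move=> c1 c2 e1 e2 t rt tT.
have r1 := (base_eqP r T vr c1).1 e1; have r2 := (base_eqP r T vr c2).1 e2.
pose f1 := cutf r T (force F Z h u1); pose f2 := cutf r T (force F Z h u2).
have [C1 a1] := cutf_admissible m r T (cforce c1).
have [C2 a2] := cutf_admissible m r T (cforce c2).
have b1 : weighted_bounded m (q * C1) (Lop S 0 f1) by move=> s; exact: (Lop_bound dich).
have b2 : weighted_bounded m (q * C2) (Lop S 0 f2) by move=> s; exact: (Lop_bound dich).
have := fixed_point_stability dich (ltW L_gt0) Lq1 a1 a2 b1 b2 (fun=> erefl) (fun=> erefl) (D := 0).
rewrite mulr0 mul0r => hs.
suff : expR (m * t) * `|Lop S 0 f1 t - Lop S 0 f2 t| <= 0.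
  rewrite pmulr_rle0 ?expR_gt0// normr_le0 subr_eq0 => /eqP E.
  exact: etrans (r1 t rt tT) (etrans (congr1 (fun x => Jr r vr t + x) E) (esym (r2 t rt tT))).
apply: hs => s; rewrite addr0 mulrCA ler_wpM2l ?expR_ge0// /f1 /f2 /cutf.
case: ifP => [/andP[rs sT]|_]; last by rewrite subrr normr0 mulr_ge0// ltW.
rewrite /force opprD addrACA subrr addr0 (le_trans (F_lip _ _))//.
rewrite ler_wpM2l ?(ltW L_gt0)// opprD addrACA subrr addr0.
by rewrite (r1 s rs sT) (r2 s rs sT) opprD addrACA subrr add0r.
Qed.

End Local.

Lemma base_eq_sub Z h r T T' vr u : T' <= T -> base_eq Z h r T vr u -> base_eq Z h r T' vr u.
Proof. by move=> TT hu t rt tT; exact: hu (le_trans tT TT). Qed.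

Lemma base_eq_ext Z h r T vr u v : (forall t, r <= t -> t <= T -> u t = v t) ->
  base_eq Z h r T vr u -> base_eq Z h r T vr v.
Proof.
move=> uv hu t rt tT j; rewrite -uv// hu//; congr (_ + _).
apply: eq_Rintegral => s; rewrite inE /= in_itv /= => /andP[rs st].
by rewrite /force uv// (le_trans (ltW st)).
Qed.

(** Solutions on the segments [r, T] agree by uniqueness and are pasted; before r the function is
    frozen at its value at r. *)
Lemma mild_exists Z h r vr : continuous Z -> continuous h ->
  exists2 u : R -> X, continuous u & forall T, base_eq Z h r T vr u.
Proof.
move=> cZ ch; have [m [kap [q [dich Lq1]]]] := exists_dichotomy0.
have ex T : exists u : R -> X, r <= T -> continuous u /\ base_eq Z h r T vr u.
  have [rT|Tr] := leP r T.
    by have [u cu bu] := mild_local_exists cZ ch dich Lq1 vr rT; exists u.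
  by exists (fun=> 0).
pose U T := projT1 (cid (ex T)).
have UP T : r <= T -> continuous (U T) /\ base_eq Z h r T vr (U T) := projT2 (cid (ex T)).
pose M (t : R) := Num.max t r.
have rM t : r <= M t by rewrite le_max lexx orbT.
have tM t : t <= M t by rewrite le_max lexx.
have UU T T' t : r <= t -> t <= T -> t <= T' -> U T t = U T' t.
  move=> rt tT tT'.
  have [c1 b1] := UP T (le_trans rt tT); have [c2 b2] := UP T' (le_trans rt tT').
  apply: (mild_local_unique cZ ch dich Lq1 (r := r) (T := t) (vr := vr) c1 c2) => //.
    exact: base_eq_sub b1.
  exact: base_eq_sub b2.
(* By uniqueness every horizon beyond t gives the same value, so for s within distance 1 of t the
   single solution [U (M t + 2)] represents v. *)
pose v t := U (M t + 1) (M t).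
have M1 t : M t <= M t + 1 by rewrite lerDl.
exists v.
  apply: dist_continuous => t eps eps0.
  have rT : r <= M t + 2 by rewrite (le_trans (rM t))// lerDl.
  have [cU _] := UP _ rT.
  have cUM : continuous (fun s => U (M t + 2) (M s)).
    move=> s; apply: (continuous_comp (f := M) (g := U (M t + 2))); last exact: cU.
    by apply: continuous_maxc => x; exact: cvg_id.
  have h1 := continuous_dist (cUM t) eps0.
  near=> s; have ts : `|t - s| < 1 by near: s; exact: cvgr_dist_lt.
  have sM : M s <= M t + 2.
    rewrite ge_max rT andbT; have : s <= t + 1.
      by move: ts; rewrite ltr_norml => /andP[h3 _]; lra.
    by have := tM t; lra.
  rewrite /v (@UU _ (M t + 2) (M t))// ?lerD2l ?ler1n// ?(@UU (M s + 1) (M t + 2) (M s))//.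
  - by near: s.
  - by rewrite lerDl.
move=> T; have [rT|Tr] := leP r T; last first.
  by move=> t rt tT; have := lt_le_trans Tr (le_trans rt tT); rewrite ltxx.
have [_ bT] := UP T rT; apply: base_eq_ext bT => t rt tT.
have Mt : M t = t by exact/max_idPl.
by rewrite /v Mt; apply: UU => //; rewrite lerDl.
Unshelve. all: by end_near. Qed.

Lemma mild_unique Z h r T vr u1 u2 : continuous Z -> continuous h ->
  continuous u1 -> continuous u2 ->
  base_eq Z h r T vr u1 -> base_eq Z h r T vr u2 ->
  forall t, r <= t -> t <= T -> u1 t = u2 t.
Proof.
move=> cZ ch c1 c2 b1 b2; have [m [kap [q [dich Lq1]]]] := exists_dichotomy0.
exact: (mild_local_unique cZ ch dich Lq1 c1 c2 b1 b2).
Qed.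

Lemma continuous_decay_ip (f : R -> H) t j : continuous f ->
  continuous (fun s : R => decay S j (t - s) (f s)).
Proof.
move=> cf s; apply: cvgM; last by apply: ip_cvg; exact: cf.
apply: (cvg_comp (fun s => - (lam S j * (t - s))) expR); last exact: continuous_expR.
by apply: cvgN; apply: cvgM; [exact: cvg_cst|apply: cvgB; [exact: cvg_cst|exact: cvg_id]].
Qed.

Lemma measurable_decay_ip (D : set R) (f : R -> H) t j : continuous f ->
  measurable_fun D (fun s : R => decay S j (t - s) (f s)).
Proof.
move=> cf; apply: measurable_funTS; apply: continuous_measurable_fun; exact: continuous_decay_ip.
Qed.

Lemma integrable_decay_ip (f : R -> H) a b t j : continuous f ->
  mu.-integrable `[a, b] (EFin \o (fun s : R => decay S j (t - s) (f s))).
Proof.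
move=> cf; apply: continuous_compact_integrable; first exact: segment_compact.
by apply: continuous_subspaceT; exact: continuous_decay_ip.
Qed.

Lemma integral_decay_co_cc (f : R -> H) a b t j : continuous f ->
  \int[mu]_(s in `[a, b[) (decay S j (t - s) (f s)) =
  \int[mu]_(s in `[a, b]) (decay S j (t - s) (f s)).
Proof.
move=> cf; apply: Rintegral_itv_bndo_bndc.
apply: (integrableS _ _ _ (integrable_decay_ip a b t j cf)) => //.
by apply: subset_itvl; rewrite bnd_simp.
Qed.

Lemma integral_norm_finite (f : R -> H) a b : continuous f ->
  (\int[mu]_(s in `[a, b]) (`|f s|)%:E < +oo)%E.
Proof.
move=> cf.
have /integrableP[_] : mu.-integrable `[a, b] (EFin \o (fun s => `|f s|)).
  apply: continuous_compact_integrable; first exact: segment_compact.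
  by apply: continuous_subspaceT => s; apply: cvg_norm; exact: cf.
by under eq_integral do rewrite /= normr_id.
Qed.

Variable z : Omega H -> X.

(** Only values on [r, +oo[ are constrained, so v is matched with some u continuous on R. One
    direction reads the Bochner integral in coordinates; the other obtains its existence from the
    contractivity of the semigroup in H. *)
Lemma is_mildP (w : Omega H) (h : R -> X) r vr v :
  continuous (fun t => z (theta t w)) -> continuous h ->
  is_mild F z w h r vr v <->
  exists2 u : R -> X, continuous u /\ (forall t, r <= t -> v t = u t) &
    forall T, base_eq (fun t => z (theta t w)) (fun t => Dval (h t)) r T vr u.
Proof.
move=> cZ ch; set Z := fun t => z (theta t w); set hh := fun t => Dval (h t).
have chh : continuous hh.
  by move=> t; apply: (continuous_comp (f := h) (g := @Dval R H S)); [exact: ch|exact: Dval_continuous].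
split=> [[cv hv]|[u [cu vu] bu]].
  pose u t := v (Num.max t r).
  have uv t : r <= t -> v t = u t by move=> rt; rewrite /u (max_idPl rt).
  have cu : continuous u.
    apply: (within_continuous_comp (phi := fun t : R => Num.max t r) cv).
      by apply: continuous_maxc => x; exact: cvg_id.
    by move=> t; rewrite /= in_itv /= andbT le_max lexx orbT.
  have cf : continuous (force F Z hh u).
    by move=> t; exact: (force_continuous F_lip (@cZ t) (@chh t) (@cu t)).
  exists u => // T t rt tT j.
  have [I [_ _ hI] vE] := hv t rt.
  rewrite -uv// {1}/Dcoef vE ipDl semigroup_coef ?subr_ge0//; congr (_ + _).
  rewrite hI (integral_decay_co_cc _ _ _ _ cf); apply: eq_Rintegral => s.
  rewrite inE /= in_itv /= => /andP[rs st].
  by rewrite semigroup_coef ?subr_ge0// /force -uv.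
have cf : continuous (force F Z hh u).
  by move=> t; exact: (force_continuous F_lip (@cZ t) (@chh t) (@cu t)).
split.
  by apply: continuous_within_eq cu _ => t; rewrite /= in_itv /= andbT => rt; rewrite vu.
move=> t rt; exists (Dval (v t) - semigroup S (t - r) (Dval vr)); last by rewrite addrC subrK.
have fE s : s \in `[r, t] -> F (v s + z (theta s w)) + Dval (h s) = force F Z hh u s.
  by rewrite in_itv /= => /andP[rs st]; rewrite vu.
have mc j : measurable_fun `[r, t] (fun s => ip S (semigroup S (t - s)
    (F (v s + z (theta s w)) + Dval (h s))) (e j)).
  apply: (eq_measurable_fun (fun s : R => decay S j (t - s) (force F Z hh u s))).
    move=> s; rewrite inE /= => srt; rewrite fE//; move: srt; rewrite in_itv /= => /andP[rs st].
    by rewrite semigroup_coef// subr_ge0.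
  exact: measurable_decay_ip.
apply: is_integral_coord => //.
- apply: le_lt_trans (integral_norm_finite r t cf).
  apply: ge0_le_integral => //=.
  + apply/measurable_EFinP.
    have mb := measurable_coef (measurable_itv `[r, t]) mc.
    exact: (measurable_borel_real (@norm_continuous R H) (measurable_itv `[r, t]) mb).
  + by apply/measurable_EFinP; apply: measurable_funTS; apply: continuous_measurable_fun => s;
      apply: cvg_norm; exact: cf.
  + move=> s /= srt; rewrite fE// lee_fin; move: srt; rewrite in_itv /= => /andP[rs st].
    by apply: semigroup_norm; rewrite subr_ge0.
- move=> j; rewrite ipDl ipNl semigroup_coef ?subr_ge0// vu//.
  rewrite -/(Dcoef (u t) j) (bu t t)// addrAC subrr add0r (integral_decay_co_cc _ _ _ _ cf).
  apply: eq_Rintegral => s; rewrite inE /= => srt; rewrite fE//.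
  move: srt; rewrite in_itv /= => /andP[rs st].
  by rewrite semigroup_coef// subr_ge0.
Qed.

(** [vsol] selects a mild solution if there is one, and [mild_exists] supplies one. *)
Lemma vsol_spec (w : Omega H) (h : R -> X) r vr :
  continuous (fun t => z (theta t w)) -> continuous h ->
  exists2 u : R -> X, continuous u /\ (forall t, r <= t -> vsol F z t r w h vr = u t) &
    forall T, base_eq (fun t => z (theta t w)) (fun t => Dval (h t)) r T vr u.
Proof.
move=> cZ ch; apply/(is_mildP r vr (fun t => vsol F z t r w h vr) cZ ch).
have chh : continuous (fun t => Dval (h t)).
  by move=> t; apply: (continuous_comp (f := h) (g := @Dval R H S)); [exact: ch|exact: Dval_continuous].
have [u cu bu] := mild_exists r vr cZ chh.
have mu0 : is_mild F z w h r vr u by apply/is_mildP => //; exists u.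
by rewrite /vsol; case: xgetP => [v _ //|/(_ u)].
Qed.

Lemma vsol_unique (w : Omega H) (h : R -> X) r T vr u :
  continuous (fun t => z (theta t w)) -> continuous h -> continuous u ->
  base_eq (fun t => z (theta t w)) (fun t => Dval (h t)) r T vr u ->
  forall t, r <= t -> t <= T -> vsol F z t r w h vr = u t.
Proof.
move=> cZ ch cu bu t rt tT; have [v [cv vE] bv] := vsol_spec r vr cZ ch.
have chh : continuous (fun t => Dval (h t)).
  by move=> x; apply: (continuous_comp (f := h) (g := @Dval R H S)); [exact: ch|exact: Dval_continuous].
by rewrite vE//; apply: (mild_unique cZ chh cv cu (bv T) bu).
Qed.

End Mild.

Section Shifts.
Context (R : realType) (H : completeNormedModType R).

Lemma wpath_ext (w1 w2 : wpath H) : (forall t, w1 t = w2 t) -> w1 = w2.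
Proof.
case: w1 w2 => [f1 c1 z1] [f2 c2 z2] /= /funext E; subst f2.
by rewrite (Prop_irrelevance c1 c2) (Prop_irrelevance z1 z2).
Qed.

Lemma theta_theta s t (w : Omega H) : theta s (theta t w) = theta (s + t) w.
Proof.
apply: wpath_ext => x /=; rewrite !addrA opprB addrA; congr (_ - _).
by rewrite subrK.
Qed.

Lemma theta0 (w : Omega H) : theta 0 w = w.
Proof. by apply: wpath_ext => x /=; rewrite addr0 wpath_at0 subr0. Qed.

End Shifts.

(** * Weighted bounds on the negative half-line *)

Section NegativeHalfLine.
Context (R : realType) (H : completeNormedModType R) (m : R).

Definition neg_cut (f : R -> H) (s : R) : H := if s < 0 then f s else 0.

Definition neg_bounded (V : normedModType R) (u : R -> V) : Prop :=
  exists C, forall t, t <= 0 -> expR (m * t) * `|u t| <= C.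

Lemma neg_boundedD (V : normedModType R) (u v : R -> V) :
  neg_bounded u -> neg_bounded v -> neg_bounded (fun t => u t + v t).
Proof.
move=> [C hC] [D hD]; exists (C + D) => t t0; apply: le_trans (lerD (hC t t0) (hD t t0)).
by rewrite -mulrDr ler_wpM2l ?expR_ge0// ler_normD.
Qed.

(** For a > 0 the shift brings in values on ]0, a], bounded by continuity; the others cost the
    factor e^(-m a). *)
Lemma neg_bounded_shift (V : normedModType R) (u : R -> V) (a : R) : continuous u -> neg_bounded u ->
  neg_bounded (fun s => u (s + a)).
Proof.
move=> cu [C hC].
have [D D0 hD] := continuous_bounded (- a) 0
  (@continuous_weighted_norm R V _ m (@continuous_shift R V u a cu)).
exists (Num.max (expR (- (m * a)) * C) D) => s s0; rewrite le_max.
have [sa|sa] := leP (s + a) 0; last by rewrite hD ?orbT// lerNl; lra.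
apply/orP; left; have := hC (s + a) sa.
rewrite -(ler_pM2l (expR_gt0 (- (m * a)))) mulrA -expRD.
by rewrite (_ : - (m * a) + m * (s + a) = m * s)//; ring.
Qed.

Lemma neg_cut_admissible f : continuous f -> neg_bounded f ->
  exists C, admissible m C (neg_cut f).
Proof.
move=> cf [C hC]; exists (Num.max C 0); split.
  by apply: (pcont_if (piecewise_const_lt 0) cf) => t; exact: cvg_cst.
move=> t; rewrite le_max /neg_cut; case: ifP => t0; first by rewrite hC// ltW.
by rewrite normr0 mulr0 lexx orbT.
Qed.

(** Temperedness controls the far past and continuity the remaining segment [M, 0]. This puts the
    noise into the weighted space. *)
Lemma tempered_bounded (V : normedModType R) (u : R -> V) : continuous u ->
  expR (m * t) * `|u t| @[t --> -oo] --> (0 : R) -> neg_bounded u.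
Proof.
move=> cu /cvgrPdist_lt /(_ 1 ltr01) [M [_ hM]].
have [C _ hC] := continuous_bounded M 0 (@continuous_weighted_norm R V u m cu).
exists (Num.max 1 C) => t t0; rewrite le_max; have [Mt|tM] := leP M t.
  by rewrite hC ?orbT.
have := hM t tM; rewrite sub0r normrN ger0_norm ?mulr_ge0 ?expR_ge0//.
by move=> /ltW ->.
Qed.

End NegativeHalfLine.

(** * Gluing and superposing orbits *)

Section EvolutionAlgebra.
Context (R : realType) (H : completeNormedModType R) (S : setting H).
Local Notation mu := (@lebesgue_measure R).
Local Notation X := (Dalpha S).

Lemma integrable_decay_co (f : R -> H) a b c d t j : continuous f -> c <= a -> b <= d ->
  mu.-integrable `[a, b[ (EFin \o (fun s : R => decay S j (t - s) (f s))).
Proof.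
move=> cf ca bd; have := integrable_decay_ip S c d t j cf.
apply: (@integrableS _ _ _ mu `[c, d]%classic `[a, b[%classic) => // x.
by rewrite /= !in_itv /= => /andP[ax xb]; rewrite (le_trans ca ax) (le_trans (ltW xb) bd).
Qed.

Lemma decay_itv_split (f : R -> H) s r t T j : continuous f -> s <= r -> r <= t ->
  \int[mu]_(x in `[s, t[) (decay S j (T - x) (f x)) =
  \int[mu]_(x in `[s, r[) (decay S j (T - x) (f x)) +
  \int[mu]_(x in `[r, t[) (decay S j (T - x) (f x)).
Proof.
move=> cf sr rt; rewrite (@itv_bndbnd_setU _ _ _ (BLeft r)) ?bnd_simp//.
rewrite Rintegral_setU//=.
- by rewrite -itv_bndbnd_setU ?bnd_simp//; exact: (integrable_decay_co T j cf (lexx s) (lexx t)).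
- apply/disj_setPS => y [/=]; rewrite 2!in_itv/= => /andP[_ yr] /andP[ry _].
  by have := lt_le_trans yr ry; rewrite ltxx.
Qed.

(** Only s < 0 < t is new: pass through time 0 and compose the exponentials. *)
Lemma evol_glue (f : R -> H) (u : R -> X) T : continuous f -> 0 <= T ->
  evol `]-oo, 0] f u -> evol `[0, T] f u -> evol `]-oo, T] f u.
Proof.
move=> cf T0 e1 e2 s t st; rewrite /= !in_itv /= => sT tT j.
have [t0|t0] := leP t 0; first by apply: e1; rewrite //= in_itv//= (le_trans st).
have [s0|s0] := leP 0 s; first by apply: e2; rewrite //= in_itv/= ?s0 ?sT// (ltW t0).
have D1 (x : R) : x <= 0 -> `]-oo, 0]%classic x by move=> x0; rewrite /= in_itv.
have D2 (x : R) : 0 <= x -> x <= T -> `[0, T]%classic x by move=> x0 xT; rewrite /= in_itv/= x0.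
rewrite (e2 0 t (ltW t0) (D2 _ (lexx 0) T0) (D2 _ (ltW t0) tT)).
rewrite (e1 s 0 (ltW s0) (D1 _ (ltW s0)) (D1 _ (lexx 0))).
rewrite (decay_itv_split t j cf (ltW s0) (ltW t0)) mulrDr -!addrA; congr (_ + (_ + _)).
  by rewrite mulrA -expRD; congr (expR _ * _); ring.
rewrite -RintegralZl//; last exact: (integrable_decay_co 0 j cf (lexx s) (lexx 0)).
apply: eq_Rintegral => x _; rewrite mulrA -expRD; congr (expR _ * _); ring.
Qed.

(** Serves the tracking argument, where the sought orbit is the given solution plus an orbit of the
    difference equation. *)
Lemma evol_add D (f1 f2 : R -> H) (u1 u2 : R -> X) : continuous f1 -> continuous f2 ->
  evol D f1 u1 -> evol D (fun s => f2 s - f1 s) u2 -> evol D f2 (fun t => u1 t + u2 t).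
Proof.
move=> c1 c2 e1 e2 s t st Ds Dt j; rewrite !DcoefD (e1 s t)// (e2 s t)//.
have -> : \int[mu]_(r in `[s, t[) (decay S j (t - r) (f2 r - f1 r)) =
  \int[mu]_(x in `[s, t[) (decay S j (t - x) (f2 x)) -
  \int[mu]_(x in `[s, t[) (decay S j (t - x) (f1 x)).
  rewrite -RintegralB//.
  - by apply: eq_Rintegral => r _; rewrite ipDl ipNl mulrBr.
  - exact: (integrable_decay_co t j c2 (lexx s) (lexx t)).
  - exact: (integrable_decay_co t j c1 (lexx s) (lexx t)).
have rg (E a b I1 I2 : R) : E * a + I1 + (E * b + (I2 - I1)) = E * (a + b) + I2 by ring.
exact: rg.
Qed.

Lemma evol_homogeneous D (f : R -> H) (u v : R -> X) :
  (forall s t, s <= t -> D s -> D t -> forall j,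
     Dcoef (v t) j = expR (- (lam S j * (t - s))) * Dcoef (v s) j) ->
  evol D f u -> evol D f (fun t => v t + u t).
Proof.
move=> hv hu s t st Ds Dt j; rewrite !DcoefD (hv s t)// (hu s t)//.
have rg (E a b I : R) : E * a + (E * b + I) = E * (a + b) + I by ring.
exact: rg.
Qed.

End EvolutionAlgebra.

(** * Stable and unstable parts of the integrals *)

Section SpectralSplitting.
Context (R : realType) (H : completeNormedModType R) (S : setting H).
Local Notation mu := (@lebesgue_measure R).
Local Notation e := (ebase S).
Local Notation la j := (lam S j `^ alpha S).
Variables (n : nat) (m : R) (kap : R -> R) (q : R).
Hypothesis dich : dichotomy S n m kap q.

Lemma ip_le_norm (a b : H) :
  (forall j, `|ip S a (e j)| <= `|ip S b (e j)|) -> `|a| <= `|b|.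
Proof.
move=> ab; apply: (coef_norm_le (S := S)) => // N; apply: le_trans (bessel S b N).
by apply: ler_sum => j _; rewrite -[leLHS]real_normK ?num_real// -[leRHS]real_normK ?num_real// lerXn2r ?nnegrE.
Qed.

Lemma semigroup_proj t (y : H) : t <= 0 ->
  (forall j, ip S (semigroup S t (Defs.proj S n y)) (e j) =
     expR (- (lam S j * t)) * (if (j < n)%N then ip S y (e j) else 0)) /\
  `|semigroup S t (Defs.proj S n y)| <= expR (- (lam S n * t)) * `|y|.
Proof.
move=> t0; have [|j nj|j jn|h1 h2] := @semigroup_coef_fin R H S n t (Defs.proj S n y) (expR (- (lam S n * t))).
- exact: expR_ge0.
- by rewrite ip_proj ltnNge nj.
- by rewrite ler_expR lerN2 ler_wnM2r// lam_nondecr// ltnW.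
split; first by move=> j; rewrite h1 ip_proj.
apply: le_trans h2 _; rewrite ler_wpM2l ?expR_ge0//; apply: ip_le_norm => j.
by rewrite ip_proj; case: ifP => _ //; rewrite normr0.
Qed.

Lemma semigroup_coproj_coef t (y : H) j : 0 <= t ->
  ip S (semigroup S t (Defs.coproj S n y)) (e j) =
  expR (- (lam S j * t)) * (if (j < n)%N then 0 else ip S y (e j)).
Proof. by move=> t0; rewrite semigroup_coef// ip_coproj. Qed.

(** The kernel built for D(A^alpha) also dominates the H-norm, up to lambda_1^(-alpha); this gives
    convergence of the integral over ]-oo, t]. *)
Lemma semigroup_coproj_norm (t : R) (y : H) : 0 < t ->
  `|semigroup S t (Defs.coproj S n y)| <= (la 0%N)^-1 * (kap (- t) * `|y|).
Proof.
move=> t0; have k0 := kap_ge0 dich (- t).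
have c0 : 0 <= (la 0%N)^-1 * kap (- t) by rewrite mulr_ge0// invr_ge0 powR_ge0.
rewrite mulrA -[_ * kap _]ger0_norm// -normrZ; apply: ip_le_norm => j.
rewrite semigroup_coproj_coef ?(ltW t0)// ipZl; case: ltnP => jn.
  by rewrite mulr0 normr0.
rewrite !normrM ler_wpM2r// !ger0_norm ?expR_ge0//.
rewrite [leRHS]mulrC ler_pdivlMr ?lam_powR_gt0//.
have := dich_bound dich j (- t); rewrite /green ltrNl oppr0 t0 ltnNge jn /= mulrN.
rewrite ger0_norm ?expR_ge0// => /(le_trans _); apply.
rewrite mulrC ler_wpM2r ?expR_ge0// ge0_ler_powR ?alpha_ge0 ?nnegrE ?(ltW (lam_gt0 _ _))//.
  exact: lam_nondecr.
by rewrite invr_ge0 powR_ge0.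
Qed.

(** The cut stops the future integral at 0, which leaves exactly the two integrals of the equation
    for xi^*. *)
Lemma green_coef_cut f t j C : continuous f -> admissible m C (neg_cut f) -> t <= 0 ->
  green_coef S n (neg_cut f) t j =
  if (j < n)%N
  then - \int[mu]_(s in `[t, 0]) (decay S j (t - s) (f s))
  else \int[mu]_(s in `]-oo, t]) (decay S j (t - s) (f s)).
Proof.
move=> cf af t0; case: ltnP => jn.
  rewrite (green_coef_low dich t af jn) -(integral_decay_co_cc S _ _ _ _ cf); congr (- _).
  rewrite [LHS]Rintegral_mkcond [RHS]Rintegral_mkcond; apply: eq_Rintegral => s _.
  rewrite !patchE !mem_setE !in_itv /= andbT /neg_cut; case: ltP => s0; first by rewrite andbT.
  by rewrite andbF ip0l mulr0; case: ifP.
rewrite (green_coef_high dich t af jn).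
rewrite /Rintegral -integral_itv_bndo_bndc; last first.
  by apply/measurable_EFinP; exact: measurable_decay_ip.
apply: eq_Rintegral => s; rewrite inE /= in_itv /= => st.
by rewrite /neg_cut (lt_le_trans st t0).
Qed.

Lemma integral_coproj_finite (f : R -> H) (t C : R) : continuous f -> admissible m C (neg_cut f) -> t <= 0 ->
  (forall j, measurable_fun `]-oo, t] (fun s : R => ip S (semigroup S (t - s) (Defs.coproj S n (f s))) (e j))) ->
  (\int[mu]_(s in `]-oo, t]) (`|semigroup S (t - s) (Defs.coproj S n (f s))|)%:E < +oo)%E.
Proof.
move=> cf af t0 mc.
have mb := measurable_coef (measurable_itv `]-oo, t]) mc.
have mn := measurable_borel_real (@norm_continuous R H) (measurable_itv `]-oo, t]) mb.
have sub : `]-oo, t[ `<=` `]-oo, t] by apply: subset_itvl; rewrite bnd_simp.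
have mno : measurable_fun `]-oo, t[ (fun s => `|semigroup S (t - s) (Defs.coproj S n (f s))|).
  by apply: measurable_funS mn.
rewrite -integral_itv_bndo_bndc; last exact/measurable_EFinP.
have ik := integrable_shift (- t) (integrable_kap_adm dich t af).
pose k s := (la 0%N)^-1 * (kap (s - t) * `|neg_cut f s|).
have ik' : mu.-integrable `]-oo, t[ (EFin \o k).
  have ik2 : mu.-integrable setT (EFin \o k).
    have := integrableZl measurableT ((la 0%N)^-1) ik; apply: eq_integrable => // s _ /=.
    by rewrite subrK.
  by move: ik2; apply: integrableS.
have : mu.-integrable `]-oo, t[
    (EFin \o (fun s => `|semigroup S (t - s) (Defs.coproj S n (f s))|)).
  apply: integrable_dominated ik' => // s; rewrite /= in_itv /= => st; rewrite normr_id.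
  have := @semigroup_coproj_norm (t - s) (f s); rewrite subr_gt0 opprB => /(_ st).
  by rewrite /k /neg_cut (lt_le_trans st t0).
by move=> /integrableP[_]; under eq_integral do rewrite /= normr_id.
Qed.

End SpectralSplitting.

(** * Measurability in omega *)

Section JointMeasurability.
Context d (T : measurableType d) (R : realType).
Local Notation mu := (@lebesgue_measure R).

Lemma measurable_floor_fiber (c : R) (k : int) : 0 < c ->
  measurable [set s : R | Num.floor (c * s) = k].
Proof.
move=> c0; rewrite (_ : [set _ | _] = `[k%:~R / c, (k + 1)%:~R / c[%classic).
  exact: measurable_itv.
apply/seteqP; split=> s; rewrite /= in_itv /= ler_pdivrMr// ltr_pdivlMr// ![s * c]mulrC.
  by move=> <-; exact: floor_itv.
by move=> h; exact/floor_def.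
Qed.

(* A Caratheodory function is the pointwise limit of its discretizations in
   the real variable. *)
Lemma measurable_caratheodory (chi : T -> R -> R) :
  (forall s, measurable_fun setT (chi ^~ s)) -> (forall w, continuous (chi w)) ->
  measurable_fun setT (fun p : T * R => chi p.1 p.2).
Proof.
move=> mchi cchi.
pose gr (m : nat) (s : R) : R := (Num.floor (m.+1%:R * s))%:~R / m.+1%:R.
apply: (@measurable_fun_cvg _ _ R setT (fun m p => chi p.1 (gr m p.2))); last first.
  move=> [w s] _ /=; apply: (cvg_comp (gr ^~ s) (chi w)); last exact: (cchi w s).
  apply/cvgrPdist_lt => eps eps0.
  have [m _ Hm] := @near_infty_natSinv_lt R (PosNum eps0).
  exists m => // i mi; apply: le_lt_trans (Hm i mi).
  have i0 : 0 < i.+1%:R :> R by [].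
  have /andP[h1 h2] := floor_itv (i.+1%:R * s).
  rewrite ger0_norm /gr; last by rewrite subr_ge0 ler_pdivrMr// [s * _]mulrC.
  rewrite -(ler_pM2r i0) mulrBl divfK ?gt_eqF// mulVf ?gt_eqF//.
  by move: h2; rewrite intrD [s * _]mulrC => /ltW; rewrite lerBlDl addrC.
move=> m _ B mB; rewrite setTI.
have -> : (fun p : T * R => chi p.1 (gr m p.2)) @^-1` B = \bigcup_(k : int)
   ((chi ^~ (k%:~R / m.+1%:R) @^-1` B) `*` [set s : R | Num.floor (m.+1%:R * s) = k]).
  apply/seteqP; split=> [[w s] /= h|[w s] [k _ [/= h kE]]]; last by rewrite /gr kE.
  by exists (Num.floor (m.+1%:R * s)).
apply: countable_bigcupT_measurable; first exact: countableP.
move=> k; apply: measurableX; last exact: measurable_floor_fiber.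
by rewrite -[X in measurable X]setTI; exact: mchi.
Qed.

(** Tonelli for the positive and the negative part. *)
Lemma measurable_Rintegral (f : T * R -> R) : measurable_fun setT f ->
  measurable_fun setT (fun w => \int[mu]_s f (w, s)).
Proof.
move=> mf; have mF : measurable_fun setT (EFin \o f) by exact/measurable_EFinP.
have mp := measurable_fun_fubini_tonelli_F (m2 := mu) _ (measurable_funepos mF) (fun x => funepos_ge0 _ x).
have mn := measurable_fun_fubini_tonelli_F (m2 := mu) _ (measurable_funeneg mF) (fun x => funeneg_ge0 _ x).
have mB := emeasurable_funB mp mn.
rewrite (_ : (fun w => _) = fine \o (fubini_F mu (EFin \o f)^\+ \- fubini_F mu (EFin \o f)^\-)%E).
  by apply: measurableT_comp => //; exact: fine_measurable.
apply/funext => w; rewrite /Rintegral integralE /fubini_F /=; congr (fine (_ - _)%E).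
  by apply: eq_integral => s _; rewrite !funeposE.
by apply: eq_integral => s _; rewrite !funenegE.
Qed.

End JointMeasurability.

(** * Measurability of the path shift *)

Section NoiseShift.
Context (R : realType) (H : completeNormedModType R).

(** Closeness within eps/2 on the compact set made of K + s and the point s gives closeness of the
    shifted increments within eps on K. *)
Lemma shift_compact_open (w : R -> H) (s : R) : continuous w ->
  {compact-open, (fun (g : R -> H) x => g (x + s) - g s) @ nbhs (w : {compact-open, R -> H}) -->
     (fun x => w (x + s) - w s)}.
Proof.
move=> cw; have cadd : continuous (fun x : R => x + s).
  by move=> x; apply: cvgD; [exact: cvg_id|exact: cvg_cst].
have cs : continuous (fun x => w (x + s) - w s).
  move=> x; apply: cvgB; last exact: cvg_cst.
  by apply: (continuous_comp (f := fun x : R => x + s) (g := w)); [exact: cadd|exact: cw].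
apply/(@compact_open_fam_compactP _ _ _ _ cs)/fam_cvgP => K cK P /uniform_nbhs [E [entE EP]].
have /(@compact_open_fam_compactP _ _ _ _ cw) hw :
    {compact-open, nbhs (w : {compact-open, R -> H}) --> w} by exact: cvg_id.
move: entE; rewrite -entourage_ballE => -[eps /= eps0 hE].
pose K' := ((fun x : R => x + s) @` K) `|` [set s].
have cK' : compact K'.
  apply: compactU; last exact: compact_set1.
  by apply: continuous_compact cK; exact: continuous_subspaceT.
have e2 : 0 < eps / 2 by rewrite divr_gt0.
have ent2 : entourage [set xy : H * H | ball xy.1 (eps / 2) xy.2] by exact: entourage_ball (PosNum e2).
have := hw _ (@fam_nbhs _ _ compact K' _ w ent2 cK'); apply: filterS => h hK.
apply: EP => y Ky /=; apply: hE => /=.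
have h1 := hK (y + s) (or_introl (ex_intro2 _ _ y Ky erefl)); have h2 := hK s (or_intror erefl).
move: h1 h2; rewrite -!ball_normE /= => h1 h2.
rewrite opprD addrACA -opprD (le_lt_trans (ler_normB _ _))// [eps]splitr ltrD//.
Qed.

Lemma measurable_theta (s : R) : measurable_fun setT (theta s : Omega H -> Omega H).
Proof.
apply: (@measurability _ _ (Omega H) (Omega H) setT (theta s) (@wpath_open R H) erefl).
move=> V [U]; case=> O oO -> <-; rewrite setTI; apply: sub_sigma_algebra.
pose sh := (fun (g : R -> H) x => g (x + s) - g s).
(* Continuity of the shift is known at continuous functions. The interior restores an open set and
   still contains every path whose shift lies in O. *)
pose O' : set {compact-open, R -> H} := interior (sh @^-1` O : set {compact-open, R -> H}).
exists O'; first exact: open_interior.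
apply/seteqP; split=> w /=; last exact: interior_subset.
move=> Ow; have := @shift_compact_open w s (@wpath_continuous R H w).
by apply; exact: open_nbhs_nbhs.
Qed.

End NoiseShift.

(** * Closed random graphs over P_nH *)

Section RandomGraph.
Context (R : realType) (H : completeNormedModType R) (S : setting H).
Local Notation X := (Dalpha S).
Local Notation e := (ebase S).
Local Notation la j := (lam S j `^ alpha S).

Lemma PnH_submod n (a : R) (x y : X) : PnH S n x -> PnH S n y -> PnH S n (a *: x + y).
Proof.
by move=> /PnHP hx /PnHP hy; apply/PnHP => j nj; rewrite DcoefD DcoefZ hx// hy// mulr0 addr0.
Qed.

Lemma PnH_proj n (u : X) : PnH S n (Dproj n u). Proof. by exists u. Qed.

Lemma PnHD n (x y : X) : PnH S n x -> PnH S n y -> PnH S n (x + y).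
Proof. by move=> hx hy; rewrite -[x]scale1r; exact: PnH_submod. Qed.

Lemma PnHB n (x y : X) : PnH S n x -> PnH S n y -> PnH S n (x - y).
Proof. by move=> hx hy; rewrite addrC -scaleN1r; exact: PnH_submod. Qed.

(** On the first n modes the norm of D(A^alpha) is at most lambda_(n+1)^alpha times that of H, so
    truncating a dense sequence of H suffices. *)
Lemma PnH_dense n : exists2 r : nat -> X, (forall i, PnH S n (r i)) &
  forall x, PnH S n x -> forall eps : R, 0 < eps -> exists i, `|x - r i| < eps.
Proof.
exists (fun i => Dfin S n (fun j => ip S (rat_vec S i) (e j))) => [i|x /PnHP hx eps eps0].
  by apply/PnHP => j nj; rewrite Dcoef_fin ltnNge nj.
have ln0 : 0 < la n by exact: lam_powR_gt0.
have [i hi] := rat_vec_dense S (Dval x) (divr_gt0 eps0 ln0).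
exists i; apply: (@le_lt_trans _ _ (la n * `|Dval x - rat_vec S i|)); last first.
  by rewrite mulrC -ltr_pdivlMr.
apply: Dnorm_coef_le => [|N]; first by rewrite mulr_ge0// ltW.
rewrite exprMn; apply: (@le_trans _ _ (la n ^+ 2 * \sum_(0 <= j < N) (ip S (Dval x - rat_vec S i) (e j)) ^+ 2)); last first.
  by rewrite ler_wpM2l ?sqr_ge0// bessel.
rewrite mulr_sumr; apply: ler_sum => j _; rewrite DcoefB Dcoef_fin; case: ltnP => jn.
  rewrite ipDl ipNl exprMn ler_wpM2r ?sqr_ge0// ler_sqr ?nnegrE ?powR_ge0//.
  apply: ge0_ler_powR; rewrite ?nnegrE ?alpha_ge0 ?(ltW (lam_gt0 _ _))//.
  by rewrite lam_nondecr// ltnW.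
by rewrite hx// subrr mulr0 expr0n mulr_ge0 ?sqr_ge0.
Qed.

Lemma PnH_finite_dimensional n : finite_dimensional (PnH S n).
Proof.
exists n, (fun i => Dbase S i); apply/seteqP; split=> [_ [u _ <-]|_ [c ->]] /=.
  by exists (fun i => ip S (Dval u) (e i)).
apply/PnHP => j nj; rewrite Dcoef_sum big1// => i _; rewrite DcoefZ Dcoef_base.
have /negbTE -> : (i : nat) != j by rewrite neq_ltn (leq_trans _ nj).
by rewrite mulr0.
Qed.

Definition QnH n : set X := [set u | forall j, (j < n)%N -> Dcoef u j = 0].

Lemma PnH_QnH_direct n : direct_sum (PnH S n) (QnH n).
Proof.
split=> [x|].
  exists (Dproj n x), (Dcoproj n x); split; [exact: PnH_proj| |by rewrite /Dcoproj addrC subrK].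
  by move=> j jn; rewrite Dcoef_coproj jn.
apply/seteqP; split=> [x [/PnHP h1 h2]|_ ->].
  by apply: Dcoef_inj => j; rewrite Dcoef0; have [/h2|/h1] := ltnP j n.
by split; [apply/PnHP => j _|move=> j _]; rewrite Dcoef0.
Qed.

(** The graph is the zero set of y -> Q_n y - q(P_n y), which is Lipschitz because q is evaluated at
    projections only. *)
Lemma lipschitz_graph_closed n (q : X -> X) (K : R) :
  (forall x, PnH S n x -> QnH n (q x)) ->
  (forall x y, PnH S n x -> PnH S n y -> `|q x - q y| <= K * `|x - y|) ->
  closed [set x + q x | x in PnH S n].
Proof.
move=> qQ qK; pose G y := Dcoproj n y - q (Dproj n y).
have cG : continuous G.
  apply: (@lipschitz_continuous R _ _ _ (1 + `|K|)) => u v.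
  have -> : G u - G v = Dcoproj n (u - v) - (q (Dproj n u) - q (Dproj n v)).
    have -> : Dcoproj n (u - v) = Dcoproj n u - Dcoproj n v.
      by apply: Dcoef_inj => j; rewrite DcoefB !Dcoef_coproj DcoefB; case: ifP => _; rewrite ?subrr.
    have rg (a b c d : X) : a - b - (c - d) = (a - c) - (b - d).
      by rewrite !opprB addrACA [RHS]addrACA; congr (_ + _); exact: addrC.
    exact: rg.
  rewrite mulrDl mul1r; apply: le_trans (ler_normB _ _) _; apply: lerD; first exact: Dnorm_coproj.
  apply: le_trans (qK _ _ (PnH_proj n u) (PnH_proj n v)) _.
  apply: (@le_trans _ _ (`|K| * `|Dproj n u - Dproj n v|)).
    by rewrite ler_wpM2r// ler_norm.
  rewrite ler_wpM2l//; have -> : Dproj n u - Dproj n v = Dproj n (u - v).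
    by apply: Dcoef_inj => j; rewrite DcoefB !Dcoef_proj DcoefB; case: ifP => _; rewrite ?subrr.
  exact: Dnorm_proj.
have -> : [set x + q x | x in PnH S n] = G @^-1` [set 0].
  apply/seteqP; split=> [_ [x hx <-]|y /eqP]; rewrite /= /G.
    have P : Dproj n (x + q x) = x.
      apply: Dcoef_inj => j; rewrite Dcoef_proj DcoefD; case: ltnP => jn.
        by rewrite qQ// addr0.
      by move/PnHP : hx => ->.
    by rewrite /Dcoproj P [x + _]addrC addrK subrr.
  rewrite subr_eq0 => /eqP E; exists (Dproj n y); first exact: PnH_proj.
  by rewrite -E /Dcoproj addrC subrK.
move/continuous_closedP : cG; apply.
by apply: accessible_closed_set1; apply: hausdorff_accessible; exact: norm_hausdorff.
Qed.

(** The distance is below a exactly when a graph point over one of countably many dense base points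
    is closer than a, as graph points depend continuously on their base point. *)
Lemma measurable_graph_dist d (T : measurableType d) n (q : T -> X -> X) (x0 : X) :
  (forall x, PnH S n x -> measurable_fun setT ((fun w => q w x) : T -> borel X)) ->
  (forall w, exists K : R, forall x y, PnH S n x -> PnH S n y ->
     `|q w x - q w y| <= K * `|x - y|) ->
  measurable_fun setT (fun w => inf [set `|x0 - y| | y in [set x + q w x | x in PnH S n]]).
Proof.
move=> mq qK; have [r rP rd] := PnH_dense n.
apply: (measurability _ (RGenInftyO.measurableE R)) => _ [_ [a ->] <-]; rewrite setTI.
have -> : (fun w => inf [set `|x0 - y| | y in [set x + q w x | x in PnH S n]]) @^-1` `]-oo, a[ =
   \bigcup_i [set w | `|x0 - (r i + q w (r i))| < a].
  apply/seteqP; split=> w /=; rewrite ?in_itv /=.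
    move=> /inf_lt [|_ [_ [x hx <-] <-] xa].
      exists `|x0 - (r 0%N + q w (r 0%N))|; exists (r 0%N + q w (r 0%N)) => //.
      by exists (r 0%N).
    have [K hK] := qK w.
    (* Moving the base point by d moves the graph point by at most (1 + |K|) d, so this tolerance
       keeps the distance below a. *)
    have d0 : 0 < (a - `|x0 - (x + q w x)|) / (1 + `|K|) by rewrite divr_gt0 ?subr_gt0// ltr_wpDr.
    have [i hi] := rd x hx _ d0; exists i => //=.
    have -> : x0 - (r i + q w (r i)) = x0 - (x + q w x) + ((x - r i) + (q w x - q w (r i))).
      by rewrite [x - _ + _]addrACA -opprD addrA subrK.
    rewrite (le_lt_trans (ler_normD _ _))// -ltrBrDl.
    have hi' : `|x - r i| * (1 + `|K|) < a - `|x0 - (x + q w x)|.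
      by rewrite -ltr_pdivlMr// ltr_wpDr.
    apply: le_lt_trans hi'.
    rewrite mulrDr mulr1 (le_trans (ler_normD _ _))// lerD2l (le_trans (hK _ _ hx (rP i)))//.
    by rewrite mulrC ler_wpM2l// ler_norm.
  move=> [i _ /= ia]; apply: le_lt_trans ia; apply: ge_inf.
    by exists 0 => _ [y _ <-].
  by exists (r i + q w (r i)) => //; exists (r i).
apply: bigcup_measurable => i _.
have c1 : continuous (fun y : X => x0 - (r i + y)).
  apply: (@lipschitz_continuous R X X _ 1) => u v; rewrite mul1r distrC.
  by rewrite opprB addrC addrA subrK opprD addrACA subrr add0r.
have m0 := measurable_borel_comp c1 measurableT (mq _ (rP i)).
have m1 := measurable_borel_real (@norm_continuous R X) measurableT m0.
have := m1 measurableT _ (measurable_itv `]-oo, a[).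
by rewrite setTI preimage_itvNyo.
Qed.

End RandomGraph.

(** An almost period for the tolerance 1 brings t into [0, l], so the maximum of |g| there plus 1 is
    a bound. *)
Lemma almost_periodic_bounded (R : realType) (X : completeNormedModType R) (g : R -> X) : almost_periodic g ->
  exists G, forall t, `|g t| <= G.
Proof.
move=> [cg /(_ 1 ltr01) [l l0 hl]].
have cn : continuous (fun t => `|g t|) by move=> t; apply: cvg_norm; exact: cg.
have [C _ hC] := continuous_bounded 0 l cn.
exists (C + 1) => t; have [t0] := hl (- t); rewrite in_itv /= => /andP[h1 h2] /(_ t) hg.
rewrite -[g t](subKr (g (t + t0))) (le_trans (ler_normB _ _))// lerD ?(ltW hg)//.
by apply: hC; [rewrite -lerBlDl sub0r|rewrite -lerBrDl addrC].
Qed.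

(** With K = 2 L / k one has m - l1 = K l1^a, so the first fraction is 1/K. What the gap leaves for
    l2 - m is at least K (l2^a + c (l2 - l1)^a), so the second is at most 1/K. The total is at most
    2 L / K = k. *)
Lemma gap_contraction (R : realType) (a c l1 l2 L k : R) : 0 <= a -> 0 <= c -> 0 < l1 ->
  0 < l2 -> 0 < L -> 0 < k -> k < 2^-1 ->
  l2 - l1 >= 2 * L / k * (l2 `^ a + l1 `^ a + c * (l2 - l1) `^ a) ->
  let m := l1 + 2 * L / k * l1 `^ a in
  [/\ l1 < m, m < l2 &
   L * (l1 `^ a / (m - l1) + (l2 `^ a + c * (l2 - m) `^ a) / (l2 - m)) < 1].
Proof.
move=> a0 c0 l10 l20 L0 k0 k2 gap m; set K := 2 * L / k.
have K0 : 0 < K by rewrite divr_gt0// mulr_gt0.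
have p1 : 0 < l1 `^ a by exact: powR_gt0.
have p2 : 0 < l2 `^ a by exact: powR_gt0.
have ml : m - l1 = K * l1 `^ a by rewrite /m addrAC subrr add0r.
have lm : l1 < m by rewrite -subr_gt0 ml mulr_gt0.
have h1 : K * (l2 `^ a + c * (l2 - l1) `^ a) <= l2 - m.
  have -> : l2 - m = (l2 - l1) - K * l1 `^ a by rewrite /m opprD addrA.
  rewrite lerBrDr; apply: le_trans gap; apply: le_of_eq.
  by rewrite -/K; ring.
have lm2 : m < l2.
  by rewrite -subr_gt0; apply: lt_le_trans h1; rewrite mulr_gt0// ltr_wpDr// mulr_ge0// powR_ge0.
split => //.
have h2 : (l2 `^ a + c * (l2 - m) `^ a) / (l2 - m) <= K^-1.
  rewrite ler_pdivrMr ?subr_gt0// [leRHS]mulrC ler_pdivlMr// mulrC; apply: le_trans h1.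
  rewrite ler_wpM2l ?(ltW K0)// lerD2l ler_wpM2l//; apply: ge0_ler_powR => //.
  - by rewrite nnegrE subr_ge0 ltW.
  - by rewrite nnegrE subr_ge0 ltW// (lt_trans lm lm2).
  - by rewrite lerD2l lerN2 ltW.
have h3 : l1 `^ a / (m - l1) = K^-1 by rewrite ml invfM mulrCA mulfV ?mulr1// gt_eqF.
rewrite h3; apply: (@le_lt_trans _ _ (L * (K^-1 + K^-1))).
  by rewrite ler_wpM2l ?(ltW L0)// lerD2l.
have -> : L * (K^-1 + K^-1) = k by rewrite /K; field; rewrite ?gt_eqF.
by apply: lt_trans k2 _; rewrite invf_lt1// ltr1n.
Qed.

(** * The inertial manifold *)

Section InertialManifold.
Context (R : realType) (H : completeNormedModType R) (S : setting H).
Local Notation mu := (@lebesgue_measure R).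
Local Notation e := (ebase S).
Local Notation X := (Dalpha S).
Local Notation la j := (lam S j `^ alpha S).
Variables (F : X -> H) (L : R).
Hypothesis L_gt0 : 0 < L.
Hypothesis F_lip : forall a b, `|F a - F b| <= L * `|a - b|.
Hypothesis F0 : F 0 = 0.
Variables (n : nat) (m : R) (kap : R -> R) (q : R).
Hypothesis dich : dichotomy S n m kap q.
Hypothesis Lq1 : L * q < 1.
Hypothesis m_gt0 : 0 < m.
Hypothesis lam_low : forall j, (j < n)%N -> lam S j < m.
Hypothesis lam_high : forall j, (n <= j)%N -> m < lam S j.

Lemma F_growth a : `|F a| <= L * `|a|.
Proof. by have := F_lip a 0; rewrite F0 !subr0. Qed.

(** This is e^(-At) P_n x, which makes sense at all real times. *)
Definition Psg (x : X) (t : R) : X := Dfin S n (fun j => expR (- (lam S j * t)) * Dcoef x j).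

Lemma Psg_continuous x : continuous (Psg x).
Proof.
apply: continuous_Dfin => j t; apply: cvgM; last exact: cvg_cst.
apply: (cvg_comp (fun s => - (lam S j * s)) expR); last exact: continuous_expR.
by apply: cvgN; apply: cvgM; [exact: cvg_cst|exact: cvg_id].
Qed.

Lemma Psg_bound x t : t <= 0 -> expR (m * t) * `|Psg x t| <= `|x|.
Proof.
move=> t0; rewrite mulrC -ler_pdivlMr ?expR_gt0// -expRN mulrC.
rewrite -[expR _]gtr0_norm ?expR_gt0// -normrZ; apply: Dcoef_le_norm => j.
rewrite Dcoef_fin DcoefZ; case: ifP => jn; last by rewrite normr0.
rewrite !normrM ler_wpM2r// !ger0_norm ?expR_ge0// ler_expR lerN2.
by rewrite ler_wnM2r// ltW// lam_low.
Qed.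

Lemma PsgB x y t : Psg x t - Psg y t = Psg (x - y) t.
Proof.
apply: Dcoef_inj => j; rewrite DcoefB !Dcoef_fin DcoefB.
by case: ifP => _; [ring|rewrite subrr].
Qed.

Lemma Psg0 x : PnH S n x -> Psg x 0 = x.
Proof.
move=> /PnHP hx; apply: Dcoef_inj => j; rewrite Dcoef_fin mulr0 oppr0 expR0 mul1r.
by case: ltnP => // /hx ->.
Qed.

Lemma neg_bounded_F (u : R -> X) : neg_bounded m u -> neg_bounded m (fun t => F (u t)).
Proof.
move=> [C hC]; exists (L * C) => t t0.
apply: (@le_trans _ _ (L * (expR (m * t) * `|u t|))).
  by rewrite mulrCA ler_wpM2l ?expR_ge0// F_growth.
by rewrite ler_wpM2l ?(ltW L_gt0)// hC.
Qed.

Lemma neg_bounded_Psg x : neg_bounded m (Psg x).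
Proof. by exists `|x| => t; exact: Psg_bound. Qed.

(** * The Lyapunov-Perron equation for given noise and forcing *)

Section Data.
Variables (Z : R -> X) (h : R -> H).
Hypotheses (cZ : continuous Z) (ch : continuous h).
Hypotheses (bZ : neg_bounded m Z) (bh : neg_bounded m h).

Lemma force_cts u : continuous u -> continuous (force F Z h u).
Proof. by move=> cu t; exact: (force_continuous F_lip (@cZ t) (@ch t) (@cu t)). Qed.

Lemma force_neg_bounded u : neg_bounded m u -> neg_bounded m (force F Z h u).
Proof. by move=> bu; apply: neg_boundedD => //; apply: neg_bounded_F; exact: neg_boundedD. Qed.

Lemma force_admissible u : continuous u -> neg_bounded m u ->
  exists C, admissible m C (neg_cut (force F Z h u)).
Proof. by move=> cu bu; apply: neg_cut_admissible; [exact: force_cts|exact: force_neg_bounded]. Qed.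

(** The equation for xi^* in Green form: with the source cut at 0, the integral of the low modes
    ends there. *)
Definition LPform (x : X) (u : R -> X) : Prop :=
  forall t, t <= 0 -> u t = Psg x t + Lop S n (neg_cut (force F Z h u)) t.

Definition LPnl (x : X) : R -> X -> H := cutN F (fun s => s < 0) (fun s => Psg x s + Z s) h.

Lemma LPnl_nonlinearity x : exists2 C, 0 <= C & nonlinearity m L C (LPnl x).
Proof.
have [C0 hC] : neg_bounded m (fun t => F (Psg x t + Z t) + h t).
  apply: neg_boundedD => //; apply: neg_bounded_F; apply: neg_boundedD => //.
  exact: neg_bounded_Psg.
exists (Num.max C0 0); first by rewrite le_max lexx orbT.
have cPZ : continuous (fun s => Psg x s + Z s).
  by move=> t; apply: cvgD; [exact: Psg_continuous|exact: cZ].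
apply: (cutN_nonlinearity L_gt0 F_lip); [| exact: pcont_cts|exact: pcont_cts| |].
- by rewrite le_max lexx orbT.
- exact: piecewise_const_lt.
- by move=> t t0; rewrite le_max hC// ltW.
Qed.

(** The free term becomes background and p is the fixed point. The convergent iterates are kept for
    the measurability argument. *)
Lemma LP_exists x : exists2 p : R -> X, [/\ continuous p, neg_bounded m p &
    LPform x (fun t => Psg x t + p t)] &
    forall t, picard n (LPnl x) i t @[i --> \oo] --> p t.
Proof.
have [C C00 nl] := LPnl_nonlinearity x.
have [p [cp [B hB] pE pl]] := fixed_point dich (ltW L_gt0) Lq1 nl C00.
exists p => //; split=> // [|t _]; first by exists B.
congr (_ + _); rewrite pE; congr (Lop S n _ t); apply/funext => s.
by rewrite /LPnl /cutN /neg_cut /force; case: ifP => // _; rewrite addrAC.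
Qed.

(** Low modes see only future sources, and those are cut off. At t = 0 this yields P_n u(0) = x. *)
Lemma Lop_low0 f t j C : admissible m C (neg_cut f) -> (j < n)%N -> 0 <= t ->
  Dcoef (Lop S n (neg_cut f) t) j = 0.
Proof.
move=> af jn t0; rewrite (Lop_coef dich t j af) (green_coef_low dich t af jn).
rewrite (_ : Rintegral _ _ _ = 0) ?oppr0//.
transitivity (\int[mu]_(r in `[t, +oo[) (0 : R)); last by rewrite Rintegral_cst// mul0r.
apply: eq_Rintegral => s; rewrite inE /= in_itv /= andbT => ts.
by rewrite /neg_cut ltNge (le_trans t0 ts) /= ip0l mulr0.
Qed.

Lemma LPform_proj x u : continuous u -> neg_bounded m u -> LPform x u -> PnH S n x ->
  Dproj n (u 0) = x.
Proof.
move=> cu bu hu hx; have [C af] := force_admissible cu bu.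
apply: Dcoef_inj => j; rewrite Dcoef_proj hu// Psg0//.
case: ltnP => jn; last by move/PnHP : hx => ->.
by rewrite DcoefD (Lop_low0 af jn) ?addr0.
Qed.

Lemma LPform_coproj x u : continuous u -> neg_bounded m u -> LPform x u -> PnH S n x ->
  Dcoproj n (u 0) = Lop S n (neg_cut (force F Z h u)) 0.
Proof.
move=> cu bu hu hx; rewrite /Dcoproj (LPform_proj cu bu hu hx) hu// Psg0//.
by rewrite addrAC subrr add0r.
Qed.

Lemma LPform_evol x u : continuous u -> neg_bounded m u -> LPform x u ->
  evol `]-oo, 0] (force F Z h u) u.
Proof.
move=> cu bu hu s t st; rewrite /= !in_itv /= => s0 t0 j.
have [C af] := force_admissible cu bu.
rewrite (hu t t0) (hu s s0) !DcoefD (Lop_evol dich af st I I j) !Dcoef_fin.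
have -> : \int[mu]_(x in `[s, t[) (decay S j (t - x) (neg_cut (force F Z h u) x)) =
    \int[mu]_(x in `[s, t[) (decay S j (t - x) (force F Z h u x)).
  apply: eq_Rintegral => r; rewrite inE /= in_itv /= => /andP[sr rt].
  by rewrite /neg_cut (lt_le_trans rt t0).
rewrite addrA; congr (_ + _); rewrite [RHS]mulrDr; congr (_ + _).
case: ifP => _; last by rewrite mulr0.
by rewrite mulrA -expRD; congr (expR _ * _); ring.
Qed.

(** Excludes nonzero homogeneous solutions in the modes above the gap, letting s tend to -oo. *)
Lemma exp_small_eq0 (d A t del : R) : 0 < del ->
  (forall s, s <= t -> `|d| <= A * expR (del * s)) -> d = 0.
Proof.
move=> del0 hd; apply/eqP/negPn/negP => d0.
have nd : 0 < `|d| by rewrite normr_gt0.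
(* By e^x >= 1 + x, this choice makes e^(-del s) exceed |A| / |d|. *)
pose s := Num.min t (- (`|A| / (del * `|d|))).
have st : s <= t by rewrite ge_min lexx.
have sl : `|A| / (del * `|d|) <= - s by rewrite lerNr ge_min lexx orbT.
have := hd s st; rewrite leNgt => /negP; apply.
apply: (@le_lt_trans _ _ (`|A| * expR (del * s))).
  by rewrite ler_wpM2r ?expR_ge0// ler_norm.
rewrite -[s]opprK mulrN expRN ltr_pdivrMr ?expR_gt0//.
apply: (@lt_le_trans _ _ (`|d| * (1 + del * - s))); last first.
  by rewrite ler_wpM2l// expR_ge1Dx.
rewrite mulrDr mulr1 (@le_lt_trans _ _ (`|d| * (del * - s)))// ?ltrDr//.
by move: sl; rewrite ler_pdivrMr ?mulr_gt0// => /le_trans; apply; apply: le_of_eq; ring.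
Qed.

(** The difference of u and its Lyapunov-Perron representation solves the homogeneous equation. Its
    low modes vanish at 0, hence at all earlier times; its high modes would grow backwards like
    e^(-lambda_j s) with lambda_j > m, against the weighted bound. *)
Lemma evol_LPform u : continuous u -> neg_bounded m u ->
  evol `]-oo, 0] (force F Z h u) u -> LPform (Dproj n (u 0)) u.
Proof.
move=> cu bu eu t t0; have [C af] := force_admissible cu bu.
set x := Dproj n (u 0); pose v t := Psg x t + Lop S n (neg_cut (force F Z h u)) t.
have ev s r j : s <= r -> r <= 0 -> Dcoef (u r) j - Dcoef (v r) j =
    expR (- (lam S j * (r - s))) * (Dcoef (u s) j - Dcoef (v s) j).
  move=> sr r0; have s0 := le_trans sr r0.
  rewrite (eu s r sr) ?in_itv//= !DcoefD (Lop_evol dich af sr I I j) !Dcoef_fin.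
  have -> : \int[mu]_(x in `[s, r[) (decay S j (r - x) (neg_cut (force F Z h u) x)) =
    \int[mu]_(x in `[s, r[) (decay S j (r - x) (force F Z h u x)).
    apply: eq_Rintegral => y; rewrite inE /= in_itv /= => /andP[sy yr].
    by rewrite /neg_cut (lt_le_trans yr r0).
  have -> : (if (j < n)%N then expR (- (lam S j * r)) * Dcoef x j else 0) =
     expR (- (lam S j * (r - s))) * (if (j < n)%N then expR (- (lam S j * s)) * Dcoef x j else 0).
    case: ifP => _; last by rewrite mulr0.
    by rewrite mulrA -expRD; congr (expR _ * _); ring.
  have rg (E a b c I : R) : E * a + I - (E * b + (E * c + I)) = E * (a - (b + c)) by ring.
  exact: rg.
apply: Dcoef_inj => j; apply/eqP; rewrite -subr_eq0; apply/eqP.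
case: (ltnP j n) => jn.
  have := ev t 0 j t0 (lexx 0).
  have -> : Dcoef (u 0) j - Dcoef (v 0) j = 0.
    rewrite /v DcoefD (Lop_low0 af jn)// addr0 Psg0; last first.
      by apply/PnHP => i ni; rewrite Dcoef_proj ltnNge ni.
    by rewrite Dcoef_proj jn subrr.
  move=> /esym/eqP; rewrite mulf_eq0 gt_eqF ?expR_gt0//= => /eqP.
  by [].
have [B hB] : neg_bounded m (fun s => u s - v s).
  have [Cu hu] := bu; have [Cp hp] := neg_bounded_Psg x.
  exists (Cu + (Cp + q * C)) => s s0.
  apply: le_trans (lerD (hu s s0) (lerD (hp s s0) (Lop_bound dich s af))).
  rewrite -!mulrDr ler_wpM2l ?expR_ge0// (le_trans (ler_normB _ _))// lerD2l.
  exact: ler_normD.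
apply: (@exp_small_eq0 _ ((la j)^-1 * B * expR (- (lam S j * t))) t (lam S j - m)).
  by rewrite subr_gt0 lam_high.
move=> s st; rewrite (ev s t j st t0) -DcoefB normrM ger0_norm ?expR_ge0//.
have := hB s (le_trans st t0); rewrite mulrC -ler_pdivlMr ?expR_gt0// -expRN => hb.
apply: (@le_trans _ _ (expR (- (lam S j * (t - s))) * ((la j)^-1 * (B * expR (- (m * s)))))).
  rewrite ler_wpM2l ?expR_ge0// (le_trans (Dcoef_bound _ _))// ler_wpM2l//.
  by rewrite invr_ge0 ltW// lam_powR_gt0.
apply: le_of_eq.
transitivity ((la j)^-1 * B * (expR (- (lam S j * (t - s))) * expR (- (m * s)))); first by ring.
rewrite -[RHS]mulrA -!expRD; congr (_ * expR _); ring.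
Qed.

End Data.

(** [eta] measures the change of forcing. The common [Z] drops out of the Lipschitz estimate, and
    the base points enter through [Psg (x1 - x2)], of weighted norm at most |x1 - x2|. *)
Lemma LP_stability Z h1 h2 x1 x2 u1 u2 eta :
  continuous Z -> continuous h1 -> continuous h2 ->
  neg_bounded m Z -> neg_bounded m h1 -> neg_bounded m h2 ->
  continuous u1 -> continuous u2 -> neg_bounded m u1 -> neg_bounded m u2 ->
  LPform Z h1 x1 u1 -> LPform Z h2 x2 u2 ->
  0 <= eta -> (forall s, s < 0 -> expR (m * s) * `|h1 s - h2 s| <= eta) ->
  forall t, expR (m * t) * `|Lop S n (neg_cut (force F Z h1 u1)) t -
     Lop S n (neg_cut (force F Z h2 u2)) t| <= q * (L * `|x1 - x2| + eta) / (1 - L * q).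
Proof.
move=> cZ ch1 ch2 bZ bh1 bh2 c1 c2 b1 b2 f1 f2 eta0 heta.
have [C1 a1] := force_admissible cZ ch1 bZ bh1 c1 b1.
have [C2 a2] := force_admissible cZ ch2 bZ bh2 c2 b2.
apply: (fixed_point_stability dich (ltW L_gt0) Lq1 a1 a2
  (fun t => Lop_bound dich t a1) (fun t => Lop_bound dich t a2) (fun=> erefl) (fun=> erefl)).
move=> s; set p1 := Lop S n _; set p2 := Lop S n _.
have rhs0 : 0 <= L * (expR (m * s) * `|p1 s - p2 s|) by rewrite !mulr_ge0 ?expR_ge0// ltW.
rewrite /neg_cut; case: ifP => s0; last first.
  by rewrite subrr normr0 mulr0 addr_ge0// addr_ge0// mulr_ge0// ltW.
have eF : `|force F Z h1 u1 s - force F Z h2 u2 s| <= L * `|u1 s - u2 s| + `|h1 s - h2 s|.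
  rewrite /force opprD addrACA (le_trans (ler_normD _ _))// lerD2r (le_trans (F_lip _ _))//.
  by rewrite opprD addrACA subrr addr0.
have eu : `|u1 s - u2 s| <= `|Psg (x1 - x2) s| + `|p1 s - p2 s|.
  by rewrite (f1 s (ltW s0)) (f2 s (ltW s0)) opprD addrACA -PsgB ler_normD.
apply: (@le_trans _ _ (expR (m * s) * (L * (`|Psg (x1 - x2) s| + `|p1 s - p2 s|) + `|h1 s - h2 s|))).
  rewrite ler_wpM2l ?expR_ge0// (le_trans eF)// lerD2r ler_wpM2l// ltW//.
rewrite mulrDr mulrCA mulrDr [L * (_ + _)]mulrDr [X in X + _]addrC -addrA lerD2l lerD//.
  by rewrite ler_wpM2l ?(ltW L_gt0)// Psg_bound// ltW.
exact: heta.
Qed.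

Lemma LP_unique Z h x u1 u2 :
  continuous Z -> continuous h -> neg_bounded m Z -> neg_bounded m h ->
  continuous u1 -> continuous u2 -> neg_bounded m u1 -> neg_bounded m u2 ->
  LPform Z h x u1 -> LPform Z h x u2 -> forall t, t <= 0 -> u1 t = u2 t.
Proof.
move=> cZ ch bZ bh c1 c2 b1 b2 f1 f2 t t0.
have := LP_stability cZ ch ch bZ bh bh c1 c2 b1 b2 f1 f2 (lexx 0).
rewrite subrr normr0 mulr0 addr0 mulr0 mul0r => hs.
have : expR (m * t) * `|Lop S n (neg_cut (force F Z h u1)) t -
     Lop S n (neg_cut (force F Z h u2)) t| <= 0.
  by apply: hs => s _; rewrite subrr normr0 mulr0.
rewrite pmulr_rle0 ?expR_gt0// normr_le0 subr_eq0 => /eqP E.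
exact: etrans (f1 t t0) (etrans (congr1 (fun y => Psg x t + y) E) (esym (f2 t t0))).
Qed.

(** * Half-orbits and the random sets M *)

Variables (z : Omega H -> X) (g : R -> X) (G : R).
Hypothesis z_cts : forall w, continuous (fun t => z (theta t w)).
Hypothesis z_bnd : forall w, neg_bounded m (fun t => z (theta t w)).
Hypothesis g_cts : continuous g.
Hypothesis g_bnd : forall t, `|g t| <= G.

Definition noise (w : Omega H) (t : R) : X := z (theta t w).
Definition forcing (tau t : R) : H := Dval (g (t + tau)).

Let gs tau : R -> X := fun s => g (s + tau).

Lemma gs_cts tau : continuous (gs tau).
Proof. exact: continuous_shift. Qed.

Lemma forcing_cts tau : continuous (forcing tau).
Proof.
by move=> t; apply: (continuous_comp (f := gs tau) (g := @Dval R H S)); [exact: gs_cts|exact: Dval_continuous].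
Qed.

Lemma forcing_bnd tau : neg_bounded m (forcing tau).
Proof.
exists ((la 0%N)^-1 * G) => t t0; rewrite -[leRHS]mul1r ler_pM ?expR_ge0//.
  by rewrite -expR0 ler_expR mulr_ge0_le0// ltW.
rewrite (le_trans (norm_le_Dnorm _))// ler_wpM2l//.
by rewrite invr_ge0 ltW// lam_powR_gt0.
Qed.

Local Notation frc tau w := (force F (noise w) (forcing tau)).

Lemma frc_cts tau w u : continuous u -> continuous (frc tau w u).
Proof. exact: (force_cts (@z_cts w) (@forcing_cts tau)). Qed.

Definition half_solution tau w (u : R -> X) : Prop :=
  [/\ continuous u, neg_bounded m u & evol `]-oo, 0] (frc tau w u) u].

(** Clamping time at 0 makes xi continuous on R. By existence and uniqueness of mild solutions, the
    identities for [vsol] over all r <= t <= 0 are the evolution relation. *)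
Lemma MsetP tau w y : Mset F z m g tau w y <->
  exists2 u, half_solution tau w u & u 0 = y.
Proof.
split=> [[xi [[cxi [C hC]] hv xi0]]|[u [cu [C hC] eu] u0]]; last first.
  exists u; split => //; first by split; [exact: continuous_subspaceT|exists C].
  move=> r t rt t0; apply: (vsol_unique L_gt0 F_lip (@z_cts w) (@gs_cts tau) cu (T := 0)) => //.
  by move=> s rs s0 j; apply: eu; rewrite //= in_itv//= (le_trans rs).
pose u t := xi (Num.min t 0).
have uE t : t <= 0 -> u t = xi t by move=> t0; rewrite /u (min_idPl t0).
exists u; last by rewrite uE.
split.
- apply: (within_continuous_comp (phi := fun t : R => Num.min t 0) cxi).
    by apply: continuous_minc => x; exact: cvg_id.
  by move=> t; rewrite /= in_itv /= ge_min lexx orbT.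
- by exists C => t t0; rewrite uE// hC.
- move=> s t st; rewrite /= !in_itv /= => s0 t0 j.
  have [v [cv vE] bv] := vsol_spec L_gt0 F_lip s (xi s) (@z_cts w) (@gs_cts tau).
  have vx r : s <= r -> r <= 0 -> v r = u r.
    by move=> sr r0; rewrite -vE// uE// hv.
  rewrite -vx// (bv 0 t st t0) uE//; congr (_ + _).
  apply: eq_Rintegral => r; rewrite inE /= in_itv /= => /andP[sr rt].
  by rewrite /force vx// (le_trans (ltW rt)).
Qed.

(** Joins the two descriptions behind M and m: weighted-bounded backward orbits, and solutions of
    the integral equation with parameter P_n u(0). *)
Lemma half_solutionP tau w u x : PnH S n x -> continuous u -> neg_bounded m u ->
  (LPform (noise w) (forcing tau) x u <-> half_solution tau w u /\ Dproj n (u 0) = x).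
Proof.
move=> hx cu bu.
have cZ : continuous (noise w) := @z_cts w; have bZ : neg_bounded m (noise w) := z_bnd w.
have ch := @forcing_cts tau; have bh := forcing_bnd tau.
split=> [hu|[[_ _ eu] <-]].
  split; last exact: (LPform_proj cZ ch bZ bh cu bu hu hx).
  by split => //; exact: (LPform_evol cZ ch bZ bh cu bu hu).
exact: (evol_LPform cZ ch bZ bh cu bu eu).
Qed.

(** Starting at tau along theta_(-tau) omega is starting at 0 along omega with forcing g^tau, by the
    group law of theta and a change of variable. This reduces [Phi] to the flow started at time
    0. *)
Lemma vsol_shift (w : Omega H) tau t v0 : 0 <= t ->
  vsol F z (t + tau) tau (theta (- tau) w) g v0 = vsol F z t 0 w (gs tau) v0.
Proof.
move=> t0; have [u [cu uE] bu] := vsol_spec L_gt0 F_lip 0 v0 (@z_cts w) (@gs_cts tau).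
rewrite uE//; pose u' s := u (s - tau).
have cu' : continuous u' by exact: continuous_shift.
have Zw' : continuous (fun s => z (theta s (theta (- tau) w))) by exact: z_cts.
suff bu' : base_eq F (fun s => z (theta s (theta (- tau) w))) (fun s => Dval (g s)) tau (t + tau) v0 u'.
  rewrite (vsol_unique L_gt0 F_lip Zw' g_cts cu' bu') ?lexx//.
    by rewrite /u' addrK.
  by rewrite lerDr.
move=> s ts st j; rewrite /u' (bu t (s - tau)) ?subr_ge0 ?lerBlDr//.
rewrite subr0; congr (_ + _).
pose f := force F (fun s => z (theta s w)) (fun s => Dval (gs tau s)) u.
have cf : continuous f by exact: (@frc_cts tau w _ cu).
pose k x := ((fun x => decay S j (s - tau - x) (f x)) \_ `[0, s - tau[) x.
have mk : measurable_fun setT k.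
  apply/(measurable_restrictT _ _).1 => //; exact: measurable_decay_ip.
rewrite [LHS]Rintegral_mkcond -(Rintegral_shift (- tau) mk) [RHS]Rintegral_mkcond.
apply: eq_Rintegral => x _; rewrite /k !patchE !mem_setE !in_itv /= subr_ge0 ltrD2r.
case: ifP => // _; congr (expR _ * _); first by ring.
by rewrite /f /force /u' /gs theta_theta subrK.
Qed.

Lemma PhiE tau w t u0 : 0 <= t ->
  Phi F z g t tau w u0 = vsol F z t 0 w (gs tau) (u0 - z w) + z (theta t w).
Proof.
move=> t0; rewrite /Phi /usol !theta_theta subrr theta0 vsol_shift//.
by rewrite addrK.
Qed.

Lemma half_solution_shift tau w u a T : continuous u -> neg_bounded m u ->
  evol `]-oo, T] (frc tau w u) u -> a <= T ->
  half_solution (tau + a) (theta a w) (fun s => u (s + a)).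
Proof.
move=> cu bu eu aT; split.
- exact: continuous_shift.
- exact: neg_bounded_shift.
- have := @evol_shift R H S `]-oo, T]%classic `]-oo, 0]%classic a (frc tau w u) u.
  have -> : (fun r => frc tau w u (r + a)) = frc (tau + a) (theta a w) (fun s => u (s + a)).
    apply/funext => r; rewrite /force /noise /forcing theta_theta.
    by rewrite -addrA [a + tau]addrC.
  apply => //.
  + move=> j; apply: measurable_funTS; apply: continuous_measurable_fun => r.
    by apply: ip_cvg; exact: frc_cts.
  + move=> s t _; rewrite /= in_itv /= => tT r; rewrite /= !in_itv /= => /andP[_ rt].
    by rewrite (le_trans (ltW rt)).
  + move=> t; rewrite /= !in_itv /= => t0; apply: le_trans aT.
    by rewrite gerDr.
Qed.

Lemma vsol_evol tau w y T : 0 <= T -> exists2 v : R -> X,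
  continuous v /\ (forall t, 0 <= t -> vsol F z t 0 w (gs tau) y = v t) &
  v 0 = y /\ evol `[0, T] (frc tau w v) v.
Proof.
move=> T0; have [v cv bv] := vsol_spec L_gt0 F_lip 0 y (@z_cts w) (@gs_cts tau).
exists v => //; have [m0 [k0 [q0 [d0 _]]]] := @exists_dichotomy0 R H S L L_gt0.
exact: (base_eq_evol F_lip (@z_cts w) (@forcing_cts tau) d0 cv.1 (bv T) T0).
Qed.

(** One inclusion continues a half-orbit by the forward solution and moves the time origin to t; the
    other shifts a half-orbit for (tau + t, theta_t omega) back by t and restarts it at 0. *)
Lemma Mset_invariant tau w t : 0 <= t ->
  [set vsol F z t 0 w (gs tau) y | y in Mset F z m g tau w] = Mset F z m g (tau + t) (theta t w).
Proof.
move=> t0; apply/seteqP; split=> [_ [y /MsetP [u [cu bu eu] u0] <-]|y' /MsetP [u' [cu' bu' eu'] u'0]].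
  have [v [cv vE] [v0 ev]] := vsol_evol tau w y t0.
  (* Each clamped piece equals y on the other side of 0, so subtracting y once gives the glued
     function, continuous by construction. *)
  pose U s := u (Num.min s 0) + v (Num.max s 0) - y.
  have Uu s : s <= 0 -> U s = u s.
    by move=> s0; rewrite /U (min_idPl s0) (max_idPr s0) v0 addrK.
  have Uv s : 0 <= s -> U s = v s.
    by move=> s0; rewrite /U (min_idPr s0) (max_idPl s0) u0 addrAC subrr add0r.
  have cU : continuous U.
    move=> s; apply: cvgB; last exact: cvg_cst; apply: cvgD.
      apply: (continuous_comp (f := fun s : R => Num.min s 0) (g := u)); last exact: cu.
      by apply: continuous_minc => x; exact: cvg_id.
    apply: (continuous_comp (f := fun s : R => Num.max s 0) (g := v)); last exact: cv.
    by apply: continuous_maxc => x; exact: cvg_id.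
  have bU : neg_bounded m U by have [C hC] := bu; exists C => s s0; rewrite Uu// hC.
  have eU : evol `]-oo, t] (frc tau w U) U.
    apply: evol_glue => //; first exact: frc_cts.
      apply: evol_ext eu => [s|s r x]; rewrite /= ?in_itv /=; first by move=> /Uu.
      by move=> _ r0 _ xr; rewrite /force Uu// (le_trans (ltW xr)).
    apply: evol_ext ev => [s|s r x]; rewrite /= ?in_itv /=; first by move=> /andP[/Uv].
    by move=> /andP[s0 _] _ sx _; rewrite /force Uv// (le_trans s0).
  apply/MsetP; exists (fun s => U (s + t)); first exact: (half_solution_shift cU bU eU (lexx t)).
  by rewrite add0r Uv// vE.
pose u s := u' (s - t).
have cu : continuous u by exact: continuous_shift.
have bu : neg_bounded m u by exact: (neg_bounded_shift (- t) cu' bu').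
have eu : evol `]-oo, t] (frc tau w u) u.
  have := @evol_shift R H S `]-oo, 0]%classic `]-oo, t]%classic (- t) _ u' _ _ _ _ eu'.
  have -> : (fun r => frc (tau + t) (theta t w) u' (r + - t)) = frc tau w u.
    apply/funext => r; rewrite /force /noise /forcing theta_theta subrK /u.
    by congr (_ + Dval (g _)); ring.
  apply => //.
  - move=> j; apply: measurable_funTS; apply: continuous_measurable_fun => r.
    by apply: ip_cvg; exact: frc_cts.
  - move=> s r _; rewrite /= in_itv /= => r0 x; rewrite /= !in_itv /= => /andP[_ xr].
    by rewrite (le_trans (ltW xr)).
  - by move=> s; rewrite /= !in_itv /= subr_le0.
exists (u 0).
  apply/MsetP; exists u => //; split => //; apply: evol_sub eu => s /=.
  by rewrite !in_itv /= => /le_trans; apply.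
rewrite (vsol_unique L_gt0 F_lip (@z_cts w) (@gs_cts tau) cu (T := t)) ?lexx//.
  by rewrite /u subrr.
by move=> s s0 st j; apply: eu => //=; rewrite in_itv/= ?t0.
Qed.

(* The tracking orbit is v - e^(-At) Q_n v0 + p for t >= 0 and e^(-At) P_n v0 + p
   for t <= 0, with v the given solution and p a fixed point on the whole line. *)
Lemma Mset_tracking tau w v0 : exists2 y, Mset F z m g tau w y &
  exists C, forall t, 0 <= t -> expR (m * t) *
    `|vsol F z t 0 w (gs tau) v0 - vsol F z t 0 w (gs tau) y| <= C.
Proof.
have [v [cv vE] bv] := vsol_spec L_gt0 F_lip 0 v0 (@z_cts w) (@gs_cts tau).
pose Qs t := Dsg (Num.max t 0) (Dcoproj n v0).
have cQ : continuous Qs by exact: Dsg_continuous.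
have bQ t : 0 <= t -> expR (m * t) * `|Qs t| <= `|v0|.
  move=> t0; rewrite mulrC -ler_pdivlMr ?expR_gt0// -expRN mulrC.
  rewrite -[expR _]gtr0_norm ?expR_gt0// -normrZ; apply: Dcoef_le_norm => j.
  rewrite /Qs (max_idPl t0) Dsg_coef// Dcoef_coproj DcoefZ; case: ltnP => jn.
    by rewrite mulr0 normr0.
  rewrite !normrM ler_wpM2r// !ger0_norm ?expR_ge0// ler_expR lerN2.
  by rewrite ler_wpM2r// ltW// lam_high.
have cP := @Psg_continuous v0.
have cZ : continuous (noise w) := @z_cts w.
have ch := @forcing_cts tau.
(* For t >= 0 the source of p is F(v - Q + p + z) - F(v + z), with Q = [Qs]. At p = 0 it is bounded
   by L |Q| whatever the growth of v, and adding the equation of v turns it into the equation of the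
   tracking orbit. *)
pose b t := if t < 0 then Psg v0 t + noise w t else v t + noise w t - Qs t.
pose c t := if t < 0 then forcing tau t else - F (v t + noise w t).
have pb : pcont b.
  apply: (pcont_if (piecewise_const_lt 0)) => t; first by apply: cvgD; [exact: cP|exact: cZ].
  by apply: cvgB; [apply: cvgD; [exact: cv|exact: cZ]|exact: cQ].
have pc : pcont c.
  apply: (pcont_if (piecewise_const_lt 0)) => // t; apply: cvgN.
  apply: (continuous_comp (f := fun s => v s + noise w s) (g := F)); last exact: (F_continuous F_lip).
  by apply: cvgD; [exact: cv|exact: cZ].
have [C0 hC0] : neg_bounded m (fun t => F (Psg v0 t + noise w t) + forcing tau t).
  apply: neg_boundedD; last exact: forcing_bnd.
  apply: (neg_bounded_F); apply: neg_boundedD; last exact: z_bnd.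
  exact: neg_bounded_Psg.
pose C := Num.max C0 (L * `|v0|).
have C00 : 0 <= C by rewrite le_max mulr_ge0 ?orbT// ltW.
have nl : nonlinearity m L C (cutN F (fun=> true) b c).
  apply: (cutN_nonlinearity L_gt0 F_lip C00 pb pc).
    by exists [::] => t _; near=> s.
  move=> t _; rewrite /b /c le_max; case: ltP => t0; first by rewrite hC0// ltW.
  apply/orP; right; apply: (@le_trans _ _ (L * (expR (m * t) * `|Qs t|))).
    rewrite mulrCA ler_wpM2l ?expR_ge0// (le_trans (F_lip _ _))//.
    by rewrite addrAC subrr add0r normrN.
  by rewrite ler_wpM2l ?(ltW L_gt0)// bQ.
have [p [cp [B hB] pE _]] := fixed_point dich (ltW L_gt0) Lq1 nl C00.
have aG := nl_admissible (ltW L_gt0) nl cp hB.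
have ep : evol setT (fun s => cutN F (fun=> true) b c s (p s)) p.
  apply: evol_ext (Lop_evol dich aG) => // t _; exact/esym/pE.
pose zm t := Psg v0 t + p t.
have czm : continuous zm by move=> t; apply: cvgD; [exact: cP|exact: cp].
pose zp t := v t + (- Qs t + p t).
have czp : continuous zp.
  move=> t; apply: cvgD; first exact: cv.
  by apply: cvgD; [apply: cvgN; exact: cQ|exact: cp].
have vv0 : v 0 = v0.
  apply: Dcoef_inj => j; rewrite (bv 0 0)// subrr mulr0 oppr0 expR0 mul1r.
  by rewrite set_itvxx/= ?set_itvoo0 Rintegral_set0 addr0.
(* The two pieces match because P_n v0 = v0 - Q_n v0. *)
have z0 : zm 0 = zp 0.
  rewrite /zm /zp vv0 /Qs maxxx Dsg0 addrA; congr (_ + _).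
  apply: Dcoef_inj => j; rewrite DcoefB Dcoef_fin Dcoef_coproj mulr0 oppr0 expR0 mul1r.
  by case: ifP => _; [rewrite subr0|rewrite subrr].
have hzm : half_solution tau w zm.
  split => //.
    apply: neg_boundedD; first exact: neg_bounded_Psg.
    by exists B => t _; exact: hB.
  apply: evol_homogeneous.
    move=> s t st _ _ j; rewrite !Dcoef_fin; case: ifP => _; last by rewrite mulr0.
    by rewrite mulrA -expRD; congr (expR _ * _); ring.
  apply: (@evol_ext R H S `]-oo, 0]%classic (fun s => cutN F (fun=> true) b c s (p s)) _ p) => //; last first.
    by apply: evol_sub ep.
  move=> s t r; rewrite /= !in_itv /= => _ t0 _ rt.
  by rewrite /cutN /b /c (lt_le_trans rt t0) /force /zm addrAC.
exists (zm 0); first by apply/MsetP; exists zm.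
exists (`|v0| + B) => t t0; rewrite vE//.
have -> : vsol F z t 0 w (gs tau) (zm 0) = zp t.
  apply: (vsol_unique L_gt0 F_lip (@z_cts w) (@gs_cts tau) czp (T := t)) => //.
  have [m0 [k0 [q0 [d0 _]]]] := @exists_dichotomy0 R H S L L_gt0.
  have [_ ev] := base_eq_evol F_lip (@z_cts w) (@forcing_cts tau) d0 cv (bv t) t0.
  suff ez : evol `[0, t] (frc tau w zp) zp.
    move=> s s0 st j; rewrite z0; apply: ez => //=; rewrite in_itv /= ?lexx//.
      by rewrite s0.
  apply: (evol_add (@frc_cts tau w _ cv) (@frc_cts tau w _ czp) ev).
  apply: evol_homogeneous.
    move=> s r sr; rewrite /= !in_itv /= => /andP[s0 _] /andP[r0 _] j.
    rewrite !DcoefN /Qs (max_idPl s0) (max_idPl r0) !Dsg_coef// mulrN; congr (- _).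
    by rewrite mulrA -expRD; congr (expR _ * _); ring.
  apply: (@evol_ext R H S `[0, t]%classic (fun s => cutN F (fun=> true) b c s (p s)) _ p) => //; last by apply: evol_sub ep.
  move=> s r x; rewrite /= !in_itv /= => /andP[s0 _] _ sx _.
  rewrite /cutN /b /c ltNge (le_trans s0 sx) /= /force /zp.
  rewrite opprD addrACA subrr addr0; congr (F _ - _).
  by rewrite -!addrA; congr (_ + _); rewrite addrC -!addrA.
have -> : v t - zp t = Qs t - p t by rewrite /zp opprD addrA subrr add0r opprD opprK.
apply: le_trans (lerD (bQ t t0) (hB t)).
by rewrite -mulrDr ler_wpM2l ?expR_ge0// ler_normB.
Unshelve. all: by end_near. Qed.

Lemma LPform_coef tau w x u t j : PnH S n x -> continuous u -> neg_bounded m u -> t <= 0 ->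
  Dcoef (Psg x t + Lop S n (neg_cut (frc tau w u)) t) j =
  expR (- (lam S j * t)) * Dcoef x j +
  if (j < n)%N
  then - \int[mu]_(s in `[t, 0]) (decay S j (t - s) (frc tau w u s))
  else \int[mu]_(s in `]-oo, t]) (decay S j (t - s) (frc tau w u s)).
Proof.
move=> /PnHP hx cu bu t0.
have [C af] := force_admissible (@z_cts w) (@forcing_cts tau)
  (z_bnd w) (forcing_bnd tau) cu bu.
rewrite DcoefD (Lop_coef dich t j af) (green_coef_cut dich j (@frc_cts tau w _ cu) af t0) Dcoef_fin.
by case: ltnP => // /hx ->; rewrite mulr0.
Qed.

(** * From the Bochner form of the equation for xi^* to the Green form *)

Section Integrals.
Variables (tau : R) (w : Omega H).
Local Notation lpf v s := (F (v s + z (theta s w)) + Dval (g (s + tau))).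

Lemma lyapunovP x v : PnH S n x ->
  lyapunov_perron F z n m g x w tau v <->
  exists2 u : R -> X, [/\ continuous u, neg_bounded m u & forall t, t <= 0 -> v t = u t] &
    LPform (noise w) (forcing tau) x u.
Proof.
move=> hx; have hx' := (PnHP n x).1 hx.
have sgx t j : t <= 0 -> ip S (semigroup S t (Dval x)) (e j) = expR (- (lam S j * t)) * Dcoef x j.
  move=> t0; have [||//|h1 _] := @semigroup_coef_fin R H S n t (Dval x) (expR (- (lam S n * t))).
  - exact: expR_ge0.
  - by move=> i ni; exact: hx'.
  - by move=> i jn; rewrite ler_expR lerN2 ler_wnM2r// lam_nondecr// ltnW.
  exact: h1.
split=> [[[cv [C hC]] hv]|[u [cu [C hC] vu] hu]].
  pose u t := v (Num.min t 0).
  have uE t : t <= 0 -> u t = v t by move=> t0; rewrite /u (min_idPl t0).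
  have cu : continuous u.
    apply: (within_continuous_comp (phi := fun t : R => Num.min t 0) cv).
      by apply: continuous_minc => y; exact: cvg_id.
    by move=> t; rewrite /= in_itv /= ge_min lexx orbT.
  have bu : neg_bounded m u by exists C => t t0; rewrite uE// hC.
  exists u; first by split => // t t0; rewrite uE.
  move=> t t0; apply: Dcoef_inj => j; rewrite (LPform_coef tau w j hx cu bu t0).
  have [I [J [[_ _ hI] [_ _ hJ] vE]]] := hv t t0.
  rewrite uE// {1}/Dcoef vE !ipDl ipNl sgx// hI hJ -addrA; congr (_ + _).
  have fE s : s <= 0 -> lpf v s = frc tau w u s.
    by move=> s0; rewrite /force uE.
  have EI : \int[mu]_(s in `[t, 0]) ip S (semigroup S (t - s)
      (Defs.proj S n (lpf v s))) (e j) =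
    if (j < n)%N then \int[mu]_(s in `[t, 0]) (decay S j (t - s) (frc tau w u s)) else 0.
    transitivity (\int[mu]_(s in `[t, 0]) (expR (- (lam S j * (t - s))) *
       (if (j < n)%N then ip S (frc tau w u s) (e j) else 0))).
      apply: eq_Rintegral => s; rewrite inE /= in_itv /= => /andP[ts s0].
      by rewrite fE//; have [-> _] := @semigroup_proj R H S n (t - s) (frc tau w u s) ltac:(by rewrite subr_le0).
    case: ifP => _ //; under eq_Rintegral do rewrite mulr0.
    by rewrite Rintegral_cst// mul0r.
  have EJ : \int[mu]_(s in `]-oo, t]) ip S (semigroup S (t - s)
      (Defs.coproj S n (lpf v s))) (e j) =
    if (j < n)%N then 0 else \int[mu]_(s in `]-oo, t]) (decay S j (t - s) (frc tau w u s)).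
    transitivity (\int[mu]_(s in `]-oo, t]) (expR (- (lam S j * (t - s))) *
       (if (j < n)%N then 0 else ip S (frc tau w u s) (e j)))).
      apply: eq_Rintegral => s; rewrite inE /= in_itv /= => st.
      by rewrite fE ?(le_trans st)// semigroup_coproj_coef// subr_ge0.
    case: ifP => _ //; under eq_Rintegral do rewrite mulr0.
    by rewrite /Rintegral integral0.
  by rewrite EI EJ; case: ifP => _; rewrite ?addr0 ?oppr0 ?add0r.
have bu : neg_bounded m u by exists C.
have cf : continuous (frc tau w u) by exact: frc_cts.
have [D af] := force_admissible (@z_cts w) (@forcing_cts tau)
  (z_bnd w) (forcing_bnd tau) cu bu.
split.
  split; last by exists C => t t0; rewrite vu// hC.
  by apply: continuous_within_eq cu _ => t; rewrite /= in_itv /= => t0; rewrite vu.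
move=> t t0.
have fE s : s <= 0 -> lpf v s = frc tau w u s.
  by move=> s0; rewrite /force vu.
have uc j : Dcoef (u t) j = Dcoef (Psg x t + Lop S n (neg_cut (frc tau w u)) t) j.
  by rewrite hu.
(* The witnesses are read off from the equation: its P_n part contains only I and its Q_n part only
   J. *)
exists (semigroup S t (Dval x) - Defs.proj S n (Dval (v t))), (Defs.coproj S n (Dval (v t))); split.
- have cE j s : `[t, 0]%classic s -> ip S (semigroup S (t - s)
      (Defs.proj S n (lpf v s))) (e j) =
      expR (- (lam S j * (t - s))) * (if (j < n)%N then ip S (frc tau w u s) (e j) else 0).
    rewrite /= in_itv /= => /andP[ts s0].
    by rewrite fE//; have [-> _] := @semigroup_proj R H S n (t - s) (frc tau w u s) ltac:(by rewrite subr_le0).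
  have mc j : measurable_fun `[t, 0] (fun s => ip S (semigroup S (t - s)
      (Defs.proj S n (lpf v s))) (e j)).
    apply: (eq_measurable_fun (fun s : R => expR (- (lam S j * (t - s))) *
        (if (j < n)%N then ip S (frc tau w u s) (e j) else 0))).
      by move=> s; rewrite inE => st; rewrite cE.
    case: (j < n)%N; first exact: measurable_decay_ip.
    by rewrite (_ : (fun _ => _) = cst 0); [exact: measurable_cst|apply/funext => s; rewrite mulr0].
  apply: is_integral_coord => //.
  + have cBf : continuous (fun s => expR (- (lam S n * t)) *: frc tau w u s).
      by move=> s; apply: cvgZl_tmp; exact: cf.
    apply: le_lt_trans (integral_norm_finite t 0 cBf).
    apply: ge0_le_integral => //=.
    * apply/measurable_EFinP.
      have mb := measurable_coef (measurable_itv `[t, 0]) mc.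
      exact: (measurable_borel_real (@norm_continuous R H) (measurable_itv `[t, 0]) mb).
    * by apply/measurable_EFinP; apply: measurable_funTS; apply: continuous_measurable_fun => s;
        apply: cvg_norm; exact: cBf.
    * move=> s; rewrite /= in_itv /= => /andP[ts s0]; rewrite fE// lee_fin.
      have [_ h2] := @semigroup_proj R H S n (t - s) (frc tau w u s) ltac:(by rewrite subr_le0).
      apply: le_trans h2 _; rewrite normrZ ler_wpM2r// ger0_norm ?expR_ge0//.
      rewrite ler_expR lerN2 ler_wpM2l ?(ltW (lam_gt0 _ _))//.
      by rewrite lerBrDl addrC -lerBrDl subrr.
  + move=> j; rewrite ipDl ipNl sgx// ip_proj vu// -/(Dcoef (u t) j) uc (LPform_coef tau w j hx cu bu t0).
    transitivity (\int[mu]_(s in `[t, 0]) (expR (- (lam S j * (t - s))) *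
        (if (j < n)%N then ip S (frc tau w u s) (e j) else 0))); last first.
      by apply: eq_Rintegral => s; rewrite inE => st; rewrite cE.
    case: ltnP => jn; first by rewrite opprD opprK addrA subrr add0r.
    rewrite hx'// mulr0 subr0; under eq_Rintegral do rewrite mulr0.
    by rewrite Rintegral_cst// mul0r.
- have cE j s : `]-oo, t]%classic s -> ip S (semigroup S (t - s)
      (Defs.coproj S n (lpf v s))) (e j) =
      expR (- (lam S j * (t - s))) * (if (j < n)%N then 0 else ip S (frc tau w u s) (e j)).
    rewrite /= in_itv /= => st.
    by rewrite fE ?(le_trans st)// semigroup_coproj_coef// subr_ge0.
  have mc j : measurable_fun `]-oo, t] (fun s => ip S (semigroup S (t - s)
      (Defs.coproj S n (lpf v s))) (e j)).
    apply: (eq_measurable_fun (fun s : R => expR (- (lam S j * (t - s))) *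
        (if (j < n)%N then 0 else ip S (frc tau w u s) (e j)))).
      by move=> s; rewrite inE => st; rewrite cE.
    case: (j < n)%N; last exact: measurable_decay_ip.
    by rewrite (_ : (fun _ => _) = cst 0); [exact: measurable_cst|apply/funext => s; rewrite mulr0].
  apply: is_integral_coord => //.
  + have E s : `]-oo, t]%classic s -> lpf v s = frc tau w u s.
      by rewrite /= in_itv /= => st; rewrite fE// (le_trans st).
    have mc' j : measurable_fun `]-oo, t] (fun s => ip S (semigroup S (t - s)
        (Defs.coproj S n (frc tau w u s))) (e j)).
      by apply: eq_measurable_fun (mc j) => s; rewrite inE => st; rewrite E.
    apply: le_lt_trans (integral_coproj_finite dich cf af t0 mc').
    apply: le_of_eq.
    by apply: eq_integral => s; rewrite inE => /E ->.
  + move=> j; rewrite ip_coproj vu// -/(Dcoef (u t) j) uc (LPform_coef tau w j hx cu bu t0).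
    transitivity (\int[mu]_(s in `]-oo, t]) (expR (- (lam S j * (t - s))) *
        (if (j < n)%N then 0 else ip S (frc tau w u s) (e j)))); last first.
      by apply: eq_Rintegral => s; rewrite inE => st; rewrite cE.
    case: ltnP => jn.
      under eq_Rintegral do rewrite mulr0.
      by rewrite /Rintegral integral0.
    by rewrite hx'// mulr0 add0r.
- by rewrite /Defs.coproj opprB addrA addrCA subrr addr0 addrAC subrr add0r.
Qed.

End Integrals.

(** [xi_star] is a choice, but solutions of the equation are unique on the half-line, so m can be
    computed from any of them. *)
Lemma mmap_spec tau w x u : PnH S n x -> continuous u -> neg_bounded m u ->
  LPform (noise w) (forcing tau) x u -> mmap F z n m g tau w x = Dcoproj n (u 0).
Proof.
move=> hx cu bu hu; rewrite /mmap; congr Dcoproj.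
have : lyapunov_perron F z n m g x w tau (xi_star F z n m g x w tau).
  rewrite /xi_star; case: xgetP => [v _ //|/(_ u)[]].
  by apply/lyapunovP => //; exists u.
move/(lyapunovP tau w _ hx) => [v [cv bv ->//] hv].
exact: (LP_unique (@z_cts w) (@forcing_cts tau) (z_bnd w) (forcing_bnd tau) cv cu bv bu hv hu).
Qed.

Lemma LP_solution tau w x : exists2 u : R -> X, continuous u /\ neg_bounded m u &
  LPform (noise w) (forcing tau) x u.
Proof.
have [p [cp bp hp] _] := LP_exists (@z_cts w)
  (@forcing_cts tau) (z_bnd w) (forcing_bnd tau) x.
exists (fun t => Psg x t + p t) => //; split.
  by move=> t; apply: cvgD; [exact: Psg_continuous|exact: cp].
by apply: neg_boundedD => //; exact: neg_bounded_Psg.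
Qed.

Lemma Mset_graph tau w : Mset F z m g tau w = [set x + mmap F z n m g tau w x | x in PnH S n].
Proof.
apply/seteqP; split=> [y /MsetP [u hu <-]|_ [x hx <-]].
  have [cu bu _] := hu; have hx : PnH S n (Dproj n (u 0)) by exists (u 0).
  exists (Dproj n (u 0)) => //; rewrite (mmap_spec (u := u) hx cu bu).
    by rewrite /Dcoproj addrC subrK.
  by apply/(half_solutionP tau w hx cu bu).
have [u [cu bu] hu] := LP_solution tau w x.
apply/MsetP; exists u.
  by apply (half_solutionP tau w hx cu bu).
rewrite (mmap_spec hx cu bu hu) /Dcoproj.
have /(half_solutionP tau w hx cu bu) [_ ->] := hu.
by rewrite addrC subrK.
Qed.

(** m(x) is the Green part at time 0, where the weight is 1. *)
Lemma mmap_stability tau1 tau2 w x1 x2 eta : PnH S n x1 -> PnH S n x2 -> 0 <= eta ->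
  (forall s, s < 0 -> expR (m * s) * `|forcing tau1 s - forcing tau2 s| <= eta) ->
  `|mmap F z n m g tau1 w x1 - mmap F z n m g tau2 w x2| <=
    q * (L * `|x1 - x2| + eta) / (1 - L * q).
Proof.
move=> h1 h2 eta0 heta.
have [u1 [c1 b1] f1] := LP_solution tau1 w x1; have [u2 [c2 b2] f2] := LP_solution tau2 w x2.
rewrite (mmap_spec h1 c1 b1 f1) (mmap_spec h2 c2 b2 f2).
rewrite (LPform_coproj (@z_cts w) (@forcing_cts tau1) (z_bnd w) (forcing_bnd tau1) c1 b1 f1 h1).
rewrite (LPform_coproj (@z_cts w) (@forcing_cts tau2) (z_bnd w) (forcing_bnd tau2) c2 b2 f2 h2).
have := LP_stability (@z_cts w) (@forcing_cts tau1) (@forcing_cts tau2)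
  (z_bnd w) (forcing_bnd tau1) (forcing_bnd tau2) c1 c2 b1 b2 f1 f2 eta0 heta 0.
by rewrite mulr0 expR0 mul1r.
Qed.

Lemma mmap_low tau w x j : PnH S n x -> (j < n)%N -> Dcoef (mmap F z n m g tau w x) j = 0.
Proof.
move=> hx jn; have [u [cu bu] hu] := LP_solution tau w x.
by rewrite (mmap_spec hx cu bu hu) Dcoef_coproj jn.
Qed.

(** * Measurability of the iterates and of m *)

Section Picard.
Context d (T : measurableType d).
Variables (Z : T -> R -> X) (h : R -> H) (Y : T -> X).
Hypotheses (cZ : forall w, continuous (Z w)) (ch : continuous h).
Hypotheses (bZ : forall w, neg_bounded m (Z w)) (bh : neg_bounded m h).
Hypothesis mZ : forall s, measurable_fun setT ((fun w => Z w s) : T -> borel X).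
Hypothesis mY : measurable_fun setT (Y : T -> borel X).

Local Notation pic w := (picard n (LPnl (Z w) h (Y w))).

(** Each coordinate of the next iterate is an integral over s of a jointly measurable function of
    (omega, s). The base point [Y] is random because m is later evaluated at x - P_n z(omega). *)
Lemma measurable_picard i t : measurable_fun setT ((fun w => pic w i t) : T -> borel X).
Proof.
elim: i t => [t|i ih t] /=; first exact: measurable_cst.
apply: measurable_Dcoef => // j.
have reg w : exists C, admissible m C (fun s => LPnl (Z w) h (Y w) s (pic w i s)) /\ continuous (pic w i).
  have [C C0 nl] := LPnl_nonlinearity (@cZ w) ch (bZ w) bh (Y w).
  have [ci [B B0 bi]] := picard_regular dich (ltW L_gt0) i nl C0.
  by exists (L * B + C); split => //; exact: (nl_admissible (ltW L_gt0) nl ci bi).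
(* The integrand without the cut at s + t = 0, hence continuous in s and of Caratheodory type; the
   cut is restored as a measurable case distinction. *)
pose chi w s := ip S (F (Psg (Y w) (s + t) + Z w (s + t) + pic w i (s + t)) + h (s + t)) (e j).
have cchi w : continuous (chi w).
  have [_ [_ cp]] := reg w.
  suff ck : continuous (fun s => ip S (F (Psg (Y w) s + Z w s + pic w i s) + h s) (e j) : R).
    exact: (@continuous_shift R R^o _ t ck).
  move=> s; apply: ip_cvg; apply: cvgD; last exact: ch.
  apply: (continuous_comp (f := fun s => Psg (Y w) s + Z w s + pic w i s) (g := F)); last exact: (F_continuous F_lip).
  by apply: cvgD; [apply: cvgD; [exact: Psg_continuous|exact: cZ]|exact: cp].
have mchi s : measurable_fun setT (chi ^~ s).
  have ma : measurable_fun setT ((fun w => Psg (Y w) (s + t) + Z w (s + t) + pic w i (s + t)) : T -> borel X).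
    apply: measurable_Dcoef => // l; under eq_fun do rewrite !DcoefD.
    apply: measurable_funD; last exact: measurable_borel_Dcoef.
    apply: measurable_funD; last exact: measurable_borel_Dcoef.
    under eq_fun do rewrite Dcoef_fin.
    by case: (l < n)%N; [apply: measurable_funM; [exact: measurable_cst|exact: measurable_borel_Dcoef]|exact: measurable_cst].
  under eq_fun do rewrite /chi ipDl; apply: measurable_funD; last exact: measurable_cst.
  have mF := measurable_borel_comp (F_continuous F_lip) measurableT ma.
  exact: (measurable_borel_real (@ip_continuous R H S (e j)) measurableT mF).
have mj : measurable_fun setT (fun p : T * R => if p.2 + t < 0 then chi p.1 p.2 else 0).
  apply: measurable_fun_ifT => //; last exact: measurable_caratheodory.
  have m1 : measurable_fun setT (fun p : T * R => p.2 + t).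
    by apply: measurable_funD; [exact: measurable_snd|exact: measurable_cst].
  by apply: measurable_fun_ltr => //; exact: measurable_cst.
have mg : measurable_fun setT (fun p : T * R => green S n j p.2 * (if p.2 + t < 0 then chi p.1 p.2 else 0)).
  apply: measurable_funM => //; exact: (measurableT_comp (measurable_green S n j) measurable_snd).
apply: (eq_measurable_fun (fun w => \int[mu]_s (green S n j s * (if s + t < 0 then chi w s else 0)))).
  move=> w _; have [C [af _]] := reg w.
  rewrite (Lop_coef dich t j af); apply: eq_Rintegral => s _; congr (_ * _).
  by rewrite /LPnl /cutN /chi; case: ifP => // _; rewrite ip0l.
exact: (measurable_Rintegral mg).
Qed.

End Picard.

Hypothesis z_meas : measurable_fun setT (z : Omega H -> borel X).

Lemma measurable_noise s : measurable_fun setT ((fun w => noise w s) : Omega H -> borel X).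
Proof. exact: (measurableT_comp z_meas (@measurable_theta R H s)). Qed.

Lemma measurable_mmap tau (Y : Omega H -> X) : measurable_fun setT (Y : Omega H -> borel X) ->
  (forall w, PnH S n (Y w)) ->
  measurable_fun setT ((fun w => mmap F z n m g tau w (Y w)) : Omega H -> borel X).
Proof.
move=> mY hY; have cf : continuous (forcing tau) by exact: (@forcing_cts tau).
have bf : neg_bounded m (forcing tau) := forcing_bnd tau.
apply: measurable_Dcoef => // j; have [jn|jn] := ltnP j n.
  rewrite (_ : (fun w => _) = cst 0); first exact: measurable_cst.
  by apply/funext => w; rewrite (mmap_low _ _ (hY w) jn).
apply: (@measurable_fun_cvg _ _ R setT
   (fun i w => Dcoef (picard n (LPnl (noise w) (forcing tau) (Y w)) i 0) j)).
  move=> i; apply: measurable_borel_Dcoef => //.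
  by apply: measurable_picard => //; exact: measurable_noise.
move=> w _.
have [p [cp bp hp] pl] := LP_exists (@z_cts w) cf (z_bnd w) bf (Y w).
have cu : continuous (fun t => Psg (Y w) t + p t).
  by move=> t; apply: cvgD; [exact: Psg_continuous|exact: cp].
have bu : neg_bounded m (fun t => Psg (Y w) t + p t).
  by apply: neg_boundedD => //; exact: neg_bounded_Psg.
rewrite (mmap_spec (hY w) cu bu hp).
rewrite Dcoef_coproj ltnNge jn /= DcoefD Dcoef_fin ltnNge jn /= add0r.
by apply: (cvg_comp (fun i => picard n (LPnl (noise w) (forcing tau) (Y w)) i 0) (fun x => Dcoef x j));
  [exact: pl|exact: Dcoef_continuous].
Qed.

(** * The manifold translated by the noise *)

Local Notation mm := (mmap F z n m g).

(* x + z w + m(tau, w)(x) = x' + graph_map tau w x' for x' = x + P_n (z w). *)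
Definition graph_map (tau : R) (w : Omega H) (x : X) : X :=
  mm tau w (x - Dproj n (z w)) + Dcoproj n (z w).

Lemma translated_graph tau w :
  [set x + z w + mm tau w x | x in PnH S n] = [set x + graph_map tau w x | x in PnH S n].
Proof.
have E (a b c : X) : a + b + (c + (z w - b)) = a + z w + c.
  by rewrite addrCA [RHS]addrC; congr (_ + _); rewrite -addrA [b + _]addrC subrK.
apply/seteqP; split=> _ [x hx <-].
  exists (x + Dproj n (z w)); first by apply: PnHD => //; exact: PnH_proj.
  by rewrite /graph_map addrK /Dcoproj E.
exists (x - Dproj n (z w)); first by apply: PnHB => //; exact: PnH_proj.
rewrite /graph_map /Dcoproj -[X in X + (_ + (_ - _))](subrK (Dproj n (z w))).
exact/esym/E.
Qed.

Let q0 : 0 <= q := dich_q_ge0 dich.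
Let Lq0 : 0 < 1 - L * q. Proof. by rewrite subr_gt0. Qed.

Lemma graph_map_low tau w x : PnH S n x -> QnH n (graph_map tau w x).
Proof.
move=> hx j jn; rewrite /graph_map DcoefD Dcoef_coproj jn addr0.
by rewrite (mmap_low)//; apply: PnHB => //; exact: PnH_proj.
Qed.

(** Both shifts by parts of z(omega) cancel in the difference, so the constant does not depend on
    omega. The forcing is measured in H, whence the factor lambda_1^(-alpha). *)
Lemma graph_map_stability tau1 tau2 w x1 x2 eta : PnH S n x1 -> PnH S n x2 -> 0 <= eta ->
  (forall s, `|g (s + tau1) - g (s + tau2)| <= eta) ->
  `|graph_map tau1 w x1 - graph_map tau2 w x2| <=
    q * (L * `|x1 - x2| + (la 0%N)^-1 * eta) / (1 - L * q).
Proof.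
move=> h1 h2 eta0 heta; have -> : graph_map tau1 w x1 - graph_map tau2 w x2 =
    mm tau1 w (x1 - Dproj n (z w)) - mm tau2 w (x2 - Dproj n (z w)).
  have rg (a b c : X) : a + c - (b + c) = a - b by rewrite opprD addrACA subrr addr0.
  exact: rg.
have -> : x1 - x2 = (x1 - Dproj n (z w)) - (x2 - Dproj n (z w)).
  by rewrite opprB addrA subrK.
have c0 : 0 <= (la 0%N)^-1 by rewrite invr_ge0 powR_ge0.
apply: (mmap_stability).
- by apply: PnHB => //; exact: PnH_proj.
- by apply: PnHB => //; exact: PnH_proj.
- exact: mulr_ge0.
move=> s s0; rewrite -[leRHS]mul1r ler_pM ?expR_ge0//.
  by rewrite -expR0 ler_expR mulr_ge0_le0// ltW.
apply: (@le_trans _ _ ((la 0%N)^-1 * `|g (s + tau1) - g (s + tau2)|)).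
  exact: (norm_le_Dnorm (g (s + tau1) - g (s + tau2))).
by rewrite ler_wpM2l.
Qed.

Lemma graph_map_lipschitz tau w : exists K : R, forall x y, PnH S n x -> PnH S n y ->
  `|graph_map tau w x - graph_map tau w y| <= K * `|x - y|.
Proof.
exists (q * L / (1 - L * q)) => x y hx hy.
have := @graph_map_stability tau tau w x y 0 hx hy (lexx 0).
rewrite mulr0 addr0 => h; apply: le_trans (h _) _; first by move=> s; rewrite subrr normr0.
by apply: le_of_eq; ring.
Qed.

Lemma measurable_graph_map tau x : PnH S n x ->
  measurable_fun setT ((fun w => graph_map tau w x) : Omega H -> borel X).
Proof.
move=> hx; have mY : measurable_fun setT ((fun w => x - Dproj n (z w)) : Omega H -> borel X).
  apply: measurable_Dcoef => // j; under eq_fun do rewrite DcoefB Dcoef_proj.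
  apply: measurable_funB; first exact: measurable_cst.
  by case: (j < n)%N; [exact: measurable_borel_Dcoef|exact: measurable_cst].
have mM := measurable_mmap tau mY (fun w => PnHB hx (PnH_proj n (z w))).
apply: measurable_Dcoef => // j; under eq_fun do rewrite DcoefD Dcoef_coproj.
apply: measurable_funD; first exact: measurable_borel_Dcoef.
by case: (j < n)%N; [exact: measurable_cst|exact: measurable_borel_Dcoef].
Qed.

Lemma translated_Mset tau w :
  [set x + z w + mm tau w x | x in PnH S n] = [set y + z w | y in Mset F z m g tau w].
Proof.
rewrite (Mset_graph).
apply/seteqP; split=> [_ [x hx <-]|_ [_ [x hx <-] <-]].
  by exists (x + mm tau w x); [exists x|rewrite addrAC].
by exists x => //; rewrite addrAC.
Qed.

(** [Phi] subtracts the noise before the flow and adds it afterwards, so translation conjugates it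
    to the flow that preserves M. *)
Lemma translated_invariant t tau w : 0 <= t ->
  Phi F z g t tau w @` [set y + z w | y in Mset F z m g tau w] =
  [set y + z (theta t w) | y in Mset F z m g (tau + t) (theta t w)].
Proof.
move=> t0; rewrite -(Mset_invariant tau w t0).
apply/seteqP; split=> [_ [_ [y hy <-] <-]|_ [_ [y hy <-] <-]].
  rewrite (PhiE)// addrK.
  by eexists; [exists y|].
exists (y + z w); first by exists y.
by rewrite (PhiE)// addrK.
Qed.

(** The noise cancels in the difference, so the tracking estimate gives the rate m; adding 1 to |C|
    makes the constant positive. *)
Lemma translated_attracting tau w x :
  exists2 y, [set y + z w | y in Mset F z m g tau w] y &
    exists c1 c2 : R, [/\ 0 < c1, 0 < c2 & forall t, 0 <= t ->
      `|Phi F z g t tau w x - Phi F z g t tau w y| <= c1 * expR (- c2 * t)].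
Proof.
have [y hy [C hC]] := Mset_tracking tau w (x - z w).
exists (y + z w); first by exists y.
exists (`|C| + 1), m; split=> [||t t0]; [by rewrite ltr_wpDl|exact: m_gt0|].
rewrite !(PhiE)// addrK opprD addrACA subrr addr0.
rewrite mulNr expRN -[leLHS](mulKf (lt0r_neq0 (expR_gt0 (m * t)))) mulrC.
rewrite ler_wpM2r ?invr_ge0 ?expR_ge0// (le_trans (hC t t0))//.
by rewrite (le_trans (ler_norm C))// lerDl.
Qed.

Hypothesis g_ap : almost_periodic g.

Lemma graph_map_almost_periodic : pathwise_almost_periodic (PnH S n) graph_map.
Proof.
(* Chosen so that the stability bound becomes eps q / (q + 1); the denominator q + 1 covers q =
   0. *)
move=> eps eps0; pose delta := eps * (1 - L * q) * la 0%N / (q + 1).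
have q1 : 0 < q + 1 by rewrite ltr_wpDl.
have la0 : 0 < la 0%N by exact: lam_powR_gt0.
have d0 : 0 < delta by rewrite divr_gt0// !mulr_gt0.
have [l l0 hl] := g_ap.2 _ d0; exists l => // a; have [tau0 ta ht] := hl a.
exists tau0 => // tau w x hx.
apply: le_trans (graph_map_stability w hx hx (ltW d0) _) _.
  move=> s; have -> : s + (tau + tau0) = s + tau + tau0 by rewrite addrA.
  by rewrite ltW.
rewrite subrr normr0 mulr0 add0r ler_pdivrMr//.
have -> : q * ((la 0%N)^-1 * delta) = eps * (1 - L * q) * (q / (q + 1)).
  by rewrite /delta; field; rewrite ?gt_eqF.
apply: ler_piMr; first by rewrite mulr_ge0// ltW.
by rewrite ler_pdivrMr// mul1r lerDl.
Qed.

Lemma translated_pap : pap_random_inertial_manifold (@theta R H) (Phi F z g)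
  (fun tau w => [set x + z w + mm tau w x | x in PnH S n]).
Proof.
exists (PnH S n), (@QnH R H S n), graph_map; split; last exact: graph_map_almost_periodic.
split.
- split; [split| |exact: PnH_finite_dimensional|exact: PnH_QnH_direct].
  + by apply/PnHP => j _; rewrite Dcoef0.
  + by move=> a x y; exact: PnH_submod.
  + split=> [j _|a x y hx hy j jn]; first by rewrite Dcoef0.
    by rewrite DcoefD DcoefZ hx// hy// mulr0 addr0.
- split.
  + by move=> tau w x; exact: graph_map_low.
  + exact: translated_graph.
  + by move=> tau x; exact: measurable_graph_map.
  + move=> tau w; have [K hK] := graph_map_lipschitz tau w; exists K.
    by move=> [x y] [/= hx hy]; exact: hK.
- move=> tau; split=> [w|x0].
    rewrite translated_graph; have [K hK] := graph_map_lipschitz tau w.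
    by apply: (lipschitz_graph_closed (K := K)) => //; move=> x; exact: graph_map_low.
  under eq_fun do rewrite translated_graph.
  apply: measurable_graph_dist; first by move=> x; exact: measurable_graph_map.
  by move=> w; exact: graph_map_lipschitz.
- move=> t tau w t0.
  apply: etrans (congr1 (fun A => Phi F z g t tau w @` A) (translated_Mset tau w)) _.
  exact: etrans (translated_invariant tau w t0) (esym (translated_Mset (tau + t) (theta t w))).
- by move=> tau w x; rewrite translated_Mset; exact: translated_attracting.
Qed.

End InertialManifold.

Theorem theorem4p1 (R : realType) (H : completeNormedModType R) (S : setting H)
    (Q : {linear H -> H}) (P : probability (Omega H) R)
    (z : Omega H -> Dalpha S)
    (HQ : trace_class_covariance S Q) (HP : wiener_measure S Q P)
    (Hz : stationary_OU P z)
    (F : Dalpha S -> H) (L : R) (n : nat) (k : R) (g : R -> Dalpha S)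
    (L_gt0 : 0 < L)
    (F0 : F 0 = 0)
    (F_lip : forall u1 u2 : Dalpha S,
      `|F u1 - F u2| <= L * `|Apow S (Dval (u1 - u2))|)
    (n_gt0 : (0 < n)%N) (k_gt0 : 0 < k) (k_lt : k < 2^-1)
    (* [lam S n.-1] and [lam S n] are lambda_n and lambda_(n+1) *)
    (gap : lam S n - lam S n.-1 >=
      2 * L / k * (lam S n `^ alpha S + lam S n.-1 `^ alpha S
        + c_const (alpha S) * (lam S n - lam S n.-1) `^ alpha S))
    (g_ap : almost_periodic g) :
  let mu := lam S n.-1 + 2 * L / k * lam S n.-1 `^ alpha S in
  let Mtilde := fun (tau : R) (w : Omega H) =>
    [set x + z w + mmap F z n mu g tau w x | x in PnH S n] in
  (forall tau w, Mtilde tau w = [set y + z w | y in Mset F z mu g tau w]) /\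
  pap_random_inertial_manifold (@theta R H) (Phi F z g) Mtilde.
Proof.
move=> mu Mtilde; have [z_meas _ z_cts z_temp] := Hz.
have [l1m ml2 Lq] := gap_contraction (alpha_ge0 S) (c_const_ge0 (alpha S)) (lam_gt0 S n.-1)
  (lam_gt0 S n) L_gt0 k_gt0 k_lt gap.
have lam_low j : (j < n)%N -> lam S j <= lam S n.-1.
  by move=> jn; apply: lam_nondecr; rewrite -ltnS prednK.
have mu_gt0 : 0 < mu by exact: lt_trans (lam_gt0 S n.-1) l1m.
have hA j : (j < n)%N -> lam S j `^ alpha S <= lam S n.-1 `^ alpha S /\ lam S j <= lam S n.-1.
  move=>  jn; split; last exact: lam_low.
  by apply: ge0_ler_powR; rewrite ?nnegrE ?alpha_ge0 ?(ltW (lam_gt0 _ _))// lam_low.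
(* Here l1 = lambda_n and A = lambda_n^alpha, so q is the quantity controlled by
   [gap_contraction]. *)
have dich := dichotomy_green ml2 l1m (powR_ge0 _ _) hA.
have low j : (j < n)%N -> lam S j < mu by move=> jn; exact: le_lt_trans (lam_low j jn) l1m.
have high j : (n <= j)%N -> mu < lam S j.
  by move=> nj; apply: lt_le_trans ml2 _; exact: lam_nondecr.
(* Temperedness holds for every positive exponent, in particular for mu. *)
have z_bnd w : neg_bounded mu (fun t => z (theta t w)).
  exact: tempered_bounded (z_cts w) (z_temp w mu mu_gt0).
have [G g_bnd] := almost_periodic_bounded g_ap.
split; last first.
  exact: (translated_pap L_gt0 F_lip F0 dich Lq mu_gt0 low high z_cts z_bnd g_ap.1 g_bnd z_meas g_ap).
by move=> tau w; exact: (translated_Mset L_gt0 F_lip F0 dich Lq mu_gt0 low high z_cts z_bnd g_ap.1 g_bnd).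
Qed.
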